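(* Let $G$ be a compact Abelian group and let $\mu_{1},\mu_{2} \in \mathrm{M}(G)$. Then (i) $\mu_{1}\ll \mu_{2}$ (in the usual measure-theoretic sense) if and only if $\widehat{\mu_1} \ll \widehat{\mu_2}$ in $\mathrm{B}(\widehat{G})$; (ii) $\mu_1 \perp \mu_2$ (in the usual measure-theoretic sense) if and only if $\widehat{\mu_1} \perp \widehat{\mu_2}$ in $\mathrm{B}(\widehat{G})$.
   Context: $\mathrm{M}(G)$ is the Banach algebra of complex Borel measures on $G$, and $\widehat{\mu}(\gamma)=\int_G\gamma(-x)\,d\mu(x)$, $\gamma\in\widehat G$, is the Fourier--Stieltjes transform; $\widehat{\mu}\in\mathrm{B}(\widehat G)$. For a discrete group $\Gamma$, the Fourier--Stieltjes algebra $\mathrm{B}(\Gamma)$ is identified with the dual of the full group $C^*$-algebra $C^*(\Gamma)$ via $\langle f,x\rangle=\sum_{g}f(g)x(g)$, $x\in\mathbb{C}[\Gamma]$. For a $C^*$-algebra $A$ and $\varphi\in A^*$ (regarded as a normal functional on the von Neumann algebra $A^{**}$), the central support $\mathrm{zs}(\varphi)$ is the smallest central projection $z\in A^{**}$ such that $\varphi$ vanishes on $(1-z)A^{**}$. For $\varphi,\psi\in A^*$: $\varphi\ll\psi$ means $\mathrm{zs}(\varphi)\leq\mathrm{zs}(\psi)$; $\varphi\perp\psi$ means $\mathrm{zs}(\varphi)\mathrm{zs}(\psi)=0$. These notions are used in $\mathrm{B}(\widehat G)=C^*(\widehat G)^*$, where $\widehat G$ is the (discrete) dual group.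
   Formalization: The measures in M(G) are taken to be regular complex Borel measures (the usual meaning of M(G)); for non-regular Borel measures on a non-metrizable compact group the claim fails, since distinct, mutually singular measures can have the same Fourier–Stieltjes transform. *)

(* Defs.v *)
From HB Require Import structures.
From mathcomp Require Import all_boot all_order all_algebra.
From mathcomp Require Import all_classical all_reals all_analysis.
From mathcomp Require Import complex.

Set Implicit Arguments.
Unset Strict Implicit.
Unset Printing Implicit Defensive.

Import Order.TTheory GRing.Theory Num.Theory.
Import numFieldNormedType.Exports.

Local Notation Re := complex.Re.
Local Notation Im := complex.Im.

Local Open Scope classical_set_scope.
Local Open Scope complex_scope.
Local Open Scope ring_scope.

(* The norm topology of R[i] : the library only provides it on R[i]^o. *)
HB.instance Definition _ (R : realType) := GRing.ComAlgebra.copy R[i] R[i]^o.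
HB.instance Definition _ (R : realType) := NormedModule.copy R[i] R[i]^o.

Section complex_facts.
Context {R : realType}.
Implicit Types z : R[i].

Lemma normc_Re z : `|z| = (Re `|z|)%:C.
Proof. by rewrite normc_def. Qed.

Lemma Re_norm_le z : `|Re z| <= Re `|z|.
Proof.
case: z => a b; rewrite normc_def /= -sqrtr_sqr ler_wsqrtr //.
by rewrite lerDl sqr_ge0.
Qed.

Lemma Im_norm_le z : `|Im z| <= Re `|z|.
Proof.
case: z => a b; rewrite normc_def /= -sqrtr_sqr ler_wsqrtr //.
by rewrite lerDr sqr_ge0.
Qed.

Lemma Re_continuous : continuous (@Re R : R[i] -> R).
Proof.
move=> z; apply/(@cvgrPdist_lt _ _ _ (nbhs z)) => e e0.
have e0' : 0 < e%:C by rewrite ltcR.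
apply: filterS (nbhsx_ballx z _ e0') => w; rewrite -ball_normE /=.
by rewrite normc_Re ltcR; apply: le_lt_trans; rewrite -raddfB Re_norm_le.
Qed.

Lemma Im_continuous : continuous (@Im R : R[i] -> R).
Proof.
move=> z; apply/(@cvgrPdist_lt _ _ _ (nbhs z)) => e e0.
have e0' : 0 < e%:C by rewrite ltcR.
apply: filterS (nbhsx_ballx z _ e0') => w; rewrite -ball_normE /=.
by rewrite normc_Re ltcR; apply: le_lt_trans; rewrite -raddfB Im_norm_le.
Qed.

End complex_facts.

(* Complex C*-algebras, not assumed unital ; cstar is the involution. *)
HB.mixin Record isCStarAlgebra (R : realType) A
    & CompleteNormedModule R[i] A := {
  cmul : A -> A -> A;
  cstar : A -> A;
  cmulA : associative cmul;
  cmulDl : left_distributive cmul +%R;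
  cmulDr : right_distributive cmul +%R;
  cmulZl : forall (c : R[i]) a b, cmul (c *: a) b = c *: cmul a b;
  cmulZr : forall (c : R[i]) a b, cmul a (c *: b) = c *: cmul a b;
  cstarD : {morph cstar : a b / a + b};
  cstarZ : forall (c : R[i]) a, cstar (c *: a) = conjc c *: cstar a;
  cstarM : forall a b, cstar (cmul a b) = cmul (cstar b) (cstar a);
  cstarK : involutive cstar;
  cnormM : forall a b : A, `|cmul a b| <= `|a| * `|b|;
  cnorm_star : forall a : A, `|cmul (cstar a) a| = `|a| ^+ 2;
}.

#[short(type="cstarType")]
HB.structure Definition CStarAlgebra (R : realType) :=
  {A of CompleteNormedModule R[i] A & isCStarAlgebra R A}.

HB.mixin Record isHilbert (R : realType) H
    & CompleteNormedModule R[i] H := {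
  inner : H -> H -> R[i];
  inner_scalar : forall y, scalar (inner^~ y);
  inner_conj : forall x y, inner y x = conjc (inner x y);
  inner_norm : forall x : H, inner x x = `|x| ^+ 2;
}.

#[short(type="hilbertType")]
HB.structure Definition Hilbert (R : realType) :=
  {H of CompleteNormedModule R[i] H & isHilbert R H}.

Section dual_def.
Context {R : realType} (V : normedModType R[i]).

Definition is_dual : {pred V -> R[i]} :=
  fun f => `[< scalar f /\ continuous f >].

Record dual := Dual { dual_fun :> V -> R[i]; _ : dual_fun \in is_dual }.

HB.instance Definition _ := [isSub for dual_fun].
HB.instance Definition _ := [Choice of dual by <:].

Lemma is_dual_submod_closed : submod_closed is_dual.
Proof.
split=> [|a f g /asboolP[fl fc] /asboolP[gl gc]]; apply/asboolP; split.
- by move=> b x y; rewrite /= mulr0 addr0.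
- by move=> x; exact: cvg_cst.
- move=> b x y; have E z : (a *: f + g) z = a * f z + g z by [].
  by rewrite !E fl gl !mulrDr addrACA [a * (b * _)]mulrCA.
- by move=> x; apply: cvgD; [apply: cvgZr; exact: fc|exact: gc].
Qed.

HB.instance Definition _ :=
  GRing.isSubmodClosed.Build R[i] (V -> R[i]) is_dual is_dual_submod_closed.
HB.instance Definition _ := [SubChoice_isSubLmodule of dual by <:].

Lemma dual_scalar (f : dual) : scalar f.
Proof. by case: f => f /= /asboolP[]. Qed.

Lemma dual_continuous (f : dual) : continuous f.
Proof. by case: f => f /= /asboolP[]. Qed.

HB.instance Definition _ (f : dual) :=
  GRing.isLinear.Build R[i] V R[i] *:%R f (dual_scalar f).

Lemma dual_ext (f g : dual) : f =1 g -> f = g.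
Proof. by move=> fg; apply: val_inj; apply/funext. Qed.

Lemma dual_addE (f g : dual) x : (f + g) x = f x + g x.
Proof. by []. Qed.

Lemma dual_scaleE (c : R[i]) (f : dual) x : (c *: f) x = c * f x.
Proof. by []. Qed.

Lemma dual_bounded (f : dual) :
  exists2 M : R[i], 0 <= M & forall x, `|f x| <= M * `|x|.
Proof.
have /linear_boundedP/pinfty_ex_gt0[r r0 fr] :
    bounded_near (f : {linear V -> R[i]}) (nbhs 0).
  by apply/linear_bounded_continuous; exact: dual_continuous.
by exists r => //; exact: ltW.
Qed.

Lemma bounded_is_dual (f : V -> R[i]) : scalar f ->
  (exists2 M : R[i], 0 <= M & forall x, `|f x| <= M * `|x|) -> f \in is_dual.
Proof.
move=> fl [M M0 fM]; apply/asboolP; split => //.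
pose fL := GRing.isLinear.Build R[i] V R[i] *:%R f fl.
pose g : {linear V -> R[i]} := HB.pack f fL.
suff : continuous g by [].
apply: bounded_linear_continuous; apply/linear_boundedP.
exists M; split; first by rewrite ger0_real.
by move=> r Mr x; apply: le_trans (fM x) _; rewrite ler_wpM2r// ltW.
Qed.

Definition mkdual (f : V -> R[i]) (fl : scalar f)
    (fM : exists2 M : R[i], 0 <= M & forall x, `|f x| <= M * `|x|) : dual :=
  Dual (bounded_is_dual fl fM).

(* ‖f‖ = sup {|f x| : ‖x‖ <= 1}; norms are R[i]-valued in the library's normed
   modules over R[i], whence the real part and the injection. *)
Definition dual_norm (f : dual) : R[i] :=
  (sup [set Re `|f x| | x in [set x | `|x| <= 1]])%:C.

Let dual_has_sup (f : dual) :
  has_sup [set Re `|f x| | x in [set x | `|x| <= 1]].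
Proof.
split; first by exists (Re `|f 0|), 0 => //=; rewrite normr0.
have [M M0 fM] := dual_bounded f.
exists (Re M) => _ [x /= x1 <-]; rewrite -lecR -normc_Re.
by rewrite -[M]ger0_norm// in fM *; rewrite -normc_Re (le_trans (fM x))// ler_piMr.
Qed.

Lemma dual_norm_ge0 f : 0 <= dual_norm f.
Proof.
rewrite lecR -[X in X <= _](_ : Re `|f 0| = 0); last by rewrite raddf0 normr0.
by apply: sup_upper_bound; [exact: dual_has_sup|exists 0 => //=; rewrite normr0].
Qed.

Lemma dual_norm_bound (f : dual) x : `|f x| <= dual_norm f * `|x|.
Proof.
have [->|x0] := eqVneq x 0; first by rewrite raddf0 !normr0 mulr0.
have nx0 : 0 < `|x| by rewrite normr_gt0.
rewrite -ler_pdivrMr//.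
have -> : `|f x| / `|x| = `|f (`|x|^-1 *: x)|.
  by rewrite linearZ /= normrM ger0_norm ?invr_ge0// mulrC.
rewrite [leLHS]normc_Re lecR; apply: sup_upper_bound; first exact: dual_has_sup.
by exists (`|x|^-1 *: x) => //=; rewrite normrZ ger0_norm ?invr_ge0// mulVf ?gt_eqF.
Qed.

Lemma dual_norm_le (f : dual) (M : R) :
  (forall x, `|x| <= 1 -> `|f x| <= M%:C) -> dual_norm f <= M%:C.
Proof.
move=> fM; rewrite lecR; apply: ge_sup; first by have [] := dual_has_sup f.
by move=> _ [x /= x1 <-]; rewrite -lecR -normc_Re; exact: fM.
Qed.

Lemma dual_normD (f g : dual) : dual_norm (f + g) <= dual_norm f + dual_norm g.
Proof.
rewrite -raddfD; apply: dual_norm_le => x x1; rewrite raddfD /=.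
apply: le_trans (ler_normD _ _) _.
apply: lerD; apply: le_trans (dual_norm_bound _ _) _;
  by rewrite ler_piMr ?dual_norm_ge0.
Qed.

Lemma dual_norm_eq0 f : dual_norm f = 0 -> f = 0.
Proof.
move=> f0; apply: dual_ext => x; apply/eqP; rewrite -normr_le0.
by rewrite (le_trans (dual_norm_bound f x))// f0 mul0r.
Qed.

Lemma dual_normZ (c : R[i]) (f : dual) : dual_norm (c *: f) = `|c| * dual_norm f.
Proof.
have leZ (a : R[i]) g : dual_norm (a *: g) <= `|a| * dual_norm g.
  rewrite normc_Re -rmorphM; apply: dual_norm_le => x x1.
  rewrite dual_scaleE normrM [leRHS]rmorphM /= -normc_Re; apply: ler_wpM2l => //.
  by rewrite (le_trans (dual_norm_bound _ _))// ler_piMr ?dual_norm_ge0.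
apply/eqP; rewrite eq_le leZ /=.
have [->|c0] := eqVneq c 0; first by rewrite normr0 mul0r dual_norm_ge0.
rewrite -ler_pdivlMl ?normr_gt0// -normfV.
by apply: le_trans (leZ _ _); rewrite scalerA mulVf// scale1r.
Qed.

HB.instance Definition _ :=
  Lmodule_isNormed.Build R[i] dual dual_normD dual_normZ dual_norm_eq0.

Lemma norm_dual_le (f : dual) (M : R[i]) : 0 <= M ->
  (forall x, `|f x| <= M * `|x|) -> `|f| <= M.
Proof.
move=> M0 fM; rewrite -[M]ger0_norm// normc_Re.
apply: dual_norm_le => x x1; rewrite -normc_Re (ger0_norm M0).
by rewrite (le_trans (fM x))// ler_piMr.
Qed.

Lemma dual_le (f : dual) x : `|f x| <= `|f| * `|x|.
Proof. exact: dual_norm_bound. Qed.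

End dual_def.

Section enveloping_von_neumann_algebra.
Context {R : realType} {A : cstarType R}.
Implicit Types (phi psi : dual A) (F E : dual (dual A)) (a b : A).

Lemma cnorm_cstar a : `|cstar a| = `|a|.
Proof.
suff le b : `|b| <= `|cstar b|.
  by apply/eqP; rewrite eq_le le andbT; have := le (cstar a); rewrite cstarK.
have [->|b0] := eqVneq b 0; first by rewrite normr0.
by rewrite -(ler_pM2r (_ : 0 < `|b|)) ?normr_gt0// -expr2 -cnorm_star cnormM.
Qed.

Fact dact_scalar phi a : scalar (fun b => phi (cmul a b)).
Proof. by move=> c x y; rewrite cmulDr cmulZr linearP. Qed.

Fact dact_le phi a b : `|phi (cmul a b)| <= `|phi| * `|a| * `|b|.
Proof.
by rewrite (le_trans (dual_le _ _))// -mulrA ler_wpM2l// cnormM.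
Qed.

Fact dact_bounded phi a :
  exists2 M : R[i], 0 <= M & forall b, `|phi (cmul a b)| <= M * `|b|.
Proof.
by exists (`|phi| * `|a|); [exact: mulr_ge0|exact: dact_le].
Qed.

(* <phi . a, b> = <phi, a b> *)
Definition dact phi a : dual A :=
  mkdual (dact_scalar phi a) (dact_bounded phi a).

Fact dact_norm phi a : `|dact phi a| <= `|phi| * `|a|.
Proof. by apply: norm_dual_le; [exact: mulr_ge0|exact: dact_le]. Qed.

Fact bidact_scalar F phi : scalar (fun a => F (dact phi a)).
Proof.
move=> c x y; rewrite -linearP; congr (dual_fun F _); apply: dual_ext => b.
by rewrite /= cmulDl cmulZl linearP.
Qed.

Fact bidact_le F phi a : `|F (dact phi a)| <= `|F| * `|phi| * `|a|.
Proof.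
by rewrite (le_trans (dual_le _ _))// -mulrA ler_wpM2l// dact_norm.
Qed.

Fact bidact_bounded F phi :
  exists2 M : R[i], 0 <= M & forall a, `|F (dact phi a)| <= M * `|a|.
Proof.
by exists (`|F| * `|phi|); [exact: mulr_ge0|exact: bidact_le].
Qed.

(* <F . phi, a> = <F, phi . a> *)
Definition bidact F phi : dual A :=
  mkdual (bidact_scalar F phi) (bidact_bounded F phi).

Fact bidact_norm F phi : `|bidact F phi| <= `|F| * `|phi|.
Proof. by apply: norm_dual_le; [exact: mulr_ge0|exact: bidact_le]. Qed.

Fact arens_scalar E F : scalar (fun phi => E (bidact F phi)).
Proof.
move=> c x y; rewrite -linearP; congr (dual_fun E _); apply: dual_ext => a.
rewrite -[RHS]/(c * F (dact x a) + F (dact y a)) -dual_scalar /=.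
by congr (dual_fun F _); exact: dual_ext.
Qed.

Fact arens_bounded E F :
  exists2 M : R[i], 0 <= M & forall phi, `|E (bidact F phi)| <= M * `|phi|.
Proof.
exists (`|E| * `|F|) => [|phi]; first exact: mulr_ge0.
by rewrite (le_trans (dual_le _ _))// -mulrA ler_wpM2l// bidact_norm.
Qed.

(* The product of A** : the two Arens products coincide on the bidual of a
   C*-algebra, and are its product as a von Neumann algebra. *)
Definition arens E F : dual (dual A) :=
  mkdual (arens_scalar E F) (arens_bounded E F).

Fact dstar_scalar phi : scalar (fun a => conjc (phi (cstar a))).
Proof.
move=> c x y; rewrite cstarD cstarZ dual_scalar rmorphD rmorphM /=; congr (_ * _ + _).
exact: conjcK.
Qed.

Fact norm_conjc (z : R[i]) : `|conjc z| = `|z|.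
Proof. by case: z => x y; rewrite !normc_def /= sqrrN. Qed.

Fact dstar_le phi a : `|conjc (phi (cstar a))| <= `|phi| * `|a|.
Proof. by rewrite norm_conjc (le_trans (dual_le _ _))// cnorm_cstar. Qed.

Fact dstar_bounded phi :
  exists2 M : R[i], 0 <= M & forall a, `|conjc (phi (cstar a))| <= M * `|a|.
Proof. by exists `|phi| => // a; exact: dstar_le. Qed.

Definition dstar phi : dual A := mkdual (dstar_scalar phi) (dstar_bounded phi).

Fact bidstar_scalar F : scalar (fun phi => conjc (F (dstar phi))).
Proof.
move=> c x y; rewrite (_ : dstar _ = conjc c *: dstar x + dstar y); last first.
  apply: dual_ext => a.
  transitivity (conjc (c * x (cstar a) + y (cstar a))) => //.
  by rewrite rmorphD rmorphM.
rewrite dual_scalar rmorphD rmorphM /=; congr (_ * _ + _).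
exact: conjcK.
Qed.

Fact bidstar_bounded F :
  exists2 M : R[i], 0 <= M & forall phi, `|conjc (F (dstar phi))| <= M * `|phi|.
Proof.
exists `|F| => // phi; rewrite norm_conjc (le_trans (dual_le _ _))//.
by rewrite ler_wpM2l//; apply: norm_dual_le => // a; exact: dstar_le.
Qed.

Definition bidstar F : dual (dual A) :=
  mkdual (bidstar_scalar F) (bidstar_bounded F).

Definition central_projection z :=
  [/\ arens z z = z, bidstar z = z & forall F, arens z F = arens F z].

Definition proj_le z z' := arens z z' = z.

(* phi vanishes on (1 - z) A**, i.e. on every F - z F. *)
Definition vanishes_off phi z := forall F, (F - arens z F) phi = 0.

Definition is_central_support phi z :=
  [/\ central_projection z, vanishes_off phi z &
    forall z', central_projection z' -> vanishes_off phi z' -> proj_le z z'].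

(* The default value 0 is irrelevant : the central support exists. *)
Definition zs phi : dual (dual A) := xget 0 [set z | is_central_support phi z].

Definition functional_ll phi psi := proj_le (zs phi) (zs psi).

Definition functional_perp phi psi := arens (zs phi) (zs psi) = 0.

End enveloping_von_neumann_algebra.

Section group_cstar_algebra.
Context {R : realType} {Gamma : groupType}.

Definition unitary_rep (H : hilbertType R) (pi : Gamma -> H -> H) :=
  [/\ forall g, linear (pi g), forall xi, pi 1%g xi = xi,
      forall g h xi, pi (g * h)%g xi = pi g (pi h xi) &
      forall g xi eta, inner (pi g xi) (pi g eta) = inner xi eta].

(* An element of the group algebra is presented as a finite formal sum
   \sum_(g <- s) x g *: g. *)
Definition universal_norm (s : seq Gamma) (x : Gamma -> R[i]) : R :=
  sup [set r | exists (H : hilbertType R) (pi : Gamma -> H -> H),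
    unitary_rep pi /\ exists2 xi : H, `|xi| <= 1 &
      r = Re `|\sum_(g <- s) x g *: pi g xi| ].

(* (A, u) is the full group C*-algebra of the discrete group Gamma : the
   completion of the *-algebra C[Gamma] for the universal norm. *)
Definition full_group_cstar (A : cstarType R) (u : Gamma -> A) :=
  [/\ forall g h, u (g * h)%g = cmul (u g) (u h),
      forall g, u (g^-1)%g = cstar (u g),
      forall s x, `|\sum_(g <- s) x g *: u g| = (universal_norm s x)%:C &
      dense [set a | exists s x, a = \sum_(g <- s) x g *: u g] ].

(* phi in C*(Gamma)^* is the functional identified with f in B(Gamma). *)
Definition represents (A : cstarType R) (u : Gamma -> A)
    (f : Gamma -> R[i]) (phi : dual A) :=
  forall s x, phi (\sum_(g <- s) x g *: u g) = \sum_(g <- s) f g * x g.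

End group_cstar_algebra.

Section complex_measures.
Local Open Scope ereal_scope.
Context d (T : measurableType d) (R : realType).

(* Only the values on measurable sets are meaningful. *)
Record cmeasure := CMeasure {
  cmeas :> set T -> R[i];
  cmeas_sigma_additive : forall F : (set T)^nat,
    (forall n, measurable (F n)) -> trivIset setT F ->
    (\sum_(0 <= i < n) cmeas (F i))%R @[n --> \oo] --> cmeas (\bigcup_n F n)
}.

Implicit Types mu nu : cmeasure.

Definition total_variation mu (E : set T) : \bar R :=
  ereal_sup [set \sum_(0 <= i <oo) (Re `|mu (F i)|)%:E | F in
    [set F : (set T)^nat | [/\ forall i, measurable (F i),
                               trivIset setT F & \bigcup_i F i = E] ] ].

Definition absolutely_continuous mu nu :=
  total_variation mu `<< total_variation nu.

Definition mutually_singular mu nu := exists E : set T,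
  [/\ measurable E, total_variation mu E = 0 & total_variation nu (~` E) = 0].

Lemma cmeas0 mu : mu set0 = 0%R.
Proof.
have /(_ (fun=> measurable0)) := @cmeas_sigma_additive mu (fun=> set0).
rewrite bigcup0// => h0; have {h0}h := h0 (ltac:(by move=> i j _ _ [x []])).
have {}h : (mu set0 *+ n : R[i])%R @[n --> \oo] --> mu set0.
  by apply: cvg_trans h; apply: near_eq_cvg; near=> n; rewrite sumr_const_nat subn0.
have h1 : (mu set0 *+ n.+1 : R[i])%R @[n --> \oo] --> mu set0.
  by rewrite (@cvg_shiftS _ (fun n => (mu set0 *+ n)%R)).
have := cvgB h1 h; rewrite subrr => /(_ _) h2.
have h3 : ((fun n => mu set0 *+ n.+1) \- (fun n => mu set0 *+ n) : nat -> R[i])%R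
    @ \oo --> mu set0.
  rewrite (_ : _ \- _ = fun=> mu set0)%R; first exact: cvg_cst.
  by apply/funext => n /=; rewrite mulrS addrK.
rewrite -(cvg_lim (@norm_hausdorff _ R[i]) h3).
exact: (cvg_lim (@norm_hausdorff _ R[i]) h2).
Unshelve. all: by end_near. Qed.

Definition cre mu (A : set T) : \bar R := (Re (mu A))%:E.
Definition cim mu (A : set T) : \bar R := (Im (mu A))%:E.

Section charges.
Variable mu : cmeasure.

Let cre0 : cre mu set0 = 0. Proof. by rewrite /cre cmeas0. Qed.
Let cim0 : cim mu set0 = 0. Proof. by rewrite /cim cmeas0. Qed.

Let cre_fin A : measurable A -> cre mu A \is a fin_num. Proof. by []. Qed.
Let cim_fin A : measurable A -> cim mu A \is a fin_num. Proof. by []. Qed.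

Let cre_sigma_additive : semi_sigma_additive (cre mu).
Proof.
move=> F mF tF _; rewrite [X in X @ _](_ : _ = EFin \o (@Re R \o
    (fun n => \sum_(0 <= i < n) mu (F i))%R)).
  apply: (@cvg_comp _ _ _ _ EFin _ (nbhs (Re (mu (\bigcup_n F n)))));
    last exact: cvg_id.
  exact: (cvg_comp _ _ (cmeas_sigma_additive mF tF) (@Re_continuous R _)).
by apply/funext => n; rewrite /= (raddf_sum (@complex.Re R)) sumEFin.

Qed.

Let cim_sigma_additive : semi_sigma_additive (cim mu).
Proof.
move=> F mF tF _; rewrite [X in X @ _](_ : _ = EFin \o (@Im R \o
    (fun n => \sum_(0 <= i < n) mu (F i))%R)).
  apply: (@cvg_comp _ _ _ _ EFin _ (nbhs (Im (mu (\bigcup_n F n)))));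
    last exact: cvg_id.
  exact: (cvg_comp _ _ (cmeas_sigma_additive mF tF) (@Im_continuous R _)).
by apply/funext => n; rewrite /= (raddf_sum (@complex.Im R)) sumEFin.

Qed.

HB.instance Definition _ :=
  isCharge.Build _ _ _ (cre mu) cre0 cre_fin cre_sigma_additive.
HB.instance Definition _ :=
  isCharge.Build _ _ _ (cim mu) cim0 cim_fin cim_sigma_additive.

End charges.

Lemma hahn_ex (nu : {charge set T -> \bar R}) :
  {PN : set T * set T | hahn_decomposition nu PN.1 PN.2}.
Proof.
by apply: cid; have [P [N PN]] := Hahn_decomposition nu; exists (P, N).
Qed.

(* The value does not depend on the Hahn decomposition chosen. *)
Definition charge_integral (nu : {charge set T -> \bar R}) (f : T -> R) : R :=
  (\int[jordan_pos (svalP (hahn_ex nu))]_x f x -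
   \int[jordan_neg (svalP (hahn_ex nu))]_x f x)%R.

Definition cintegral mu (f : T -> R[i]) : R[i] :=
  let fr := @Re R \o f in let fi := @Im R \o f in
  ((charge_integral (cre mu) fr - charge_integral (cim mu) fi) +i*
   (charge_integral (cre mu) fi + charge_integral (cim mu) fr))%R.

End complex_measures.

(* The library's measurable types are pointed. *)
Definition pointed_group (G : topologicalZmodType) : Type := G.
HB.instance Definition _ (G : topologicalZmodType) :=
  Choice.on (pointed_group G).
HB.instance Definition _ (G : topologicalZmodType) :=
  isPointed.Build (pointed_group G) (0 : G).

Definition borel (G : topologicalZmodType) :=
  g_sigma_algebraType (@open G : set (set (pointed_group G))).

Section dual_group.
Context (R : realType) (G : topologicalZmodType).

Definition is_character : {pred G -> R[i]} := fun gamma =>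
  `[< [/\ continuous gamma, forall x y, gamma (x + y) = gamma x * gamma y &
          forall x, `|gamma x| = 1] >].

Record dual_group :=
  Character { char_fun :> G -> R[i]; _ : char_fun \in is_character }.

HB.instance Definition _ := [isSub for char_fun].
HB.instance Definition _ := [Choice of dual_group by <:].

Lemma dual_group_continuous (gamma : dual_group) : continuous gamma.
Proof. by case: gamma => f /= /asboolP[]. Qed.

Lemma dual_groupD (gamma : dual_group) x y :
  gamma (x + y) = gamma x * gamma y.
Proof. by case: gamma => f /= /asboolP[]. Qed.

Lemma dual_group_norm (gamma : dual_group) x : `|gamma x| = 1.
Proof. by case: gamma => f /= /asboolP[]. Qed.

Lemma dual_group_ext (gamma delta : dual_group) :
  gamma =1 delta -> gamma = delta.
Proof. by move=> fg; apply: val_inj; apply/funext. Qed.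

Fact char1_subproof : (fun=> 1) \in is_character.
Proof.
apply/asboolP; split=> [x|x y|x]; [exact: cvg_cst|by rewrite mulr1|].
exact: normr1.
Qed.

Fact charM_subproof (gamma delta : dual_group) :
  (fun x => gamma x * delta x) \in is_character.
Proof.
apply/asboolP; split=> [x|x y|x].
- by apply: cvgM; exact: dual_group_continuous.
- by rewrite !dual_groupD mulrACA.
- by rewrite normrM !dual_group_norm mulr1.
Qed.

Fact charV_subproof (gamma : dual_group) :
  (fun x => gamma (- x)) \in is_character.
Proof.
apply/asboolP; split=> [x|x y|x].
- apply: (@continuous_comp _ _ _ -%R gamma); first exact: opp_continuous.
  exact: dual_group_continuous.
- by rewrite opprD dual_groupD.
- exact: dual_group_norm.
Qed.

Definition char1 := Character char1_subproof.
Definition charM gamma delta := Character (charM_subproof gamma delta).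
Definition charV gamma := Character (charV_subproof gamma).

Fact char_at0 (gamma : dual_group) : gamma 0 = 1.
Proof.
have g0 : gamma 0 != 0 by rewrite -normr_gt0 dual_group_norm.
by apply: (mulfI g0); rewrite -dual_groupD addr0 mulr1.
Qed.

Fact charMA : associative charM.
Proof. by move=> a b c; apply: dual_group_ext => x /=; rewrite mulrA. Qed.
Fact char1M : left_id char1 charM.
Proof. by move=> a; apply: dual_group_ext => x /=; rewrite mul1r. Qed.
Fact charM1 : right_id char1 charM.
Proof. by move=> a; apply: dual_group_ext => x /=; rewrite mulr1. Qed.
Fact charVM : left_inverse char1 charV charM.
Proof.
by move=> a; apply: dual_group_ext => x /=; rewrite -dual_groupD addNr char_at0.
Qed.
Fact charMV : right_inverse char1 charV charM.
Proof.
by move=> a; apply: dual_group_ext => x /=; rewrite -dual_groupD addrN char_at0.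
Qed.

HB.instance Definition _ :=
  isGroup.Build dual_group charMA char1M charM1 charVM charMV.

End dual_group.

Section measures_on_groups.
Context {R : realType} {G : topologicalZmodType}.
Implicit Type mu : cmeasure (borel G) R.

(* |mu| is outer regular by open sets and inner regular by compact sets. *)
Definition regular mu := forall E : set (borel G), measurable E ->
  total_variation mu E = ereal_inf [set total_variation mu U | U in
    [set U | open (U : set G) /\ E `<=` U] ] /\
  total_variation mu E = ereal_sup [set total_variation mu K | K in
    [set K | compact (K : set G) /\ K `<=` E] ].

Definition fourier_stieltjes mu (gamma : dual_group R G) : R[i] :=
  cintegral mu (fun x => gamma (- (x : G))).

End measures_on_groups.

(* Main.v *)
(* The Gelfand transform a |-> j a, sending u gamma to t |-> gamma (- t), identifies
   A with the algebra of continuous functions on G. It is isometric because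
   evaluations are one-dimensional representations of the dual group and because,
   conversely, ||a||^(2^k) = ||a^(2^k)|| for self-adjoint a while the powers of a
   are combinations of polynomially many characters. It is onto because characters
   span a dense subspace: they come from minimal idempotents of the convolution
   algebra, cut out by spectral projections of convolution operators.

   The functional phi represented by the transform of mu thus becomes integration
   against mu. If phi0 is integration against |mu|, the central support z of phi
   acts by sending psi to its part absolutely continuous with respect to phi0, where
   absolute continuity is an epsilon-delta condition on continuous k with values
   in [0, 1]. If psi0 is attached in this way to psi, then phi << psi means that
   phi is absolutely continuous with respect to psi0, and phi _|_ psi that no nonzero
   functional is absolutely continuous with respect to both phi0 and psi0. Urysohn functions squeezed between compact and
   open sets turn these conditions into statements on measurable sets. *)

From HB Require Import structures.
From mathcomp Require Import all_boot all_order all_algebra.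
From mathcomp Require Import all_classical all_reals all_analysis.
From mathcomp Require Import complex.
From mathcomp Require Import ring lra zify.
Require Import Defs.

Set Implicit Arguments.
Unset Strict Implicit.
Unset Printing Implicit Defensive.

Import Order.TTheory GRing.Theory Num.Theory.
Import numFieldNormedType.Exports.

Local Notation Re := complex.Re.
Local Notation Im := complex.Im.

Local Open Scope classical_set_scope.
Local Open Scope complex_scope.
Local Open Scope ring_scope.

(** * Real norms and continuity *)

(** The Haar integral enters only as a mean on continuous functions, the constant uniformly
    approximated by averages of translates. L2 estimates become uniform ones because the sup norm of
    a convolution is bounded by the L2 norms of its factors, so limits are taken among continuous
    functions only. The obstacle in A** is minimality of the central support: an abstract central
    projection is not described by a set. It is seen only through its action on functionals, and the
    decisive fact is [separate]: if F fixes phi and kills y, some continuous k with values in [0, 1]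
    makes |phi|(1 - k) and |y|(k) small. It nearly minimizes |phi|((1 - k)^2) + |y|(k^2); the
    first-order condition nearly equates (1 - k)|phi|, which up to a phase is fixed by F, with k|y|,
    which up to a phase is killed by F. The measure |psi| is never constructed: |psi|(k) is the norm
    of k psi. On the side of measures, [variation] is the sum of four Jordan parts. Comparison with
    the total variation and with |phi| costs factors 2 and 4, harmless since only null sets and
    epsilon-delta conditions matter. *)

Section real_norm.
Context {R : realType}.

(* Norms of modules over R[i] are R[i]-valued; rnorm is the real-valued norm. *)
Definition rnorm {V : normedZmodType R[i]} (x : V) : R := Re `|x|.

Section zmod.
Context {V : normedZmodType R[i]}.
Implicit Types x y z : V.

Lemma normE x : `|x| = (rnorm x)%:C.
Proof. by rewrite /rnorm RRe_real// normr_real. Qed.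

Lemma rnormP x (r : R) : (`|x| <= r%:C) = (rnorm x <= r).
Proof. by rewrite normE lecR. Qed.

Lemma rnorm_ge0 x : 0 <= rnorm x.
Proof. by rewrite -lecR -normE; exact: normr_ge0. Qed.

Lemma rnorm0 : rnorm (0 : V) = 0.
Proof. by rewrite /rnorm normr0. Qed.

Lemma rnorm0_eq0 x : rnorm x = 0 -> x = 0.
Proof. by move=> x0; apply/normr0_eq0; rewrite normE x0. Qed.

Lemma rnormN x : rnorm (- x) = rnorm x.
Proof. by rewrite /rnorm normrN. Qed.

Lemma rdistC x y : rnorm (x - y) = rnorm (y - x).
Proof. by rewrite /rnorm distrC. Qed.

Lemma ler_rnormD x y : rnorm (x + y) <= rnorm x + rnorm y.
Proof. by rewrite -lecR rmorphD /= -!normE ler_normD. Qed.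

Lemma ler_rnormB x y : rnorm (x - y) <= rnorm x + rnorm y.
Proof. by rewrite -(rnormN y) ler_rnormD. Qed.

Lemma ler_rdistD z x y : rnorm (x - y) <= rnorm (x - z) + rnorm (z - y).
Proof. by apply: le_trans (ler_rnormD _ _); rewrite addrA subrK. Qed.

Lemma ler_rnormBD x y : rnorm x <= rnorm (x - y) + rnorm y.
Proof. by apply: le_trans (ler_rnormD _ _); rewrite subrK. Qed.

Lemma ler_rnorm_sum (I : Type) (s : seq I) (P : pred I) (F : I -> V) :
  rnorm (\sum_(i <- s | P i) F i) <= \sum_(i <- s | P i) rnorm (F i).
Proof.
elim/big_ind2 : _ => //; first by rewrite rnorm0.
by move=> a b c d ab cd; apply: le_trans (ler_rnormD _ _) _; exact: lerD.
Qed.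

Lemma rnorm_small x : (forall e, 0 < e -> rnorm x <= e) -> x = 0.
Proof.
move=> xe; apply: rnorm0_eq0; apply/eqP; rewrite eq_le rnorm_ge0 andbT.
by apply/ler_addgt0Pr => e e0; rewrite add0r xe.
Qed.

End zmod.

Lemma rnormZ (V : normedModType R[i]) (c : R[i]) (x : V) :
  rnorm (c *: x) = rnorm c * rnorm x.
Proof. by apply: (@complexI R); rewrite rmorphM/= -!normE normrZ. Qed.

Lemma rnormM (a b : R[i]) : rnorm (a * b) = rnorm a * rnorm b.
Proof. by apply: (@complexI R); rewrite rmorphM/= -!normE normrM. Qed.

Lemma rnorm1 : rnorm (1 : R[i]) = 1.
Proof. by rewrite /rnorm normr1. Qed.

Lemma rnormV (a : R[i]) : rnorm a^-1 = (rnorm a)^-1.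
Proof. by apply: (@complexI R); rewrite fmorphV/= -!normE normfV. Qed.

Lemma rnorm_conj (z : R[i]) : rnorm (conjc z) = rnorm z.
Proof. by rewrite /rnorm norm_conjc. Qed.

Lemma rnormC (r : R) : rnorm r%:C = `|r|.
Proof. by rewrite /rnorm normc_def /= expr0n addr0 sqrtr_sqr. Qed.

Lemma rnormC_ge0 (r : R) : 0 <= r -> rnorm r%:C = r.
Proof. by rewrite rnormC => /ger0_norm. Qed.

Lemma normRe_le (z : R[i]) : `|Re z| <= rnorm z.
Proof. exact: Re_norm_le. Qed.

Lemma normIm_le (z : R[i]) : `|Im z| <= rnorm z.
Proof. exact: Im_norm_le. Qed.

Lemma Re_le_rnorm (z : R[i]) : Re z <= rnorm z.
Proof. exact: le_trans (ler_norm _) (normRe_le _). Qed.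

Lemma rnorm_sqr (z : R[i]) : rnorm z ^+ 2 = Re z ^+ 2 + Im z ^+ 2.
Proof.
apply: (@complexI R); rewrite rmorphXn /= -normE -add_Re2_Im2.
by [].
Qed.

Lemma mulcJ (z : R[i]) : z * conjc z = (rnorm z ^+ 2)%:C.
Proof.
by rewrite rnorm_sqr; case: z => a b /=; apply/eqP; rewrite eq_complex /=; apply/andP;
  split; apply/eqP; ring.
Qed.

Lemma rnorm_le_ReIm (z : R[i]) : rnorm z <= `|Re z| + `|Im z|.
Proof.
case: z => a b; rewrite /= (_ : a +i* b = a%:C + 'i * b%:C); last first.
  by rewrite [LHS]complexE.
apply: le_trans (ler_rnormD _ _) _; rewrite rnormM !rnormC.
suff -> : rnorm ('i : R[i]) = 1 by rewrite mul1r.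
by rewrite /rnorm normc_def /= expr0n add0r expr1n sqrtr1.
Qed.

Lemma ReB (x y : R[i]) : Re (x - y) = Re x - Re y.
Proof. by rewrite raddfB. Qed.
Lemma ReD (x y : R[i]) : Re (x + y) = Re x + Re y.
Proof. by rewrite raddfD. Qed.
Lemma ImB (x y : R[i]) : Im (x - y) = Im x - Im y.
Proof. by rewrite raddfB. Qed.
Lemma conjcB (x y : R[i]) : conjc (x - y) = conjc x - conjc y.
Proof. by rewrite rmorphB. Qed.
Lemma conjcD (x y : R[i]) : conjc (x + y) = conjc x + conjc y.
Proof. by rewrite rmorphD. Qed.
Lemma conjcM (x y : R[i]) : conjc (x * y) = conjc x * conjc y.
Proof. by rewrite rmorphM. Qed.

End real_norm.

Section completeness.
Context {R : realType}.

Lemma cauchy_cvgR (x : nat -> R) :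
  (forall e : R, 0 < e -> exists N, forall n m, (N <= n)%N -> (N <= m)%N ->
     `|x n - x m| <= e) ->
  exists l : R, forall e : R, 0 < e ->
    exists N, forall n, (N <= n)%N -> `|x n - l| <= e.
Proof.
move=> cx; have : cvgn x.
  apply/cauchy_cvgP/cauchy_exP => e e0.
  have [|N xN] := cx (e / 2); first by rewrite divr_gt0.
  exists (x N); exists N => //= n /= Nn; rewrite /ball/=.
  by apply: le_lt_trans (xN _ _ _ _) _ => //; rewrite ltr_pdivrMr// ltr_pMr// ltr1n.
move=> /cvg_ex[l xl]; exists l => e e0.
have /cvgrPdist_le /(_ _ e0) [N _ xN] := xl.
by exists N => n Nn; rewrite distrC; exact: xN.
Qed.

Lemma cauchy_cvgC (x : nat -> R[i]) :
  (forall e : R, 0 < e -> exists N, forall n m, (N <= n)%N -> (N <= m)%N ->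
     rnorm (x n - x m) <= e) ->
  exists l : R[i], forall e : R, 0 < e ->
    exists N, forall n, (N <= n)%N -> rnorm (x n - l) <= e.
Proof.
move=> cx.
have [a ha] : exists l : R, forall e : R, 0 < e ->
    exists N, forall n, (N <= n)%N -> `|Re (x n) - l| <= e.
  apply: cauchy_cvgR => e /cx[N xN]; exists N => n m Nn Nm.
  by rewrite -ReB; apply: le_trans (normRe_le _) _; exact: xN.
have [b hb] : exists l : R, forall e : R, 0 < e ->
    exists N, forall n, (N <= n)%N -> `|Im (x n) - l| <= e.
  apply: cauchy_cvgR => e /cx[N xN]; exists N => n m Nn Nm.
  by rewrite -ImB; apply: le_trans (normIm_le _) _; exact: xN.
exists (a +i* b) => e e0; have e2 : 0 < e / 2 by rewrite divr_gt0.
have [N aN] := ha _ e2; have [M bM] := hb _ e2.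
exists (maxn N M) => n; rewrite geq_max => /andP[Nn Mn].
apply: le_trans (rnorm_le_ReIm _) _; rewrite ReB ImB /=.
by rewrite [e]splitr lerD ?aN ?bM.
Qed.

(** Completeness makes [R[i]] a Hilbert space, the carrier of the one-dimensional representations in
    [trig_le_comb]. *)
Lemma complex_complete (F : set_system R[i]) :
  ProperFilter F -> cauchy F -> cvg F.
Proof.
move=> FF /cauchy_ballP cF.
have cFr (e : R) : 0 < e -> \forall x & y \near F, rnorm (x - y) < e.
  move=> e0; have e0' : 0 < e%:C by rewrite ltcR.
  have := cF _ e0'; apply: filterS => -[x y] /=.
  by rewrite -ball_normE /= normE ltcR.
have /cvg_ex[/= a Fa] : cvg (@Re R @ F).
  apply/cauchy_cvgP/cauchy_ballP => e e0; rewrite near_map2.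
  have := cFr _ e0; apply: filterS => -[x y] /=.
  by rewrite /ball/= -ReB; apply: le_lt_trans (normRe_le _).
have /cvg_ex[/= b Fb] : cvg (@Im R @ F).
  apply/cauchy_cvgP/cauchy_ballP => e e0; rewrite near_map2.
  have := cFr _ e0; apply: filterS => -[x y] /=.
  by rewrite /ball/= -ImB; apply: le_lt_trans (normIm_le _).
apply/cvg_ex; exists (a +i* b); apply/cvgrPdist_le => e e0.
have eE : e = (Re e)%:C by rewrite RRe_real// gtr0_real.
have e0' : 0 < Re e by rewrite -ltcR -eE.
have e2 : 0 < Re e / 2 by rewrite divr_gt0.
move/cvgrPdist_le/(_ _ e2) : Fa => Fa; move/cvgrPdist_le/(_ _ e2) : Fb => Fb.
near=> z; rewrite eE rnormP; apply: le_trans (rnorm_le_ReIm _) _.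
rewrite ReB ImB /= [Re e]splitr lerD//.
  by near: z.
by near: z.
Unshelve. all: by end_near. Qed.

HB.instance Definition _ := Uniform_isComplete.Build R[i] complex_complete.
HB.instance Definition _ := CompleteNormedModule.on R[i].

Fact cinner_scalar (y : R[i]) : scalar ((fun x y : R[i] => x * conjc y)^~ y).
Proof. by move=> a u v; rewrite mulrDl mulrA. Qed.

Fact cinner_conj (x y : R[i]) : y * conjc x = conjc (x * conjc y).
Proof. by rewrite conjcM [conjc (conjc y)]conjcK mulrC. Qed.

Fact cinner_norm (x : R[i]) : x * conjc x = `|x| ^+ 2.
Proof. by rewrite mulcJ rmorphXn /= -normE. Qed.

HB.instance Definition _ :=
  isHilbert.Build R R[i] cinner_scalar cinner_conj cinner_norm.

End completeness.

Section continuity.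
Context {R : realType} {X : topologicalType}.
Implicit Types f g : X -> R[i].

(* Continuity, stated with real tolerances: this keeps the topology of R[i] out
   of unification problems. *)
Definition ccont f :=
  forall x (e : R), 0 < e -> \forall y \near x, rnorm (f y - f x) <= e.

Lemma ccontP f : continuous f <-> ccont f.
Proof.
split=> [cf x e e0|cf x].
  have e0' : 0 < e%:C by rewrite ltcR.
  have /cvgrPdist_le/(_ _ e0') := cf x; apply: filterS => y.
  by rewrite rnormP rdistC.
apply/cvgrPdist_le => e e0.
have eE : e = (Re e)%:C by rewrite RRe_real// gtr0_real.
have e0' : 0 < Re e by rewrite -ltcR -eE.
by have := cf x _ e0'; apply: filterS => y; rewrite eE rnormP rdistC.
Qed.

Lemma ccont_cst (c : R[i]) : ccont (fun _ : X => c).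
Proof. by apply/ccontP => x; exact: cvg_cst. Qed.

Lemma ccontD f g : ccont f -> ccont g -> ccont (fun x => f x + g x).
Proof.
move=> /ccontP cf /ccontP cg; apply/ccontP => x.
by apply: cvgD; [exact: cf|exact: cg].
Qed.

Lemma ccontN f : ccont f -> ccont (fun x => - f x).
Proof. by move=> /ccontP cf; apply/ccontP => x; apply: cvgN; exact: cf. Qed.

Lemma ccontB f g : ccont f -> ccont g -> ccont (fun x => f x - g x).
Proof. by move=> cf cg; apply: ccontD => //; exact: ccontN. Qed.

Lemma ccontM f g : ccont f -> ccont g -> ccont (fun x => f x * g x).
Proof.
move=> /ccontP cf /ccontP cg; apply/ccontP => x.
by apply: cvgM; [exact: cf|exact: cg].
Qed.

Lemma ccontZ (c : R[i]) f : ccont f -> ccont (fun x => c * f x).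
Proof. by move=> cf; apply: ccontM => //; exact: ccont_cst. Qed.

Lemma ccont_conj f : ccont f -> ccont (fun x => conjc (f x)).
Proof.
move=> cf x e e0.
by have := cf x e e0; apply: filterS => y; rewrite -conjcB rnorm_conj.
Qed.

Lemma ccont_real (f : X -> R) : continuous f <-> ccont (fun x => (f x)%:C).
Proof.
split=> [cf x e e0|cf x].
  have /cvgrPdist_le/(_ _ e0) := cf x; apply: filterS => y.
  by rewrite -rmorphB rnormC distrC.
apply/cvgrPdist_le => e e0; have := cf x e e0; apply: filterS => y.
by rewrite -rmorphB rnormC distrC.
Qed.

Lemma ccont_Re f : ccont f -> ccont (fun x => (Re (f x))%:C).
Proof.
move=> cf x e e0; have := cf x e e0; apply: filterS => y.
by rewrite -rmorphB rnormC -ReB; apply: le_trans; exact: normRe_le.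
Qed.

Lemma ccont_Im f : ccont f -> ccont (fun x => (Im (f x))%:C).
Proof.
move=> cf x e e0; have := cf x e e0; apply: filterS => y.
by rewrite -rmorphB rnormC -ImB; apply: le_trans; exact: normIm_le.
Qed.

Lemma ccont_rnorm f : ccont f -> ccont (fun x => (rnorm (f x))%:C).
Proof.
move=> cf x e e0; have := cf x e e0; apply: filterS => y xy.
rewrite -rmorphB rnormC.
rewrite ler_norml; have := ler_rnormBD (f x) (f y); have := ler_rnormBD (f y) (f x).
by rewrite (rdistC (f x)); move: xy; lra.
Qed.

Lemma ccont_sum (I : Type) (s : seq I) (F : I -> X -> R[i]) :
  (forall i, ccont (F i)) -> ccont (fun x => \sum_(i <- s) F i x).
Proof.
move=> cF; elim: s => [|i s ih].
  under eq_fun do rewrite big_nil; exact: ccont_cst.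
by under eq_fun do rewrite big_cons; exact: ccontD.
Qed.

End continuity.

Lemma ccont_comp {R : realType} {X Z : topologicalType} (h : Z -> X)
    (f : X -> R[i]) : continuous h -> ccont f -> ccont (fun z => f (h z)).
Proof. by move=> ch cf z e e0; exact: (ch z _ (cf (h z) e e0)). Qed.

(** * Haar mean and convolution *)

Section compact_uniformity.
Context {R : realType} {X Y : topologicalType}.
Variable F : X -> Y -> R[i].
Hypothesis cptX : compact [set: X].
Hypothesis cF : ccont (fun p : X * Y => F p.1 p.2).

Lemma ccont_sec1 y : ccont (F^~ y).
Proof.
apply: (ccont_comp (h := fun x => (x, y)) _ cF) => x.
by apply: cvg_pair; [exact: cvg_id|exact: cvg_cst].
Qed.

Lemma ccont_sec2 x : ccont (F x).
Proof.
apply: (ccont_comp (h := fun y => (x, y)) _ cF) => y.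
by apply: cvg_pair; [exact: cvg_cst|exact: cvg_id].
Qed.

(** A tube-lemma argument: compactness in the first variable makes continuity in the second one
    uniform. *)
Lemma near_uniform (y0 : Y) (e : R) : 0 < e ->
  \forall y \near y0, forall x, rnorm (F x y - F x y0) <= e.
Proof.
move=> e0; have e2 : 0 < e / 2 by rewrite divr_gt0.
have /compact_near_coveringP nc := cptX.
suff h : forall x, [set: X] x -> \forall x' \near x & y \near y0,
    rnorm (F x' y - F x' y0) <= e.
  have := nc Y (nbhs y0) (fun y x => rnorm (F x y - F x y0) <= e) (nbhs_filter y0) h.
  by apply: filterS => y h' x; exact: h'.
move=> x _; have h1 := @ccont_sec1 y0 x _ e2.
have [[U V] /= [xU yV] UV] := cF (x, y0) e2.
near=> x' y; rewrite [e]splitr.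
apply: le_trans (ler_rdistD (F x y0) _ _) _; apply: lerD.
  apply: (UV (x', y)); split => /=; first by near: x'.
  by near: y.
by rewrite rdistC /=; near: x'.
Unshelve. all: by end_near. Qed.

Lemma uniform_net (e : R) : compact [set: Y] -> 0 < e ->
  exists s : seq Y, forall y, exists2 y0, y0 \in s &
    forall x, rnorm (F x y - F x y0) <= e.
Proof.
move=> /compact_near_coveringP cptY e0.
(* Along the filter of finite sequences ordered by inclusion, the near-covering form of compactness
   yields a finite net. *)
pose fin := filter_from [set: seq Y] (fun s => [set s' : seq Y | {subset s <= s'}]).
have Ffin : Filter fin.
  apply: filter_from_filter; first by exists [::].
  by move=> s t _ _; exists (s ++ t) => // s' /= sub; split=> x xs; apply: sub;
    rewrite mem_cat xs ?orbT.
pose P (s : seq Y) (y : Y) := exists2 y0, y0 \in s & forall x, rnorm (F x y - F x y0) <= e.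
have [|s _ sP] := cptY (seq Y) fin P Ffin.
  move=> y _.
  exists ([set y' | forall x, rnorm (F x y' - F x y) <= e], [set s : seq Y | y \in s]).
    split => /=; first exact: near_uniform.
    by exists [:: y] => // s /=; apply; rewrite mem_head.
  by move=> [y' s] /= [h ys]; exists y.
by exists s => y; exact: (sP s (fun _ h => h) y I).
Qed.

End compact_uniformity.

Section averages.
Context {G : zmodType} {K : numFieldType}.
Implicit Types (s : seq G) (f g : G -> K).

Definition avg s f (x : G) : K := (size s)%:R^-1 * \sum_(t <- s) f (x + t).

Definition addseq s s' := [seq t + t' | t <- s, t' <- s'].

Lemma addseq_nil s s' : s != [::] -> s' != [::] -> addseq s s' != [::].
Proof. by case: s => // a s; case: s'. Qed.

Lemma avg_add s s' f x : avg s (avg s' f) x = avg (addseq s s') f x.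
Proof.
rewrite /avg /addseq size_allpairs big_allpairs_dep natrM invfM -mulrA; congr (_ * _).
rewrite mulr_sumr; apply: eq_bigr => t _; congr (_ * _).
by apply: eq_bigr => t' _; rewrite addrA.
Qed.

(** Averages commute because [G] is commutative. As averaging preserves closeness to a constant
    ([avg_close]), averages good for different functions compose into one good for all of them. *)
Lemma avgC s s' f x : avg s (avg s' f) x = avg s' (avg s f) x.
Proof.
rewrite /avg -!mulr_sumr !mulrA [_^-1 * _]mulrC; congr (_ * _).
rewrite exchange_big /=; apply: eq_bigr => t _; apply: eq_bigr => t' _.
by rewrite addrAC.
Qed.

Lemma avgD s f g x : avg s (fun y => f y + g y) x = avg s f x + avg s g x.
Proof. by rewrite /avg big_split mulrDr. Qed.

Lemma avgZ s (c : K) f x : avg s (fun y => c * f y) x = c * avg s f x.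
Proof. by rewrite /avg -mulr_sumr mulrCA. Qed.

Lemma avg_cst s (c : K) x : s != [::] -> avg s (fun=> c) x = c.
Proof.
move=> s0; rewrite /avg big_const_seq count_predT iter_addr_0 -[c *+ _]mulr_natl mulKf//.
by rewrite pnatr_eq0 size_eq0.
Qed.

Lemma avg_shift s f a x : avg s (fun y => f (y + a)) x = avg s f (x + a).
Proof. by rewrite /avg; congr (_ * _); apply: eq_bigr => t _; rewrite addrAC. Qed.

End averages.

Lemma avg_real {R : realType} {G : zmodType} (s : seq G) (f : G -> R) x :
  avg s (fun y => (f y)%:C) x = (avg s f x)%:C.
Proof. by rewrite /avg rmorphM fmorphV rmorph_nat rmorph_sum. Qed.

Lemma avg_conjc {R : realType} {G : zmodType} (s : seq G) (f : G -> R[i]) x :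
  avg s (fun y => conjc (f y)) x = conjc (avg s f x).
Proof. by rewrite /avg rmorphM fmorphV rmorph_nat rmorph_sum. Qed.

Section mean.
Context {R : realType} {G : topologicalZmodType}.
Hypothesis cptG : compact [set: G].
Implicit Types (s : seq G) (f g : G -> R[i]) (c : R[i]).

Lemma ler_avg s (f g : G -> R) x : (forall y, f y <= g y) -> avg s f x <= avg s g x.
Proof.
move=> fg; rewrite /avg ler_wpM2l ?invr_ge0 ?ler0n//.
by apply: ler_sum => t _; exact: fg.
Qed.

Lemma rnorm_avg s f x : rnorm (avg s f x) <= avg s (fun y => rnorm (f y)) x.
Proof.
rewrite /avg rnormM rnormV ler_pM ?invr_ge0 ?rnorm_ge0//.
  by rewrite -[_%:R](rmorph_nat (real_complex R)) rnormC_ge0 ?ler0n.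
exact: ler_rnorm_sum.
Qed.

Lemma avg_close s f c (e : R) : s != [::] -> (forall x, rnorm (f x - c) <= e) ->
  forall x, rnorm (avg s f x - c) <= e.
Proof.
move=> s0 fc x; rewrite -(avg_cst c x s0) -mulN1r -avgZ -avgD.
apply: le_trans (rnorm_avg _ _ _) _.
rewrite -[leRHS](avg_cst e x s0); apply: ler_avg => y.
by rewrite mulN1r.
Qed.

(** The Haar integral in von Neumann's form; that averages commute makes it unique and additive. *)
Definition is_mean f c := forall e : R, 0 < e ->
  exists2 s, s != [::] & forall x, rnorm (avg s f x - c) <= e.

Lemma is_mean_uniq f c d : is_mean f c -> is_mean f d -> c = d.
Proof.
move=> fc fd; apply/subr0_eq/rnorm_small => e e0.
have e2 : 0 < e / 2 by rewrite divr_gt0.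
have [s s0 sc] := fc _ e2; have [s' s0' sd] := fd _ e2.
apply: le_trans (ler_rdistD (avg s (avg s' f) 0) _ _) _; rewrite [e]splitr.
apply: lerD; last exact: avg_close.
by rewrite rdistC avgC; exact: avg_close.
Qed.

Lemma is_meanD f g c d :
  is_mean f c -> is_mean g d -> is_mean (fun x => f x + g x) (c + d).
Proof.
move=> fc gd e e0; have e2 : 0 < e / 2 by rewrite divr_gt0.
have [s s0 sc] := fc _ e2; have [s' s0' sd] := gd _ e2.
exists (addseq s s'); first exact: addseq_nil.
move=> x; rewrite -avg_add -avgC avg_add.
rewrite avgD -!avg_add opprD addrACA [e]splitr.
apply: le_trans (ler_rnormD _ _) _; apply: lerD; first exact: avg_close.
by rewrite avgC; exact: avg_close.
Qed.

Lemma is_meanZ f c (a : R[i]) : is_mean f c -> is_mean (fun x => a * f x) (a * c).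
Proof.
move=> fc e e0; have a0 : 0 < rnorm a + 1 by rewrite ltr_wpDl// rnorm_ge0.
have [|s s0 sc] := fc (e / (rnorm a + 1)); first by rewrite divr_gt0.
exists s => // x; rewrite avgZ -mulrBr rnormM.
apply: (@le_trans _ _ ((rnorm a + 1) * (e / (rnorm a + 1)))); last first.
  by rewrite mulrCA divff ?mulr1// gt_eqF.
by rewrite ler_pM ?rnorm_ge0 ?lerDl.
Qed.

Lemma is_mean_cst c : is_mean (fun=> c) c.
Proof.
move=> e e0; exists [:: 0] => // x; rewrite avg_cst// subrr rnorm0.
exact: ltW.
Qed.

Lemma is_mean_conj f c : is_mean f c -> is_mean (fun x => conjc (f x)) (conjc c).
Proof.
move=> fc e /fc[s s0 sc]; exists s => // x.
by rewrite avg_conjc -conjcB rnorm_conj.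
Qed.

Lemma is_mean_shift f c a : is_mean f c -> is_mean (fun x => f (x + a)) c.
Proof. by move=> fc e /fc[s s0 sc]; exists s => // x; rewrite avg_shift. Qed.

Lemma is_mean_opp f c : is_mean f c -> is_mean (fun x => f (- x)) c.
Proof.
move=> fc e /fc[s s0 sc]; exists (map -%R s) => [|x]; first by case: s s0 {sc}.
rewrite (_ : avg _ _ _ = avg s f (- x))//.
rewrite /avg size_map big_map; congr (_ * _); apply: eq_bigr => t _.
by rewrite opprD opprK.
Qed.

Lemma is_mean_le f c (M : R) : (forall x, rnorm (f x) <= M) -> is_mean f c ->
  rnorm c <= M.
Proof.
move=> fM fc; apply/ler_addgt0Pr => e /fc[s s0 sc].
apply: le_trans (ler_rnormBD _ (avg s f 0)) _; rewrite addrC lerD//.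
  apply: le_trans (rnorm_avg _ _ _) _.
  by rewrite -[leRHS](avg_cst M 0 s0); exact: ler_avg.
by rewrite rdistC.
Qed.

Lemma is_mean_Re_ge f c (m : R) : (forall x, m <= Re (f x)) -> is_mean f c ->
  m <= Re c.
Proof.
move=> fM fc; apply/ler_addgt0Pr => e /fc[s s0 /(_ 0) sc].
rewrite -lerBlDr; apply: (@le_trans _ _ (Re (avg s f 0) - e)).
  rewrite lerD2r -[leLHS](avg_cst m (0 : G) s0).
  have -> : Re (avg s f 0) = avg s (fun x => Re (f x)) 0; last exact: ler_avg.
  rewrite /avg -(rmorph_nat (real_complex R)) -fmorphV.
  rewrite -(raddf_sum (@complex.Re R)).
  by move: (\sum_(_ <- _) _) => [a b] /=; rewrite mul0r subr0.
rewrite lerBlDl -lerBlDr -ReB.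
exact: le_trans (Re_le_rnorm _) _.
Qed.

Lemma ccont_bounded f : ccont f ->
  exists2 M : R, 0 <= M & forall x, rnorm (f x) <= M.
Proof.
move=> cf.
have c2 : ccont (fun p : G * G => (fun _ x : G => f x) p.1 p.2).
  by apply: ccont_comp cf => p; exact: cvg_snd.
have [s sf] := @uniform_net _ _ _ (fun _ x => f x) cptG c2 _ cptG ltr01.
exists (\sum_(x <- s) rnorm (f x) + 1) => [|x].
  by rewrite addr_ge0// sumr_ge0// => ? _; exact: rnorm_ge0.
have [y ys /(_ 0) xy] := sf x; apply: le_trans (ler_rnormBD _ (f y)) _.
rewrite addrC lerD// (big_rem y)//= lerDl.
by rewrite sumr_ge0// => ? _; exact: rnorm_ge0.
Qed.

Lemma ccont_add2 f : ccont f -> ccont (fun p : G * G => f (p.1 + p.2)).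
Proof. by apply: ccont_comp; exact: add_continuous. Qed.

Lemma translation_net f (e : R) : ccont f -> 0 < e ->
  exists s : seq G, forall y, exists2 y0, y0 \in s &
    forall x, rnorm (f (x + y) - f (x + y0)) <= e.
Proof.
move=> cf; exact: (@uniform_net _ _ _ (fun x y => f (x + y)) cptG (ccont_add2 cf)).
Qed.

(* von Neumann: if the maximum of an average g of f is almost minimal among the
   averages of f, then averaging g over a finite net of translations shows that
   g is almost constant. *)
Lemma is_mean_ex_real (f : G -> R) : ccont (fun x => (f x)%:C) ->
  exists c : R, is_mean (fun x => (f x)%:C) c%:C.
Proof.
move=> cfC; have [B B0 fB] := ccont_bounded cfC.
have {}fB x : `|f x| <= B by rewrite -rnormC.
pose S := [set M : R | exists2 s : seq G, s != [::] & forall x, avg s f x <= M].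
have Sinf : has_inf S.
  split; first exists B, [:: 0] => // x.
    rewrite -[leRHS](@avg_cst G R [:: 0] B x)//; apply: ler_avg => y.
    exact: le_trans (ler_norm _) (fB _).
  exists (- B) => M [s s0 sM]; apply: le_trans (sM 0).
  rewrite -[leLHS](@avg_cst G R s (- B) 0)//; apply: ler_avg => y.
  by have := fB y; rewrite ler_norml => /andP[].
exists (inf S) => e0 e00; set M0 := inf S.
pose e := e0 / 3; have e_gt0 : 0 < e by rewrite divr_gt0.
have [l lP] := translation_net cfC e_gt0.
have l0 : l != [::] by have [t + _] := lP 0; case: (l).
have n0 : 0 < (size l)%:R :> R by rewrite ltr0n lt0n size_eq0.
(* In an average of [size l] terms exceeding [M0 - d], all terms being at most [M0 + d], no term
   falls below [M0] by more than [2 * size l * d = 2 * e]. *)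
pose d := e / (size l)%:R; have d0 : 0 < d by rewrite divr_gt0.
have [M1 [s s0 sM] MM] := inf_adherent d0 Sinf.
pose g := avg s f; have gM x : g x <= M0 + d.
  by apply: le_trans (sM x) _; exact: ltW.
have [x Mx] : exists x, M0 - d < avg l g x.
  apply: contrapT => /forallNP h.
  have : M0 <= M0 - d.
    apply: ge_inf; first by case: Sinf.
    exists (addseq l s); first exact: addseq_nil.
    by move=> x; rewrite -avg_add leNgt; apply/negP; exact: h.
  by move: d0; clear; lra.
have lo t : t \in l -> M0 - 2 * e <= g (x + t).
  move=> tl; move: Mx; rewrite /avg mulrC ltr_pdivlMr// (big_rem t)//=.
  have : \sum_(y <- rem t l) g (x + y) <= \sum_(y <- rem t l) (M0 + d).
    by apply: ler_sum.
  rewrite big_const_seq count_predT iter_addr_0 size_rem// -mulr_natr.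
  rewrite mul1r -[_ *+ _]mulr_natr; have -> : (size l).-1%:R = (size l)%:R - 1 :> R.
    by rewrite -subn1 natrB// lt0n size_eq0.
  have : d * (size l)%:R = e by rewrite /d mulfVK// gt_eqF.
  move: d0 e_gt0; rewrite -/(g (x + t)); move: ((size l)%:R) (g (x+t)) (\sum_(_ <- _) _).
  clear; clearbody M0 d e; move=> n gt S' d0 e0' dn; nra.
exists s => // y; rewrite avg_real -rmorphB rnormC -/(g y).
(* [g y] is [g] at [x] translated by [y - x]; the net replaces this translation by [t] at cost [e],
   and [lo] bounds [g (x + t)] from below. *)
have [t tl tP] := lP (y - x).
have : `|g y - g (x + t)| <= e.
  rewrite -rnormC rmorphB /= -!avg_real.
  have -> : avg s (fun y0 => (f y0)%:C) y =
            avg s (fun y0 => (f (y0 + (y - x)))%:C) x.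
    by rewrite (avg_shift s (fun z => (f z)%:C)) addrC subrK.
  rewrite -(avg_shift s (fun z => (f z)%:C) t) -mulN1r -avgZ -avgD.
  apply: le_trans (rnorm_avg _ _ _) _.
  rewrite -[leRHS](avg_cst e x s0); apply: ler_avg => z.
  by rewrite mulN1r.
have := lo _ tl; have := gM y.
have : d <= e by rewrite ler_pdivrMr// ler_peMr ?ler1n ?lt0n ?size_eq0// ltW.
have : e0 = 3 * e by rewrite /e mulrC divfK.
clearbody e d; rewrite !ler_norml => -> de gy gxt /andP[h1 h2].
by apply/andP; split; lra.
Qed.

Lemma is_mean_ex f : ccont f -> exists c, is_mean f c.
Proof.
move=> cf; have [a ha] := is_mean_ex_real (ccont_Re cf).
have [b hb] := is_mean_ex_real (ccont_Im cf).
exists (a%:C + 'i * b%:C).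
rewrite (_ : f = fun x => (Re (f x))%:C + 'i * (Im (f x))%:C).
  by apply: is_meanD => //; exact: is_meanZ.
by apply/funext => x; rewrite -complexE.
Qed.

(** The default value is never reached on continuous functions, by [is_mean_ex]. *)
Definition mean f : R[i] := xget 0 [set c | is_mean f c].

Lemma meanP f : ccont f -> is_mean f (mean f).
Proof.
move=> /is_mean_ex[c fc]; rewrite /mean; case: xgetP => [? _ //|/(_ c)].
by move=> /(_ fc).
Qed.

Lemma mean_eq f c : is_mean f c -> mean f = c.
Proof.
move=> fc; rewrite /mean; case: xgetP => [d _ fd|/(_ c)]; last by move=> /(_ fc).
exact: is_mean_uniq fd fc.
Qed.

Lemma meanD f g : ccont f -> ccont g ->
  mean (fun x => f x + g x) = mean f + mean g.
Proof. by move=> cf cg; apply/mean_eq/is_meanD; exact: meanP. Qed.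

Lemma meanZ c f : ccont f -> mean (fun x => c * f x) = c * mean f.
Proof. by move=> cf; apply/mean_eq/is_meanZ; exact: meanP. Qed.

Lemma meanB f g : ccont f -> ccont g ->
  mean (fun x => f x - g x) = mean f - mean g.
Proof.
move=> cf cg.
transitivity (mean (fun x => f x + (-1) * g x)).
  by congr mean; apply/funext => x; rewrite mulN1r.
by rewrite (meanD cf (ccontZ _ cg)) meanZ// mulN1r.
Qed.

Lemma mean_cst c : mean (fun=> c) = c.
Proof. by apply/mean_eq/is_mean_cst. Qed.

Lemma mean_conj f : ccont f -> mean (fun x => conjc (f x)) = conjc (mean f).
Proof. by move=> cf; apply/mean_eq/is_mean_conj; exact: meanP. Qed.

Lemma mean_shift f a : ccont f -> mean (fun x => f (x + a)) = mean f.
Proof. by move=> cf; apply/mean_eq/is_mean_shift; exact: meanP. Qed.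

Lemma mean_opp f : ccont f -> mean (fun x => f (- x)) = mean f.
Proof. by move=> cf; apply/mean_eq/is_mean_opp; exact: meanP. Qed.

Lemma mean_le f (M : R) : ccont f -> (forall x, rnorm (f x) <= M) ->
  rnorm (mean f) <= M.
Proof. by move=> cf fM; apply: is_mean_le fM _; exact: meanP. Qed.

Lemma mean_Re_ge f (m : R) : ccont f -> (forall x, m <= Re (f x)) ->
  m <= Re (mean f).
Proof. by move=> cf fm; apply: is_mean_Re_ge fm _; exact: meanP. Qed.

Lemma mean_real (f : G -> R) : ccont (fun x => (f x)%:C) ->
  mean (fun x => (f x)%:C) = (Re (mean (fun x => (f x)%:C)))%:C.
Proof.
move=> cfC.
have := mean_conj cfC; rewrite (_ : (fun x => conjc _) = (fun x => (f x)%:C)); last first.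
  by apply/funext => x; rewrite conjc_real.
by case: (mean _) => a b /= [] b0; apply/eqP; rewrite eq_complex /= eqxx /=;
  apply/eqP; lra.
Qed.

Lemma mean_sum (I : Type) (s : seq I) (F : I -> G -> R[i]) :
  (forall i, ccont (F i)) ->
  mean (fun x => \sum_(i <- s) F i x) = \sum_(i <- s) mean (F i).
Proof.
move=> cF; elim: s => [|i s ih].
  rewrite big_nil -[RHS](mean_cst 0); congr mean; apply/funext => x.
  by rewrite big_nil.
rewrite big_cons -ih -meanD//; last exact: ccont_sum.
by congr mean; apply/funext => x; rewrite big_cons.
Qed.

Lemma ccont_shift f a : ccont f -> ccont (fun x => f (x + a)).
Proof.
by move=> cf; exact: (@ccont_sec1 _ _ _ (fun x y => f (x + y)) (ccont_add2 cf)).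
Qed.

Lemma ccont_avg s f : ccont f -> ccont (avg s f).
Proof.
by move=> cf; apply/ccontZ/ccont_sum => t; exact: ccont_shift.
Qed.

Lemma mean_avg s f : s != [::] -> ccont f -> mean (avg s f) = mean f.
Proof.
move=> s0 cf; rewrite /avg meanZ; last first.
  by apply: ccont_sum => t; exact: ccont_shift.
rewrite mean_sum => [|t]; last exact: ccont_shift.
under eq_bigr do rewrite (mean_shift _ cf).
rewrite big_const_seq count_predT iter_addr_0 -[mean f *+ _]mulr_natl mulKf//.
by rewrite pnatr_eq0 size_eq0.
Qed.

(** Average over a finite net of translations: from every [x], some translation of the net reaches a
    point where [f] is at least [f x0 / 2]. *)
Lemma mean_gt0 (f : G -> R) x0 : ccont (fun x => (f x)%:C) -> (forall x, 0 <= f x) ->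
  0 < f x0 -> 0 < Re (mean (fun x => (f x)%:C)).
Proof.
move=> cfC f_ge0 fx0.
pose e := f x0 / 2; have e0 : 0 < e by rewrite divr_gt0.
have [l lP] := translation_net cfC e0.
have l0 : l != [::] by have [t + _] := lP 0; case: (l).
have n0 : 0 < (size l)%:R :> R by rewrite ltr0n lt0n size_eq0.
rewrite -(mean_avg l0 cfC); apply: (@lt_le_trans _ _ ((size l)%:R^-1 * e)).
  by rewrite mulr_gt0// invr_gt0.
apply: mean_Re_ge => [|x]; first exact: ccont_avg.
rewrite avg_real /= /avg ler_wpM2l ?invr_ge0 ?ler0n//.
have [t tl tP] := lP (x0 - x); rewrite (big_rem t)//=.
apply: (@le_trans _ _ (f (x + t))); last by rewrite lerDl sumr_ge0.
have := tP x; rewrite -rmorphB rnormC [x + (_ - _)]addrC subrK ler_norml => /andP[_].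
have : f x0 = 2 * e by rewrite /e mulrC divfK.
lra.
Qed.

End mean.

Ltac ccont := try assumption; lazymatch goal with
  | |- ccont (fun _ => ?c) => apply: ccont_cst
  | |- ccont (fun x => @?f x - @?g x) => refine (@ccontB _ _ f g _ _); ccont
  | |- ccont (fun x => @?f x + @?g x) => refine (@ccontD _ _ f g _ _); ccont
  | |- ccont (fun x => @?f x * @?g x) => refine (@ccontM _ _ f g _ _); ccont
  | |- ccont (fun x => - @?f x) => refine (@ccontN _ _ f _); ccont
  | |- ccont (fun x => conjc (@?f x)) => refine (@ccont_conj _ _ f _); ccont
  | |- _ => idtac
  end.

Section fubini.
Context {R : realType} {G : topologicalZmodType}.
Hypothesis cptG : compact [set: G].
Variable F : G -> G -> R[i].
Hypothesis cF : ccont (fun p : G * G => F p.1 p.2).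

Let c1 := ccont_sec1 cF.
Let c2 := ccont_sec2 cF.

Lemma ccont_mean : ccont (fun s => mean (F^~ s)).
Proof.
move=> s e e0; have := near_uniform cptG cF s e0; apply: filterS => s' h.
by rewrite -(meanB cptG (c1 s') (c1 s)); apply: mean_le => //; exact: ccontB.
Qed.

Lemma joint_mean (l : seq G) (e : R) : 0 < e -> exists2 t : seq G, t != [::] &
  forall s, s \in l -> forall r, rnorm (avg t (F^~ s) r - mean (F^~ s)) <= e.
Proof.
move=> e0; elim: l => [|s l [t t0 tl]]; first by exists [:: 0].
have [t' t0' t's] := meanP cptG (c1 s) e0.
exists (addseq t t'); first exact: addseq_nil.
move=> s'; rewrite inE => /orP[/eqP-> r|s'l r]; rewrite -avg_add.
  exact: avg_close.
by rewrite avgC; apply: avg_close => // x; exact: tl.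
Qed.

Lemma uniform_mean (e : R) : 0 < e -> exists2 t : seq G, t != [::] &
  forall s r, rnorm (avg t (F^~ s) r - mean (F^~ s)) <= e.
Proof.
move=> e0; have e3 : 0 < e / 3 by rewrite divr_gt0.
have [l lP] := uniform_net cptG cF cptG e3.
have [t t0 tl] := joint_mean l e3.
exists t => // s r; have [s0 s0l ss0] := lP s.
have h1 : rnorm (avg t (F^~ s) r - avg t (F^~ s0) r) <= e / 3.
  rewrite -mulN1r -avgZ -avgD; apply: le_trans (rnorm_avg _ _ _) _.
  rewrite -[leRHS](avg_cst (e / 3) r t0); apply: ler_avg => y.
  by rewrite mulN1r.
have h2 : rnorm (mean (F^~ s0) - mean (F^~ s)) <= e / 3.
  rewrite -(meanB cptG (c1 s0) (c1 s)); apply: mean_le => //; first exact: ccontB.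
  by move=> x; rewrite rdistC.
have h3 := tl s0 s0l r.
apply: le_trans (ler_rdistD (avg t (F^~ s0) r) _ _) _.
apply: le_trans (lerD h1 (ler_rdistD (mean (F^~ s0)) _ _)) _.
by move: h2 h3; set a := rnorm _; set b := rnorm _; lra.
Qed.

Lemma mean_avgl (t : seq G) x :
  avg t (fun r => mean (F r)) x = mean (fun s => avg t (F^~ s) x).
Proof.
rewrite /avg meanZ//; last by apply: ccont_sum => y; exact: c2.
by rewrite mean_sum// => y; exact: c2.
Qed.

(** A finite average in [r] commutes with the mean in [s], and [uniform_mean] gives one average that
    approximates the inner means for all [s] at once. *)
Lemma fubini : mean (fun s => mean (F^~ s)) = mean (fun r => mean (F r)).
Proof.
apply/esym/mean_eq => e e0; have [t t0 tP] := uniform_mean e0.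
exists t => // x; rewrite mean_avgl -(meanB cptG)//; last exact: ccont_mean.
- apply: mean_le => //; apply: ccontB; last exact: ccont_mean.
  by apply/ccontZ/ccont_sum => y; exact: c2.
- by apply/ccontZ/ccont_sum => y; exact: c2.
Qed.

End fubini.

(** * Convolution and the L2 inner product *)

Section convolution.
Context {R : realType} {G : topologicalZmodType}.
Hypothesis cptG : compact [set: G].
Implicit Types (f g h : G -> R[i]) (c : R[i]).

Definition conv f g (t : G) : R[i] := mean (fun s => f s * g (t - s)).

Definition star f (t : G) : R[i] := conjc (f (- t)).

Definition ip f g : R[i] := mean (fun s => f s * conjc (g s)).

(** The square of the L2 norm. *)
Definition N2 f : R := Re (ip f f).

Lemma ccont_sub2 f : ccont f -> ccont (fun p : G * G => f (p.2 - p.1)).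
Proof.
apply: ccont_comp => p.
apply: (@continuous_comp _ _ _ (fun p : G * G => (p.2, p.1)) (fun q => q.1 - q.2)).
  by apply: cvg_pair; [exact: cvg_snd|exact: cvg_fst].
exact: sub_continuous.
Qed.

Lemma ccont_fst f : ccont f -> ccont (fun p : G * G => f p.1).
Proof. by apply: ccont_comp => p; exact: cvg_fst. Qed.

Lemma ccont_snd f : ccont f -> ccont (fun p : G * G => f p.2).
Proof. by apply: ccont_comp => p; exact: cvg_snd. Qed.

Lemma ccont_opp f : ccont f -> ccont (fun t => f (- t)).
Proof. by apply: ccont_comp; exact: opp_continuous. Qed.

Lemma ccont_subl f t : ccont f -> ccont (fun s => f (t - s)).
Proof.
move=> cf; exact: (@ccont_sec1 _ _ _ (fun s t => f (t - s)) (ccont_sub2 cf)).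
Qed.

Lemma ccont_conv2 f g : ccont f -> ccont g ->
  ccont (fun p : G * G => f p.1 * g (p.2 - p.1)).
Proof. by move=> cf cg; apply: ccontM; [exact: ccont_fst|exact: ccont_sub2]. Qed.

Lemma ccont_conv f g : ccont f -> ccont g -> ccont (conv f g).
Proof.
move=> cf cg.
exact: (@ccont_mean _ _ cptG (fun s t => f s * g (t - s)) (ccont_conv2 cf cg)).
Qed.

Lemma ccont_star f : ccont f -> ccont (star f).
Proof. by move=> cf; apply/ccont_conj/ccont_opp. Qed.

Hint Resolve ccont_conv ccont_star : core.

Lemma mean_subl f t : ccont f -> mean (fun s => f (t - s)) = mean f.
Proof.
move=> cf; rewrite -(mean_shift cptG t cf).
rewrite -[RHS](mean_opp cptG); last exact: ccont_shift.
by congr mean; apply/funext => s; rewrite addrC.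
Qed.

Lemma convC f g : ccont f -> ccont g -> conv f g = conv g f.
Proof.
move=> cf cg; apply/funext => t; rewrite /conv -(mean_subl t).
  by congr mean; apply/funext => s; rewrite subKr mulrC.
by apply: ccontM => //; exact: ccont_subl.
Qed.

Lemma convA f g h : ccont f -> ccont g -> ccont h ->
  conv f (conv g h) = conv (conv f g) h.
Proof.
move=> cf cg ch; apply/funext => t.
pose F r s := f r * g (s - r) * h (t - s).
have cF : ccont (fun p : G * G => F p.1 p.2).
  apply: ccontM; first exact: ccont_conv2.
  exact: (ccont_snd (ccont_subl t ch)).
transitivity (mean (fun r => mean (F r))).
  rewrite /conv; congr mean; apply/funext => r.
  rewrite -(meanZ cptG); last first.
    by apply: ccontM => //; exact: ccont_subl.
  rewrite -(mean_shift cptG (- r)); last first.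
    by apply: ccontZ; apply: ccontM => //; exact: ccont_subl.
  by congr mean; apply/funext => s; rewrite /F mulrA opprB addrA subrK.
rewrite -(fubini cptG cF) /conv; congr mean; apply/funext => s.
rewrite [RHS]mulrC -(meanZ cptG); last by apply: ccontM => //; exact: ccont_subl.
by congr mean; apply/funext => r; rewrite mulrC.
Qed.

Lemma convDl f g h : ccont f -> ccont g -> ccont h ->
  conv (fun x => f x + g x) h = (fun x => conv f h x + conv g h x).
Proof.
move=> cf cg ch; apply/funext => t; rewrite /conv -(meanD cptG).
- by congr mean; apply/funext => s; rewrite mulrDl.
- by apply: ccontM => //; exact: ccont_subl.
- by apply: ccontM => //; exact: ccont_subl.
Qed.

Lemma convZl c f h : ccont f -> ccont h ->
  conv (fun x => c * f x) h = (fun x => c * conv f h x).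
Proof.
move=> cf ch; apply/funext => t; rewrite /conv -(meanZ cptG).
  by congr mean; apply/funext => s; rewrite mulrA.
by apply: ccontM => //; exact: ccont_subl.
Qed.

Lemma convBl f g h : ccont f -> ccont g -> ccont h ->
  conv (fun x => f x - g x) h = (fun x => conv f h x - conv g h x).
Proof.
move=> cf cg ch; apply/funext => t; rewrite /conv -(meanB cptG).
- by congr mean; apply/funext => s; rewrite mulrBl.
- by apply: ccontM => //; exact: ccont_subl.
- by apply: ccontM => //; exact: ccont_subl.
Qed.

Lemma convZr c f h : ccont f -> ccont h ->
  conv f (fun x => c * h x) = (fun x => c * conv f h x).
Proof. by move=> cf ch; rewrite convC ?convZl ?(convC cf)//; exact: ccontZ. Qed.

Lemma convBr f g h : ccont f -> ccont g -> ccont h ->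
  conv h (fun x => f x - g x) = (fun x => conv h f x - conv h g x).
Proof.
by move=> cf cg ch; rewrite convC ?convBl// ?(convC ch)//; exact: ccontB.
Qed.

Lemma conv_shiftl f g a : ccont f -> ccont g ->
  conv (fun x => f (x + a)) g = (fun x => conv f g (x + a)).
Proof.
move=> cf cg; apply/funext => t; rewrite /conv -(mean_shift cptG (- a)).
  by congr mean; apply/funext => s; rewrite subrK opprB addrA.
by apply: ccontM; [exact: ccont_shift|exact: ccont_subl].
Qed.

Lemma starK f : star (star f) = f.
Proof. by apply/funext => t; rewrite /star opprK; exact: conjcK. Qed.

Lemma star_conv f g : ccont f -> ccont g ->
  star (conv f g) = conv (star f) (star g).
Proof.
move=> cf cg; apply/funext => t; rewrite /star /conv -(mean_conj cptG).
  rewrite -[LHS](mean_opp cptG); last first.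
    by apply: ccont_conj; apply: ccontM => //; exact: ccont_subl.
  congr mean; apply/funext => s; rewrite conjcM; congr (_ * conjc (g _)).
  by rewrite opprD.
by apply: ccontM => //; exact: ccont_subl.
Qed.

(** This links the algebra to the L2 structure: inner products of convolution powers become values
    at 0 of higher powers. *)
Lemma conv_star0 f g : conv f (star g) 0 = ip f g.
Proof.
by rewrite /conv /ip /star; congr mean; apply/funext => s; rewrite sub0r opprK.
Qed.

Lemma ipDl f g h : ccont f -> ccont g -> ccont h ->
  ip (fun x => f x + g x) h = ip f h + ip g h.
Proof.
move=> cf cg ch; rewrite /ip -(meanD cptG); [|ccont..].
by congr mean; apply/funext => s; rewrite mulrDl.
Qed.

Lemma ipZl c f h : ccont f -> ccont h -> ip (fun x => c * f x) h = c * ip f h.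
Proof.
move=> cf ch; rewrite /ip -(meanZ cptG); [|ccont..].
by congr mean; apply/funext => s; rewrite mulrA.
Qed.

Lemma ipC f g : ccont f -> ccont g -> ip g f = conjc (ip f g).
Proof.
move=> cf cg; rewrite /ip -(mean_conj cptG); [|ccont..].
by congr mean; apply/funext => s; rewrite conjcM [conjc (conjc _)]conjcK mulrC.
Qed.

Lemma ipE f : ip f f = mean (fun s => (rnorm (f s) ^+ 2)%:C).
Proof. by rewrite /ip; congr mean; apply/funext => s; exact: mulcJ. Qed.

Lemma ccont_rnorm2 f : ccont f -> ccont (fun s => (rnorm (f s) ^+ 2)%:C).
Proof.
move=> cf; rewrite (_ : (fun _ => _) = fun s => f s * conjc (f s)).
  by ccont.
by apply/funext => s; rewrite mulcJ.
Qed.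

Lemma ip_N2 f : ccont f -> ip f f = (N2 f)%:C.
Proof.
by move=> cf; rewrite /N2 ipE; apply: mean_real => //; exact: ccont_rnorm2.
Qed.

Lemma N2_ge0 f : ccont f -> 0 <= N2 f.
Proof.
move=> cf; rewrite /N2 ipE; apply: mean_Re_ge => //; first exact: ccont_rnorm2.
by move=> x; exact: sqr_ge0.
Qed.

Lemma N2_eq0 f : ccont f -> N2 f = 0 -> forall x, f x = 0.
Proof.
move=> cf f0 x; apply: rnorm0_eq0; apply/eqP; rewrite eq_le rnorm_ge0 andbT leNgt.
apply/negP => fx; have : 0 < N2 f; last by rewrite f0 ltxx.
rewrite /N2 ipE; apply: (@mean_gt0 _ _ cptG _ x) => //; first exact: ccont_rnorm2.
  by move=> y; exact: sqr_ge0.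
by rewrite exprn_gt0.
Qed.

Lemma N2_le f (M : R) : ccont f -> (forall x, rnorm (f x) <= M) -> N2 f <= M ^+ 2.
Proof.
move=> cf fM; rewrite /N2; apply: le_trans (Re_le_rnorm _) _.
apply: mean_le => [//||x]; first by ccont.
by rewrite rnormM rnorm_conj -expr2 lerXn2r ?nnegrE ?rnorm_ge0//;
  exact: le_trans (rnorm_ge0 _) (fM x).
Qed.

Lemma N2Z c f : ccont f -> N2 (fun x => c * f x) = rnorm c ^+ 2 * N2 f.
Proof.
move=> cf; apply: (@complexI R); rewrite -ip_N2; [|ccont].
rewrite ipZl; [|ccont..]; rewrite ipC; [|ccont..]; rewrite ipZl//.
by rewrite conjcM ip_N2// conjc_real mulrA mulcJ -rmorphM.
Qed.

Lemma N2B f g : ccont f -> ccont g ->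
  N2 (fun x => f x - g x) = N2 f + N2 g - 2 * Re (ip f g).
Proof.
move=> cf cg.
have cM h k : ccont h -> ccont k -> ccont (fun s => h s * conjc (k s)).
  by move=> ch ck; ccont.
have -> : N2 (fun x => f x - g x) = Re (ip f f + ip g g - (ip f g + ip g f)).
  congr (Re _); transitivity (mean (fun s => f s * conjc (f s) + g s * conjc (g s) -
      (f s * conjc (g s) + g s * conjc (f s)))).
    congr mean; apply/funext => s; rewrite conjcB mulrBr !mulrBl opprB addrACA.
    by congr (_ + _); rewrite opprD addrC.
  rewrite (meanB cptG (ccontD (cM _ _ cf cf) (cM _ _ cg cg))
    (ccontD (cM _ _ cf cg) (cM _ _ cg cf))).
  by rewrite (meanD cptG (cM _ _ cf cf) (cM _ _ cg cg))
    (meanD cptG (cM _ _ cf cg) (cM _ _ cg cf)).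
rewrite (ipC cf cg) ReB !ReD /N2.
by case: (ip f g) => a b /=; ring.
Qed.

Lemma ip_CS f g : ccont f -> ccont g -> rnorm (ip f g) ^+ 2 <= N2 f * N2 g.
Proof.
move=> cf cg; have := N2_ge0 cg; rewrite le_eqVlt => /orP[/eqP/esym g0|g0].
  have gz := N2_eq0 cg g0; rewrite g0 mulr0.
  rewrite (_ : ip f g = 0) ?rnorm0 ?expr0n//.
  rewrite /ip -[RHS](@mean_cst R G 0); congr mean; apply/funext => s.
  by rewrite gz conjc0 mulr0.
(* Positivity of the squared norm of [N2 g * f - ip f g * g], which is [N2 g] times the wanted
   difference. *)
have cZf := ccontZ (N2 g)%:C cf; have cZg := ccontZ (ip f g) cg.
have := N2_ge0 (ccontB cZf cZg); rewrite (N2B cZf cZg) !N2Z//.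
rewrite rnormC_ge0 ?N2_ge0// (ipZl _ cf cZg) (ipC cZg cf) (ipZl _ cg cf) (ipC cf cg).
rewrite conjcM [conjc (conjc _)]conjcK [conjc _ * _]mulrC mulcJ -rmorphM /=.
move=> h; have : 0 <= N2 g * (N2 f * N2 g - rnorm (ip f g) ^+ 2).
  by apply: le_trans h _; rewrite le_eqVlt; apply/orP; left; apply/eqP; ring.
by rewrite pmulr_rge0// subr_ge0.
Qed.

(** Cauchy-Schwarz, with [g] reflected and translated. This is the bound that upgrades L2
    convergence to uniform convergence. *)
Lemma rnorm_conv f g t : ccont f -> ccont g ->
  rnorm (conv f g t) ^+ 2 <= N2 f * N2 g.
Proof.
move=> cf cg; pose k s := conjc (g (t - s)).
have ck : ccont k by apply/ccont_conj/ccont_subl.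
have -> : conv f g t = ip f k.
  by rewrite /conv /ip; congr mean; apply/funext => s; rewrite /k [conjc (conjc _)]conjcK.
have -> : N2 g = N2 k; last exact: ip_CS.
rewrite /N2 !ipE -(mean_subl t); last exact: ccont_rnorm2.
by congr (Re _); congr mean; apply/funext => s; rewrite /k rnorm_conj.
Qed.

Lemma N2_conv f g : ccont f -> ccont g -> N2 (conv f g) <= N2 f * N2 g.
Proof.
move=> cf cg; have h0 : 0 <= N2 f * N2 g by rewrite mulr_ge0 ?N2_ge0.
rewrite -[leRHS]sqr_sqrtr//; apply: N2_le => [|t]; first exact: ccont_conv.
by rewrite -(ler_pXn2r (n := 2)) ?nnegrE ?rnorm_ge0 ?sqrtr_ge0// sqr_sqrtr//;
  exact: rnorm_conv.
Qed.

End convolution.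

(** * Characters span a dense subspace *)

Section uniform_limits.
Context {R : realType}.

Definition ulim {X : Type} (f : nat -> X -> R[i]) (K : X -> R[i]) :=
  forall e : R, 0 < e -> exists N, forall n, (N <= n)%N ->
    forall t, rnorm (f n t - K t) <= e.

Lemma ulim_uniq {X : Type} (f : nat -> X -> R[i]) K L : ulim f K -> ulim f L -> K = L.
Proof.
move=> fK fL; apply/funext => t; apply/subr0_eq/rnorm_small => e e0.
have e2 : 0 < e / 2 by rewrite divr_gt0.
have [N hN] := fK _ e2; have [M hM] := fL _ e2.
apply: le_trans (ler_rdistD (f (maxn N M) t) _ _) _; rewrite [e]splitr lerD//.
  by rewrite rdistC hN// leq_maxl.
by rewrite hM// leq_maxr.
Qed.

Lemma ulimZ {X : Type} (f : nat -> X -> R[i]) K c :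
  ulim f K -> ulim (fun n t => c * f n t) (fun t => c * K t).
Proof.
move=> fK e e0; have a0 : 0 < rnorm c + 1 by rewrite ltr_wpDl// rnorm_ge0.
have [|N NP] := fK (e / (rnorm c + 1)); first by rewrite divr_gt0.
exists N => n Nn t; rewrite -mulrBr rnormM.
apply: (@le_trans _ _ ((rnorm c + 1) * (e / (rnorm c + 1)))); last first.
  by rewrite mulrCA divff ?mulr1// gt_eqF.
by rewrite ler_pM ?rnorm_ge0 ?lerDl ?NP.
Qed.

Lemma uniform_complete {X : topologicalType} (f : nat -> X -> R[i]) :
  (forall n, ccont (f n)) ->
  (forall e : R, 0 < e -> exists N, forall n m, (N <= n)%N -> (N <= m)%N ->
     forall t, rnorm (f n t - f m t) <= e) ->
  exists2 K, ccont K & ulim f K.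
Proof.
move=> cf fC.
have /choice[K KP] : forall t, exists l : R[i], forall e : R, 0 < e ->
    exists N, forall n, (N <= n)%N -> rnorm (f n t - l) <= e.
  move=> t; apply: cauchy_cvgC => e /fC[N NP]; exists N => n m Nn Nm.
  exact: NP.
have fK : ulim f K.
  move=> e e0; have e2 : 0 < e / 2 by rewrite divr_gt0.
  have [N NP] := fC _ e2; exists N => n Nn t.
  have [M MP] := KP t _ e2.
  apply: le_trans (ler_rdistD (f (maxn N M) t) _ _) _; rewrite [e]splitr lerD//.
    by apply: NP => //; exact: leq_maxl.
  by apply: MP; exact: leq_maxr.
exists K => // x e e0; have e3 : 0 < e / 3 by rewrite divr_gt0.
have [N /(_ N (leqnn N)) NP] := fK _ e3.
have := cf N x _ e3; apply: filterS => y xy.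
have h1 := NP y; have h2 := NP x.
apply: le_trans (ler_rdistD (f N y) _ _) _; rewrite rdistC.
apply: le_trans (lerD h1 (ler_rdistD (f N x) _ _)) _.
move: xy h2; set a := rnorm _; set b := rnorm _; lra.
Qed.

End uniform_limits.

(** * Geometric growth of log-convex submultiplicative sequences *)

Section growth.
Context {R : realType}.

Lemma nth_root (a : R) n : 0 <= a -> exists2 b : R, 0 <= b & b ^+ n.+1 = a.
Proof.
move=> a0; exists (a `^ n.+1%:R^-1); first exact: powR_ge0.
by rewrite -powR_mulrn ?powR_ge0// -powRrM mulVf ?powRr1.
Qed.

Variable d : nat -> R.
Hypothesis d_gt0 : forall n, 0 < d n.
Hypothesis d_convex : forall n, d n.+1 ^+ 2 <= d n * d n.+2.
Hypothesis d_sub : forall n k, d (n + k).+1 <= d n * d k.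

(* lam is the limit of the nondecreasing ratios d n.+1 / d n; the bound
   lam ^+ n.+1 <= d n comes from d (n + k).+1 / d k <= d n as k grows. *)
Lemma growth_rate : exists lam : R, [/\ 0 < lam,
  forall n, d n.+1 <= lam * d n & forall n, lam ^+ n.+1 <= d n].
Proof.
pose r n := d n.+1 / d n.
have r_gt0 n : 0 < r n by rewrite divr_gt0.
have r_nd n : r n <= r n.+1.
  by rewrite /r ler_pdivrMr// mulrAC ler_pdivlMr// -expr2 [d n.+2 * _]mulrC.
have r_mono n m : r n <= r (m + n)%N.
  by elim: m => [//|m ih]; rewrite addSn; exact: le_trans ih (r_nd _).
have r_le n : r n <= d 0.
  by rewrite ler_pdivrMr// mulrC; have := d_sub n 0; rewrite addn0.
have rne : range r !=set0 by exists (r 0), 0.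
have r_lam n : r n <= sup (range r).
  by apply: ub_le_sup; [exists (d 0) => _ [k _ <-]|exists n].
have d_pow k n : r k ^+ n.+1 * d k <= d (n + k).+1.
  elim: n => [|n ih]; first by rewrite expr1 add0n /r divfK// gt_eqF.
  rewrite exprS -mulrA; apply: (@le_trans _ _ (r k * d (n + k).+1)).
    by apply: ler_wpM2l => //; exact: ltW.
  apply: (@le_trans _ _ (r (n + k).+1 * d (n + k).+1)).
    by apply: ler_wpM2r; [exact: ltW|rewrite -addSn].
  by rewrite /r divfK ?gt_eqF// addSn.
exists (sup (range r)); split=> [|n|n].
- exact: lt_le_trans (r_gt0 0) (r_lam 0).
- by rewrite -ler_pdivrMr//; exact: r_lam.
have [b b0 bE] := nth_root n (ltW (d_gt0 n)).
rewrite -bE; apply: lerXn2r; rewrite ?nnegrE//.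
  by apply: le_trans (r_lam 0); exact: ltW.
apply: ge_sup => // _ [k _ <-].
rewrite -(@ler_pXn2r _ n.+1)// ?nnegrE ?bE//; last exact: ltW.
by rewrite -(ler_pM2r (d_gt0 k)); apply: le_trans (d_pow k n) _.
Qed.

(** The normalized terms are nonnegative and nonincreasing, hence converge. *)
Lemma normalized_cauchy (lam : R) : 0 < lam -> (forall n, d n.+1 <= lam * d n) ->
  forall e : R, 0 < e -> exists N, forall n m, (N <= n)%N -> (N <= m)%N ->
    `|d n / lam ^+ n.+1 - d m / lam ^+ m.+1| <= e.
Proof.
move=> l0 dl e e0; pose q n := d n / lam ^+ n.+1.
have lX n : 0 < lam ^+ n by rewrite exprn_gt0.
have q0 n : 0 <= q n by apply: divr_ge0; exact: ltW.
have qS n : q n.+1 <= q n.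
  rewrite /q ler_pdivrMr// [lam ^+ n.+2]exprS mulrCA divfK ?gt_eqF//.
have qD n m : q (m + n)%N <= q n.
  by elim: m => [//|m ih]; rewrite addSn; exact: le_trans (qS _) ih.
have qinf : has_inf (range q).
  by split; [exists (q 0), 0|exists 0 => _ [k _ <-]].
have [_ [N _ <-] NP] := inf_adherent e0 qinf.
have qN n : (N <= n)%N -> inf (range q) <= q n <= inf (range q) + e.
  move=> Nn; apply/andP; split.
    by apply: ge_inf; [case: qinf|exists n].
  by apply: le_trans (ltW NP); rewrite -(subnK Nn).
exists N => n m /qN/andP[a b] /qN/andP[a' b']; rewrite -/(q n) -/(q m).
by rewrite ler_norml; apply/andP; split; lra.
Qed.

End growth.

(** * Spectral projections and minimal idempotents of the convolution algebra *)

Section idempotents.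
Context {R : realType} {G : topologicalZmodType}.
Hypothesis cptG : compact [set: G].
Implicit Types (f g h : G -> R[i]) (c : R[i]).

Lemma rnorm_conv_le f g (M e : R) t : ccont f -> ccont g ->
  (forall x, rnorm (f x) <= M) -> (forall x, rnorm (g x) <= e) ->
  rnorm (conv f g t) <= M * e.
Proof.
move=> cf cg fM ge; apply: mean_le => // [|x].
  by apply: ccontM => //; exact: ccont_subl.
by rewrite rnormM ler_pM ?rnorm_ge0.
Qed.

Lemma ulim_conv h (f : nat -> G -> R[i]) K : ccont h -> (forall n, ccont (f n)) ->
  ccont K -> ulim f K -> ulim (fun n => conv h (f n)) (conv h K).
Proof.
move=> ch cf cK fK e e0; have [M M0 hM] := ccont_bounded cptG ch.
have M1 : 0 < M + 1 by rewrite ltr_wpDl.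
have [|N NP] := fK (e / (M + 1)); first by rewrite divr_gt0.
exists N => n Nn t; have -> : conv h (f n) t - conv h K t =
    conv h (fun x => f n x - K x) t by rewrite convBr.
apply: (@le_trans _ _ ((M + 1) * (e / (M + 1)))); last first.
  by rewrite mulrCA divff ?mulr1// gt_eqF.
apply: rnorm_conv_le => //; first exact: ccontB.
  by move=> x; apply: le_trans (hM x) _; rewrite lerDl.
exact: NP.
Qed.

Lemma ulim_star (f : nat -> G -> R[i]) K :
  ulim f K -> ulim (fun n => star (f n)) (star K).
Proof.
move=> fK e /fK[N NP]; exists N => n Nn t.
by rewrite /star -conjcB rnorm_conj NP.
Qed.

(** [cpow g n] has [n.+1] factors, which is where the shifts by one in later indices come from. *)
Fixpoint cpow g n := if n is n'.+1 then conv g (cpow g n') else g.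

Lemma ccont_cpow g n : ccont g -> ccont (cpow g n).
Proof. by move=> cg; elim: n => //= n ih; exact: ccont_conv. Qed.

Lemma cpowD g m n : ccont g -> conv (cpow g m) (cpow g n) = cpow g (m + n).+1.
Proof.
move=> cg; elim: m => [//|m ih] /=.
by rewrite -convA ?ih//; exact: ccont_cpow.
Qed.

Lemma star_cpow g n : ccont g -> star g = g -> star (cpow g n) = cpow g n.
Proof.
move=> cg sg; elim: n => //= n ih.
by rewrite star_conv ?ih ?sg//; exact: ccont_cpow.
Qed.

Section spectral_idempotent.
Variable g : G -> R[i].
Hypotheses (cg : ccont g) (sg : star g = g) (g0 : exists x, g x != 0).

Let p n := cpow g n.
Let cp n : ccont (p n) := ccont_cpow n cg.
Let d n := N2 (p n).

Let ip_p m n : ip (p m) (p n) = p (m + n).+1 0.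
Proof. by rewrite -conv_star0 star_cpow// cpowD. Qed.

Let dE n : p (n + n).+1 0 = (d n)%:C.
Proof. by rewrite -ip_p ip_N2. Qed.

Let N2_gt0 f : ccont f -> (exists x, f x != 0) -> 0 < N2 f.
Proof.
move=> cf [x fx]; rewrite lt_def N2_ge0// andbT; apply/eqP => f0.
by move/eqP : fx; apply; exact: N2_eq0.
Qed.

(** Cauchy-Schwarz for two powers whose indices differ by two: their inner product is the value at 0
    of an even power, namely [d n.+1]. *)
Let d_convex n : d n.+1 ^+ 2 <= d n * d n.+2.
Proof.
have := ip_CS cptG (cp n) (cp n.+2); rewrite ip_p.
by rewrite (_ : (n + n.+2).+1 = (n.+1 + n.+1).+1) 1?dE ?rnormC_ge0 ?N2_ge0//;
  rewrite addnS.
Qed.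

Let d_sub n k : d (n + k).+1 <= d n * d k.
Proof. by rewrite /d /p -cpowD//; apply: N2_conv => //; exact: ccont_cpow. Qed.

(** Log-convexity propagates positivity from [d 0] and [d 1]; the latter is positive because [p 1]
    takes the value [d 0] at 0. *)
Let d_gt0 n : 0 < d n.
Proof.
suff : 0 < d n /\ 0 < d n.+1 by case.
elim: n => [|n [h1 h2]]; split => //; first exact: N2_gt0.
  apply: N2_gt0 => //; exists 0; rewrite (dE 0).
  by rewrite eq_complex /= negb_and gt_eqF// N2_gt0.
have : 0 < d n * d n.+2 by apply: lt_le_trans (d_convex n); rewrite exprn_gt0.
by rewrite pmulr_rgt0.
Qed.

(* The spectral projection of convolution by g * g for its largest eigenvalue,
   as the limit of the normalized even convolution powers of g. *)
Lemma spectral_idempotent : exists lam : R, exists K : G -> R[i],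
  [/\ 0 < lam, ccont K /\ 1 <= Re (K 0), conv K K = K /\ star K = K,
      conv (conv g g) K = (fun t => lam%:C * K t) &
      forall e, ccont e -> conv g e = g -> conv K e = K].
Proof.
have [lam [l0 dl ld]] := growth_rate d_gt0 d_convex d_sub.
have lX n : 0 < lam ^+ n by rewrite exprn_gt0.
pose a n : R[i] := ((lam ^+ n.+1)^-1)%:C.
have a_real n : conjc (a n) = a n by rewrite conjc_real.
pose q n := d n / lam ^+ n.+1.
(* [P n] is the convolution power of [g] with [2 * n.+1] factors divided by [lam ^+ n.+1], so [lam]
   is an eigenvalue for [g * g] and not for [g]. *)
pose P n t := a n * p (n + n).+1 t.
have cP n : ccont (P n) by apply: ccontZ.
have aM m n : a m * a n = a (m + n).+1.
  by rewrite /a -rmorphM -invfM -exprD addSn addnS.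
have PM m n : conv (P m) (P n) = P (m + n).+1.
  rewrite /P (convZl cptG _ (cp _) (ccontZ _ (cp _))) (convZr cptG _ (cp _) (cp _)).
  rewrite /p cpowD//; apply/funext => t; rewrite mulrA aM; congr (_ * cpow g _ t).
  lia.
have ip_P m n : ip (P m) (P n) = (q (m + n).+1)%:C.
  rewrite /P (ipZl cptG _ (cp _) (ccontZ _ (cp _))).
  rewrite (ipC cptG (ccontZ (a n) (cp _)) (cp _)).
  rewrite (ipZl cptG _ (cp _) (cp _)) conjcM a_real -(ipC cptG (cp _) (cp _)).
  rewrite ip_p mulrA aM (_ : ((m + m).+1 + (n + n).+1).+1 = ((m + n).+1 + (m + n).+1).+1); last by lia.
  by rewrite dE -rmorphM /q mulrC.
(* Squared distances are second differences of [q], so convergence of [q] makes [P] Cauchy in L2. *)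
have N2_P m n : N2 (fun t => P m t - P n t) =
    q (m + m).+1 + q (n + n).+1 - 2 * q (m + n).+1.
  by rewrite N2B// /N2 !ip_P.
have qC := normalized_cauchy d_gt0 l0 dl.
have N2_C (e : R) : 0 < e -> exists N, forall n m, (N <= n)%N -> (N <= m)%N ->
    N2 (fun t => P m t - P n t) <= e.
  move=> e0; have e2 : 0 < e / 2 by rewrite divr_gt0.
  have [N NP] := qC _ e2; exists N => n m Nn Nm; rewrite N2_P.
  have h1 : `|q (m + m).+1 - q (m + n).+1| <= e / 2 by apply: NP; lia.
  have h2 : `|q (n + n).+1 - q (m + n).+1| <= e / 2 by apply: NP; lia.
  by move: h1 h2; rewrite !ler_norml => /andP[_ h1] /andP[_ h2]; lra.
have conv1P n : conv (p 1) (P n) = (fun t => lam%:C * P n.+1 t).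
  rewrite /P (convZr cptG _ (cp _) (cp _)) /p cpowD//.
  apply/funext => t; rewrite mulrA /a [lam ^+ n.+2]exprS invfM rmorphM mulrA.
  rewrite -rmorphM divff ?gt_eqF// mul1r; congr (_ * cpow g _ t); lia.
(* Raising the index by one is a convolution, so [rnorm_conv] turns the L2-Cauchy property into a
   uniform one. *)
have PS m n t : P m.+1 t - P n.+1 t =
    (lam^-1)%:C * conv (p 1) (fun t => P m t - P n t) t.
  rewrite convBr// !conv1P -mulrBr mulrA -rmorphM mulVf ?gt_eqF// mul1r.
  by [].
have [e e0|K cK PK] := uniform_complete (fun n => cP n.+1).
  have e0' : 0 < (lam * e) ^+ 2 / (d 1) by rewrite divr_gt0// exprn_gt0// mulr_gt0.
  have [N NP] := N2_C _ e0'; exists N => m n Nm Nn t.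
  rewrite PS rnormM rnormC_ge0; last by rewrite invr_ge0 ltW.
  rewrite ler_pdivrMl//.
  rewrite -(@ler_pXn2r _ 2)// ?nnegrE ?rnorm_ge0//; last by rewrite mulr_ge0// ltW.
  apply: le_trans (rnorm_conv cptG t (cp 1) (ccontB (cP m) (cP n))) _.
  by rewrite -/(d 1) mulrC -ler_pdivlMr// NP.
have PK' : ulim P K.
  move=> e e0; have [N NP] := PK _ e0; exists N.+1 => -[//|n] Nn; exact: NP.
have PmK m : conv (P m) K = K.
  apply: ulim_uniq (ulim_conv (cP m) cP cK PK') _.
  move=> e e0; have [N NP] := PK' _ e0; exists N => n Nn t.
  by rewrite PM; apply: NP; lia.
exists lam, K; split => //.
(* [P N 0 = q N] is at least 1 by the bound [lam ^+ N.+1 <= d N]; in the limit this keeps [K] from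
   vanishing. *)
- split=> //; apply/ler_addgt0Pr => e e0.
  have [N /(_ N (leqnn _) 0)] := PK' _ e0.
  have -> : P N 0 = (q N)%:C by rewrite /P dE -rmorphM /q mulrC.
  have q1 : 1 <= q N by rewrite /q ler_pdivlMr// mul1r.
  move=> h; have := le_trans (Re_le_rnorm _) h; rewrite ReB /=; lra.
- split.
    apply: ulim_uniq (ulim_conv cK cP cK PK') _.
    move=> e e0; exists 0 => n _ t; rewrite convC// PmK subrr rnorm0.
    exact: ltW.
  apply: ulim_uniq (ulim_star PK') _; rewrite (_ : (fun _ => _) = P)//.
  apply/funext => n; apply/funext => t.
  have -> : star (P n) t = a n * star (p (n + n).+1) t by rewrite /star /P conjcM a_real.
  by rewrite star_cpow.
- apply: ulim_uniq (ulim_conv (cp 1) cP cK PK') _.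
  rewrite (_ : (fun _ => _) = (fun n t => lam%:C * P n.+1 t)); last first.
    by apply/funext => n; rewrite conv1P.
  exact: ulimZ.
- move=> e ce ge; rewrite convC//.
  apply: ulim_uniq (ulim_conv ce cP cK PK') _.
  rewrite (_ : (fun _ => _) = P)//; apply/funext => n.
  rewrite convC// /P (convZl cptG _ (cp _) ce) (_ : conv (p _) e = p (n + n).+1)//.
  rewrite /p; elim: (n + n).+1 => [//|k ih] /=.
  by rewrite -convA ?ih//; exact: cp.
Qed.

End spectral_idempotent.

Definition conv_idem (e : G -> R[i]) := [/\ ccont e, conv e e = e & star e = e].

Lemma idem_at0 (e : G -> R[i]) : conv_idem e -> e 0 = (N2 e)%:C.
Proof. by case=> ce ee se; rewrite -{1}ee -{2}se conv_star0 ip_N2. Qed.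

(** Since [e = e * e], [N2 e] is at most its own square. In what follows [N2] plays the role of the
    rank of a projection. *)
Lemma idem_N2_ge1 (e : G -> R[i]) : conv_idem e -> (exists x, e x != 0) -> 1 <= N2 e.
Proof.
move=> [ce ee se] [x ex].
have e0 : 0 < N2 e.
  rewrite lt_def N2_ge0// andbT; apply/eqP => e0.
  by move/eqP : ex; apply; exact: N2_eq0.
by rewrite -(ler_pM2l e0) mulr1 -{1}ee; exact: N2_conv.
Qed.

Definition minimal_idempotent (e : G -> R[i]) := [/\ conv_idem e, exists x, e x != 0 &
  forall e', conv_idem e' -> conv e' e = e' -> (exists x, e' x != 0) -> e' = e].

(** A proper nonzero idempotent [e'] below [e] splits [N2 e] into [N2 e'] and [N2 (e - e')], each at
    least 1, so the descent ends; [n] bounds its length. *)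
Lemma minimal_idempotent_ex n (e : G -> R[i]) : conv_idem e -> (exists x, e x != 0) ->
  N2 e <= n%:R -> exists2 e0, minimal_idempotent e0 & conv e0 e = e0.
Proof.
elim: n e => [|n ih] e ie e0.
  move=> /(le_trans (idem_N2_ge1 ie e0)); by rewrite ler10.
move=> en; have [me|/not_and3P] := pselect (minimal_idempotent e).
  by exists e => //; case: ie.
case=> // /existsNP[e' /not_implyP[ie' /not_implyP[e'e /not_implyP[e'0 ee']]]].
have [ce ee se] := ie; have [ce' ee'' se'] := ie'.
pose k t := e t - e' t; have ck : ccont k by exact: ccontB.
have k0 : exists x, k x != 0.
  apply: contrapT => /forallNP h; apply: ee'; apply/funext => x.
  by apply/esym/subr0_eq; move/negP : (h x); rewrite negbK => /eqP.
have ik : conv_idem k.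
  split => //.
    rewrite {1}/k convBl// /k !convBr// ee e'e (convC cptG ce ce') e'e ee''.
    by apply/funext => t; rewrite subrr subr0.
  by apply/funext => t; rewrite /star /k conjcB -[in RHS]se -[in RHS]se'.
have N2D : N2 k = N2 e - N2 e'.
  by apply: (@complexI R); rewrite -idem_at0// rmorphB /= -!idem_at0.
have [|e0' m0 e0'e'] := ih e' ie' e'0.
  by have := idem_N2_ge1 ik k0; rewrite N2D; move: en; rewrite -natr1; lra.
by exists e0' => //; rewrite -e0'e' -convA// ?e'e//; case: m0 => -[].
Qed.

(* Self-adjoint x = x * e satisfy x * x = lam e; polarize. *)
Lemma minimal_idempotent_scalar (e x : G -> R[i]) : minimal_idempotent e -> ccont x ->
  conv x e = x -> exists c, x = (fun t => c * e t).
Proof.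
move=> [[ce ee se] e0 em] cx xe.
have sq y : ccont y -> star y = y -> conv y e = y ->
    exists c, conv y y = (fun t => c * e t).
  move=> cy sy ye; have [y0|/forallNP y0] := pselect (exists x, y x != 0).
    have [lam [K [l0 [cK K0] [KK sK] ggK eK]]] := spectral_idempotent cy sy y0.
    (* [K] is absorbed by [e] because [y] is, so minimality applies; then [y * y = y * y * e] is
       [lam] times [e]. *)
    have Ke : K = e.
      apply: em => //; first exact: eK.
      exists 0; apply/eqP => Kz; move: K0; rewrite Kz /= ler10//.
    by exists lam%:C; move: ggK; rewrite Ke -convA// ye.
  have {}y0 t : y t = 0 by move/negP : (y0 t); rewrite negbK => /eqP.
  exists 0; apply/funext => t; rewrite mul0r /conv -[RHS](@mean_cst R G 0).
  by congr mean; apply/funext => s; rewrite y0 mul0r.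
have sa y : ccont y -> star y = y -> conv y e = y -> exists c, y = (fun t => c * e t).
  move=> cy sy ye; pose z t := y t + e t.
  have cz : ccont z by exact: ccontD.
  have [a ya] := sq y cy sy ye.
  have [||b zb] := sq z cz.
  - by apply/funext => t; rewrite /star /z conjcD -[in RHS]sy -[in RHS]se.
  - by rewrite /z convDl// ye ee.
  (* Solve [(y + e) * (y + e) = y * y + 2 y + e] for [y], the two squares being [b e] and [a e]. *)
  exists ((b - a - 1) / 2); apply/funext => t.
  have : conv z z t = conv y y t + 2 * y t + e t.
    rewrite {1}/z convDl// (convC cptG cy cz) (convC cptG ce cz) /z !convDl//.
    by rewrite ye ee (convC cptG ce cy) ye; ring.
  rewrite ya zb => h; apply: (@mulfI _ 2); first by rewrite pnatr_eq0.
  rewrite mulrA mulrCA divff ?mulr1 ?pnatr_eq0//.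
  by rewrite !mulrBl h; ring.
have cs := ccont_star cx.
have sxe : conv (star x) e = star x.
  by rewrite -{1}se -star_conv// xe.
have i2 : ('i : R[i]) * 'i = -1 by rewrite -expr2 sqr_i.
have ci : conjc 'i = - 'i :> R[i] by apply/eqP; rewrite eq_complex /= oppr0 !eqxx.
have [||a ha] := sa (fun t => x t + star x t) (ccontD cx cs).
- by apply/funext => t; rewrite /star conjcD opprK [conjc (conjc _)]conjcK addrC.
- by rewrite convDl// xe sxe.
have cd : ccont (fun t => 'i * (x t - star x t)) by apply/ccontZ/ccontB.
have [||b hb] := sa (fun t => 'i * (x t - star x t)) cd.
- apply/funext => t; rewrite /star conjcM conjcB opprK [conjc (conjc _)]conjcK ci.
  by rewrite mulNr -mulrN opprB.
- by rewrite (convZl cptG _ (ccontB cx cs) ce) convBl// xe sxe.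
(* [2 x] is [x + star x] minus ['i] times ['i (x - star x)], and these self-adjoint functions are
   [a e] and [b e]. *)
exists ((a - 'i * b) / 2); apply/funext => t.
have {}ha : x t + star x t = a * e t by rewrite -[RHS](congr1 (fun f => f t) ha).
have {}hb : 'i * (x t - star x t) = b * e t by rewrite -[RHS](congr1 (fun f => f t) hb).
apply: (@mulfI _ 2); first by rewrite pnatr_eq0.
rewrite mulrA [2 * (_ / 2)]mulrC divfK ?pnatr_eq0//.
by rewrite mulrBl -mulrA -ha -hb mulrA i2; ring.
Qed.

(** A translate of [e] is still absorbed by [e], hence a scalar multiple of [e]; this is
    multiplicativity of [e] divided by [e 0]. Unimodularity then follows from [star e = e]. *)
Lemma minimal_idempotent_character (e : G -> R[i]) : minimal_idempotent e ->
  exists chi : dual_group R G, e = (fun t => e 0 * chi t).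
Proof.
move=> me; have [ie e0 _] := me; have [ce ee se] := ie.
have e00 : e 0 != 0.
  rewrite idem_at0// eq_complex /= negb_and gt_eqF//.
  exact: lt_le_trans ltr01 (idem_N2_ge1 ie e0).
pose chi t := e t / e 0.
have chiM s t : chi (s + t) = chi s * chi t.
  have [|c hc] :=
      @minimal_idempotent_scalar e (fun s => e (s + t)) me (ccont_shift t ce).
    by rewrite conv_shiftl// ee.
  have h z : e (z + t) = c * e z := congr1 (fun f : G -> R[i] => f z) hc.
  have := h 0; rewrite add0r => et.
  by rewrite /chi h et [c * e 0 / e 0]mulfK// -mulrA mulrC.
have chi0 : chi 0 = 1 by rewrite /chi divff.
have chiN t : chi (- t) = conjc (chi t).
  have eN : conjc (e t) = e (- t) by rewrite -{1}se /star [conjc (conjc _)]conjcK.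
  have ce0 : conjc (e 0) = e 0 by rewrite idem_at0// conjc_real.
  by rewrite /chi conjcM eN conjc_inv ce0.
have chi1 t : rnorm (chi t) = 1.
  have : chi t * chi (- t) = 1 by rewrite -chiM subrr.
  rewrite chiN mulcJ => -[] /eqP; rewrite sqrp_eq1 ?rnorm_ge0// => /eqP //.
have ichi : chi \in @is_character R G.
  apply/asboolP; split => [|//|t]; last by rewrite normE chi1.
  by apply/ccontP; apply: ccontM => //; exact: ccont_cst.
exists (Character ichi); apply/funext => t.
by rewrite /= /chi mulrCA divff ?mulr1.
Qed.

Lemma ccont_char (chi : dual_group R G) : ccont chi.
Proof. by apply/ccontP; exact: dual_group_continuous. Qed.

Lemma charN (chi : dual_group R G) t : chi (- t) = conjc (chi t).
Proof.
have c1 : chi t * chi (- t) = 1 by rewrite -dual_groupD subrr char_at0.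
have c2 : chi t * conjc (chi t) = 1.
  by rewrite mulcJ /rnorm dual_group_norm /= expr1n.
have ct : chi t != 0 by apply/eqP => ct; move/eqP : c1; rewrite ct mul0r eq_sym oner_eq0.
by apply: (mulfI ct); rewrite c1 c2.
Qed.

Lemma star_char (chi : dual_group R G) : star chi = chi.
Proof. by apply/funext => t; rewrite /star charN [LHS]conjcK. Qed.

Lemma conv_char f (chi : dual_group R G) : ccont f ->
  conv f chi = (fun t => ip f chi * chi t).
Proof.
move=> cf; have cc := ccont_char chi.
have cp : ccont (fun s => f s * conjc (chi s)) by ccont.
apply/funext => t; rewrite /conv /ip mulrC -(meanZ cptG _ cp).
congr mean; apply/funext => s.
by rewrite dual_groupD charN mulrCA.
Qed.

(** The spectral idempotent of [g = f * star f] dominates a minimal idempotent [e], a multiple of a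
    character [chi]. Were [ip f chi] zero, [f * e] and hence [g * g * e] would vanish, but the
    latter is [lam e]. *)
Lemma fourier_injective f : ccont f -> (exists x, f x != 0) ->
  exists chi : dual_group R G, ip f chi != 0.
Proof.
move=> cf [x fx]; pose g := conv f (star f).
have csf := ccont_star cf; have cg : ccont g by exact: ccont_conv.
have sg : star g = g by rewrite /g star_conv// starK convC.
have g0 : exists x, g x != 0.
  exists 0; rewrite /g conv_star0 ip_N2//.
  rewrite eq_complex /= negb_and; apply/orP; left; apply/eqP => f0.
  by move/eqP : fx; apply; exact: N2_eq0.
have [lam [K [l0 [cK K0] [KK sK] ggK eK]]] := spectral_idempotent cg sg g0.
have K0' : exists x, K x != 0.
  by exists 0; apply/eqP => Kz; move: K0; rewrite Kz /= ler10.
have [n Kn] : exists n, N2 K <= n%:R.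
  exists (Num.truncn (N2 K)).+1; exact/ltW/truncnS_gt.
have [e me eK'] := minimal_idempotent_ex (And3 cK KK sK) K0' Kn.
have [chi echi] := minimal_idempotent_character me.
have [[ce ee se] [y ey] _] := me.
exists chi; apply/eqP => fchi.
have fe : conv f e = (fun=> 0).
  rewrite echi (convZr cptG _ cf (ccont_char chi)) conv_char//.
  by apply/funext => t; rewrite fchi mul0r mulr0.
have ge : conv g e = (fun=> 0).
  rewrite /g (convC cptG cf csf) -convA// fe; apply/funext => t.
  rewrite /conv -[RHS](@mean_cst R G 0); congr mean; apply/funext => s.
  by rewrite mulr0.
have : conv (conv g g) e = (fun t => lam%:C * e t).
  rewrite -{1}eK' (convC cptG ce cK) convA//; last exact: ccont_conv.
  rewrite ggK (convZl cptG _ cK ce) (convC cptG cK ce) eK' //.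
rewrite -convA// ge => /(congr1 (fun f => f y)) /eqP.
rewrite /conv (_ : mean _ = 0); last first.
  rewrite -[RHS](@mean_cst R G 0); congr mean; apply/funext => s.
  by rewrite mulr0.
rewrite eq_sym mulf_eq0 (negbTE ey) orbF.
by rewrite eq_complex /= gt_eqF.
Qed.

End idempotents.

(** * Uniform density of trigonometric polynomials *)

Section density.
Context {R : realType} {G : topologicalZmodType}.
Hypothesis cptG : compact [set: G].
Implicit Types (f g h : G -> R[i]) (c : R[i]) (l : seq (R[i] * dual_group R G)).

Definition trig l (t : G) : R[i] := \sum_(x <- l) x.1 * x.2 t.

Lemma ccont_trig l : ccont (trig l).
Proof. by apply: ccont_sum => x; apply/ccontZ/ccont_char. Qed.

Lemma trig_cat l l' t : trig (l ++ l') t = trig l t + trig l' t.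
Proof. by rewrite /trig big_cat. Qed.

Lemma trig_scale c l t : trig [seq (c * x.1, x.2) | x <- l] t = c * trig l t.
Proof.
by rewrite /trig big_map mulr_sumr; apply: eq_bigr => x _; rewrite mulrA.
Qed.

Lemma conv_trig g l : ccont g ->
  conv g (trig l) =
  trig [seq (x.1 * ip g x.2, x.2) | x : R[i] * dual_group R G <- l].
Proof.
move=> cg; elim: l => [|x l ih].
  apply/funext => t; rewrite /trig big_nil /conv -[RHS](@mean_cst R G 0).
  by congr mean; apply/funext => s; rewrite /trig big_nil mulr0.
have cx := ccont_char x.2; have cl := ccont_trig l.
have -> : trig (x :: l) = (fun t => x.1 * x.2 t + trig l t).
  by apply/funext => t; rewrite /trig big_cons.
rewrite (convC cptG cg (ccontD (ccontZ x.1 cx) cl)).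
rewrite (convDl cptG (ccontZ x.1 cx) cl cg) (convC cptG cl cg) ih.
rewrite (convZl cptG _ cx cg) (convC cptG cx cg) (conv_char cptG _ cg).
by apply/funext => t; rewrite /trig big_cons mulrA.
Qed.

Lemma N2_parallelogram f g : ccont f -> ccont g ->
  N2 (fun x => f x - g x) = 2 * N2 f + 2 * N2 g - N2 (fun x => f x + g x).
Proof.
move=> cf cg; have cNg := ccontZ (-1) cg.
have -> : (fun x => f x + g x) = (fun x => f x - (-1) * g x).
  by apply/funext => x; rewrite mulN1r opprK.
rewrite !N2B// N2Z// rnormN rnorm1 expr1n mul1r.
have -> : ip f (fun x => -1 * g x) = - ip f g.
  rewrite (ipC cptG cNg cf) (ipZl cptG _ cg cf) (ipC cptG cf cg).
  by rewrite mulN1r rmorphN /= conjcK.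
by rewrite raddfN /=; ring.
Qed.

Lemma N2_char (chi : dual_group R G) : N2 chi = 1.
Proof.
rewrite /N2 ipE (_ : (fun _ => _) = fun=> 1) ?mean_cst//.
by apply/funext => t; rewrite /rnorm dual_group_norm /= expr1n.
Qed.

Lemma ip_conv_char f g (chi : dual_group R G) : ccont f -> ccont g ->
  ip (conv g f) chi = ip g chi * ip f chi.
Proof.
move=> cf cg; have cc := ccont_char chi.
rewrite -conv_star0 star_char -(convA cptG cg cf cc) (conv_char cptG _ cf).
by rewrite (convZr cptG _ cg cc) (conv_char cptG _ cg) char_at0 mulr1 mulrC.
Qed.

Lemma ip_sup f g (e : R) : ccont f -> ccont g -> (forall t, rnorm (f t - g t) <= e) ->
  forall chi : dual_group R G, rnorm (ip f chi - ip g chi) <= e.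
Proof.
move=> cf cg fg chi; have cc := ccont_conj (ccont_char chi).
rewrite /ip -(meanB cptG (ccontM cf cc) (ccontM cg cc)).
apply: mean_le => // [|t]; first exact: ccontB (ccontM cf cc) (ccontM cg cc).
rewrite -mulrBl rnormM rnorm_conj.
by rewrite [X in _ * X](_ : _ = 1) ?mulr1//; rewrite /rnorm dual_group_norm.
Qed.

Lemma small_inv (e : R) : 0 < e -> exists N, forall n, (N <= n)%N -> n.+1%:R^-1 <= e.
Proof.
move=> e0; exists (Num.truncn e^-1) => n Nn.
rewrite invf_ple ?posrE//; apply: le_trans (ltW (truncnS_gt _)) _.
by rewrite ler_nat.
Qed.

(* Trigonometric polynomials p n minimizing N2 (f - p n) form an L2-Cauchy
   sequence, so that g * p n converges uniformly; by minimality the limit has the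
   Fourier coefficients of g * f. *)
Lemma trig_dense_conv f g : ccont f -> ccont g -> forall e : R, 0 < e ->
  exists l, forall t, rnorm (conv g f t - trig l t) <= e.
Proof.
move=> cf cg.
pose D := [set N2 (fun t => f t - trig l t) | l in [set: seq (R[i] * dual_group R G)]].
have Dinf : has_inf D.
  split; first by exists (N2 (fun t => f t - trig [::] t)), [::].
  by exists 0 => _ [l _ <-]; apply/N2_ge0 => //; apply/ccontB/ccont_trig.
have Dle l : inf D <= N2 (fun t => f t - trig l t).
  by apply: ge_inf; [case: Dinf|exists l].
have /choice[L LP] : forall n : nat, exists l,
    N2 (fun t => f t - trig l t) <= inf D + n.+1%:R^-1.
  move=> n; have [|_ [l _ <-] /ltW h] := @inf_adherent R D n.+1%:R^-1 _ Dinf.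
    by rewrite invr_gt0.
  by exists l.
pose w n t := f t - trig (L n) t.
have cw n : ccont (w n) by apply/ccontB/ccont_trig.
have cp n : ccont (trig (L n)) := ccont_trig (L n).
have N2w m n : N2 (fun t => trig (L m) t - trig (L n) t) <=
    2 * n.+1%:R^-1 + 2 * m.+1%:R^-1.
  have -> : (fun t => trig (L m) t - trig (L n) t) = (fun t => w n t - w m t).
    by apply/funext => t; rewrite /w; ring.
  rewrite N2_parallelogram//.
  (* The midpoint of two near-minimizers is itself a competitor, so the parallelogram law bounds
     their distance. *)
  pose l' := [seq ((2^-1 : R[i]) * x.1, x.2) | x <- L n ++ L m].
  have -> : (fun t => w n t + w m t) = (fun t => 2 * (f t - trig l' t)).
    apply/funext => t; rewrite /l' trig_scale trig_cat mulrBr mulrA divff ?pnatr_eq0//.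
    by rewrite mul1r /w; ring.
  rewrite N2Z//; last exact/ccontB/ccont_trig.
  have -> : rnorm (2 : R[i]) ^+ 2 = 4.
    by rewrite -(rmorph_nat (real_complex R)) rnormC_ge0//; ring.
  have := Dle l'; have := LP n; have := LP m; rewrite -!/(w _) /w.
  by move: (n.+1%:R^-1) (m.+1%:R^-1) (N2 _) (N2 _) (N2 _) (inf D) => *; lra.
have [e e0|h ch hP] := @uniform_complete R G (fun n => conv g (trig (L n)))
    (fun n => ccont_conv cptG cg (cp n)).
  have g0 : 0 < N2 g + 1 by rewrite ltr_wpDl// N2_ge0.
  have e2 : 0 < e ^+ 2 / (4 * (N2 g + 1)) by rewrite divr_gt0 ?exprn_gt0// mulr_gt0.
  have [N NP] := small_inv e2; exists N => n m Nn Nm t.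
  have -> : conv g (trig (L n)) t - conv g (trig (L m)) t =
      conv g (fun t => trig (L n) t - trig (L m) t) t by rewrite convBr.
  rewrite -(@ler_pXn2r _ 2)// ?nnegrE ?rnorm_ge0//; last exact: ltW.
  apply: le_trans (rnorm_conv cptG t cg (ccontB (cp n) (cp m))) _.
  apply: (@le_trans _ _ ((N2 g + 1) * (2 * m.+1%:R^-1 + 2 * n.+1%:R^-1))).
    by apply: ler_pM => //; [exact: N2_ge0|exact/N2_ge0/ccontB|rewrite lerDl].
  have := NP _ Nn; have := NP _ Nm; rewrite !ler_pdivlMr ?mulr_gt0//.
  by move: (n.+1%:R^-1) (m.+1%:R^-1) (e ^+ 2) (N2 g + 1) g0 => *; lra.
have k0 : conv g f = h.
  apply: contrapT => kh; pose k t := conv g f t - h t.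
  have ck : ccont k by apply: ccontB => //; exact: ccont_conv.
  have /(fourier_injective cptG ck)[chi /eqP] : exists x, k x != 0.
    apply: contrapT => /forallNP kz; apply: kh; apply/funext => x.
    by apply/subr0_eq; move/negP : (kz x); rewrite negbK => /eqP.
  apply; apply: rnorm_small => e e0; have e2 : 0 < e / 2 by rewrite divr_gt0.
  pose B := rnorm (ip g chi) + 1.
  have B0 : 0 < B by rewrite ltr_wpDl// rnorm_ge0.
  have e3 : 0 < (e / 2 / B) ^+ 2 by rewrite exprn_gt0// divr_gt0.
  have [N NP] := small_inv e3; have [M MP] := hP _ e2.
  pose n := maxn N M.
  have h1 : rnorm (ip k chi - ip (conv g (w n)) chi) <= e / 2.
    apply: ip_sup => //; first exact: ccont_conv.
    move=> t.
    have -> : k t - conv g (w n) t = conv g (trig (L n)) t - h t by rewrite /k /w convBr//; ring.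
    exact: MP (leq_maxr _ _) t.
  have h2 : rnorm (ip (w n) chi) <= e / 2 / B.
    rewrite -(@ler_pXn2r _ 2)// ?nnegrE ?rnorm_ge0//; last by rewrite !divr_ge0 ?ltW.
    apply: le_trans (NP n (leq_maxl _ _)).
    set c := ip (w n) chi; have cc := ccont_char chi.
    (* Adding the [chi]-component of the remainder to the polynomial lowers [N2] by [rnorm c ^+ 2];
       near-minimality bounds this gain by the inverse of [n.+1]. *)
    have := Dle (L n ++ [:: (c, chi)]).
    have -> : (fun t => f t - trig (L n ++ [:: (c, chi)]) t) = (fun t => w n t - c * chi t).
      by apply/funext => t; rewrite trig_cat [trig [:: _] t]big_seq1 opprD addrA.
    rewrite N2B//; last exact: ccontZ.
    rewrite N2Z// N2_char mulr1 (ipC cptG (ccontZ c cc) (cw n)) (ipZl cptG _ cc (cw n)).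
    rewrite (ipC cptG (cw n) cc) -/c mulcJ /=.
    have := LP n; rewrite -/(w n).
    by move: (n.+1%:R^-1) (rnorm c ^+ 2) (N2 _) (inf D) => *; lra.
  apply: le_trans (ler_rnormBD _ (ip (conv g (w n)) chi)) _.
  rewrite [e]splitr lerD// ip_conv_char// rnormM.
  apply: (@le_trans _ _ (B * (e / 2 / B))); last first.
    by rewrite mulrCA divff ?mulr1// gt_eqF.
  by apply: ler_pM; rewrite ?rnorm_ge0// lerDl.
move=> e /hP[N /(_ N (leqnn N)) NP].
exists [seq (x.1 * ip g x.2, x.2) | x : R[i] * dual_group R G <- L N] => t.
by rewrite -conv_trig// k0 rdistC.
Qed.

(** Multiplying [f] by the phase [u] makes its mean real and nonnegative, and the mean is monotone
    on real parts. *)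
Lemma mean_le_mean f (k : G -> R) : ccont f -> ccont (fun x => (k x)%:C) ->
  (forall x, rnorm (f x) <= k x) -> rnorm (mean f) <= Re (mean (fun x => (k x)%:C)).
Proof.
move=> cf ck fk; have [m0|m0] := eqVneq (mean f) 0.
  rewrite m0 rnorm0; apply: mean_Re_ge => // x.
  exact: le_trans (rnorm_ge0 _) (fk x).
have n0 : 0 < rnorm (mean f).
  rewrite lt_def rnorm_ge0 andbT; apply: contra m0 => /eqP m0.
  by apply/eqP/rnorm0_eq0.
pose u := conjc (mean f) / (rnorm (mean f))%:C.
have u1 : rnorm u = 1.
  by rewrite /u rnormM rnormV rnorm_conj rnormC_ge0 ?divff ?gt_eqF// ltW.
have um : u * mean f = (rnorm (mean f))%:C.
  rewrite /u mulrAC [conjc _ * _]mulrC mulcJ -fmorphV -rmorphM expr2 mulfK//.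
  by rewrite gt_eqF.
rewrite -subr_ge0 -[rnorm _]/(Re (rnorm (mean f))%:C) -um -meanZ// -ReB.
have cuf := ccontZ u cf.
rewrite -(meanB cptG ck cuf); apply: mean_Re_ge => //; first exact: ccontB.
move=> x; rewrite ReB /= subr_ge0; apply: le_trans (fk x).
by apply: le_trans (Re_le_rnorm _) _; rewrite rnormM u1 mul1r.
Qed.

Lemma ccont_urysohn {X : topologicalType} (A B : set X) :
  compact [set: X] -> hausdorff_space X -> closed A -> closed B -> A `&` B = set0 ->
  exists k : X -> R, [/\ ccont (fun x => (k x)%:C), forall x, 0 <= k x <= 1,
    forall x, A x -> k x = 0 & forall x, B x -> k x = 1].
Proof.
move=> cptX hX cA cB AB.
have /(normal_separatorP (R := R)) nX := compact_normal hX cptX.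
have /(uniform_separatorP (R := R))[k [ck k01 kA kB]] := nX _ _ cA cB AB.
exists k; split.
- exact/ccont_real.
- by move=> x; have := k01 (k x) (ex_intro2 _ _ x I erefl); rewrite /= in_itv.
- by move=> x Ax; apply: kA; exists x.
- by move=> x Bx; apply: kB; exists x.
Qed.

Hypothesis hausG : hausdorff_space G.

(** [g] is a Urysohn function normalized to mean 1, vanishing off a neighbourhood of 0 whose
    translations move [f] by at most [e]. *)
Lemma conv_approx_identity f (e : R) : ccont f -> 0 < e ->
  exists2 g, ccont g & forall t, rnorm (conv g f t - f t) <= e.
Proof.
move=> cf e0; have cF := ccont_sub2 cf.
pose F t s := f (t - s).
have cF' : ccont (fun p : G * G => F p.1 p.2).
  by apply: ccont_comp cf; exact: sub_continuous.
have : nbhs (0 : G) [set s | forall t, rnorm (F t s - F t 0) <= e].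
  exact: (near_uniform cptG cF').
rewrite nbhsE => -[U [oU U0] UP].
have [|||k [ck k01 kU k0]] := @ccont_urysohn G (~` U) [set 0] cptG hausG.
- exact: open_closedC.
- by apply: accessible_closed_set1; exact: hausdorff_accessible.
- by rewrite -subset0 => x /= [Ux x0]; apply: Ux; rewrite x0.
have m0 : 0 < Re (mean (fun x => (k x)%:C)).
  apply: (mean_gt0 cptG (x0 := 0)) => //; last by rewrite k0.
  by move=> x; have /andP[] := k01 x.
have mk := mean_real cptG ck; set m := Re _ in m0 mk.
have mE : (m^-1)%:C * m%:C = 1 :> R[i] by rewrite -rmorphM mulVf ?gt_eqF.
exists (fun s => (m^-1)%:C * (k s)%:C) => [|t]; first exact: ccontZ.
have cs := ccont_subl t cf.
rewrite (convZl cptG _ ck cf) -[f t]mul1r -mE -mulrA -mulrBr -mk rnormM.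
rewrite rnormC_ge0; last by rewrite invr_ge0 ltW.
rewrite ler_pdivrMl//.
have -> : conv (fun x => (k x)%:C) f t - mean (fun x => (k x)%:C) * f t =
    mean (fun s => (k s)%:C * (f (t - s) - f t)).
  rewrite [_ * f t]mulrC -(meanZ cptG _ ck) -(meanB cptG (ccontM ck cs) (ccontZ _ ck)).
  by congr mean; apply/funext => s; ring.
have cek : ccont (fun s => (e * k s)%:C).
  under eq_fun do rewrite rmorphM; exact: ccontZ.
apply: le_trans (@mean_le_mean _ (fun s => e * k s) _ cek _) _.
- by apply: ccontM => //; apply: ccontB => //; exact: ccont_cst.
- move=> s; rewrite rnormM rnormC_ge0; last by have /andP[] := k01 s.
  rewrite mulrC; have [Us|Us] := pselect (U s); last by rewrite kU// !mulr0.
  apply: ler_wpM2r; first by have /andP[] := k01 s.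
  by have := UP s Us t; rewrite /F subr0.
under eq_fun do rewrite rmorphM /=.
rewrite (meanZ cptG _ ck) mk -rmorphM /=.
by rewrite mulrC.
Qed.

Theorem trig_dense f (e : R) : ccont f -> 0 < e ->
  exists l, forall t, rnorm (f t - trig l t) <= e.
Proof.
move=> cf e0; have e2 : 0 < e / 2 by rewrite divr_gt0.
have [g cg gP] := conv_approx_identity cf e2.
have [l lP] := trig_dense_conv cf cg e2.
exists l => t; apply: le_trans (ler_rdistD (conv g f t) _ _) _.
by rewrite [e]splitr lerD// rdistC.
Qed.

End density.

(** * The Gelfand transform *)

Section exponential_growth.
Context {R : realType}.

Lemma bernoulli_ge (x : R) n : 0 <= x -> 1 + n%:R * x <= (1 + x) ^+ n.
Proof.
move=> x0; elim: n => [|n ih]; first by rewrite mul0r addr0 expr0.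
rewrite exprS -natr1; have n0 : 0 <= n%:R * x by rewrite mulr_ge0.
apply: (@le_trans _ _ ((1 + x) * (1 + n%:R * x))).
  by move: n0; set m := n%:R => n0; nra.
by rewrite ler_wpM2l// addr_ge0.
Qed.

(** A polynomial factor cannot keep up with the powers of a ratio [x / M] greater than 1. *)
Lemma le_of_poly_bound (x M : R) d : 0 <= x -> 0 <= M ->
  (forall k, x ^+ (2 ^ k) <= (2 ^ k).+1%:R ^+ d * M ^+ (2 ^ k)) -> x <= M.
Proof.
move=> x0; rewrite le_eqVlt => /orP[/eqP<- h|M0 h].
  by have := h 0%N; rewrite expn0 !expr1 mulr0.
rewrite leNgt; apply/negP => Mx; pose y := x / M.
have y1 : 1 < y by rewrite /y ltr_pdivlMr// mul1r.
(* The root has order [d.+1], one more than the degree: each of the [d.+1] factors [z ^+ n] is at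
   least [c * n.+1] by Bernoulli, and one linear factor is left over. *)
have [z z0 zE] := nth_root d (ltW (lt_trans ltr01 y1)).
have z1 : 1 < z.
  rewrite ltNge; apply/negP => z1; move: y1; rewrite -zE ltNge.
  by rewrite exprn_ile1.
pose c := Num.min 1 (z - 1).
have c0 : 0 < c by rewrite lt_min ltr01 subr_gt0.
have zn n : c * n.+1%:R <= z ^+ n.
  have := @bernoulli_ge (z - 1) n; rewrite subr_ge0 (ltW z1) [1 + (z - 1)]addrC subrK => /(_ isT).
  apply: le_trans; rewrite -natr1 mulrDr mulr1 addrC.
  apply: lerD; first by rewrite ge_min lexx.
  by rewrite mulrC ler_wpM2l// ge_min lexx orbT.
have key k : c ^+ d.+1 * (2 ^ k).+1%:R <= 1.
  have yk : y ^+ (2 ^ k) <= (2 ^ k).+1%:R ^+ d.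
    by rewrite /y expr_div_n ler_pdivrMr ?exprn_gt0.
  have N0 : 0 < (2 ^ k).+1%:R ^+ d :> R by rewrite exprn_gt0.
  rewrite -(ler_pM2r N0) mul1r -mulrA -exprS -exprMn.
  apply: le_trans yk; rewrite -zE exprAC; apply: lerXn2r => //.
    by rewrite nnegrE mulr_ge0// ltW.
  by rewrite nnegrE exprn_ge0.
pose k := Num.truncn (c ^+ d.+1)^-1.
have := key k; rewrite leNgt => /negP; apply.
rewrite mulrC -ltr_pdivrMr ?exprn_gt0// mul1r.
apply: lt_le_trans (truncnS_gt _) _; rewrite ler_nat ltnS.
exact/ltnW/ltn_expl.
Qed.

End exponential_growth.

Section cstar_norm.
Context {R : realType} {A : cstarType R}.
Implicit Types a b : A.

Lemma rcnormM a b : rnorm (cmul a b) <= rnorm a * rnorm b.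
Proof. by rewrite -lecR rmorphM /= -!normE; exact: cnormM. Qed.

Lemma rcnorm_star a : rnorm (cmul (cstar a) a) = rnorm a ^+ 2.
Proof. by apply: (@complexI R); rewrite rmorphXn /= -!normE cnorm_star. Qed.

Lemma rnorm_cstar a : rnorm (cstar a) = rnorm a.
Proof. by rewrite /rnorm cnorm_cstar. Qed.

Lemma cmulBl a b c : cmul (a - b) c = cmul a c - cmul b c.
Proof. by rewrite cmulDl -scaleN1r cmulZl scaleN1r. Qed.

Lemma cmulBr a b c : cmul c (a - b) = cmul c a - cmul c b.
Proof. by rewrite cmulDr -scaleN1r cmulZr scaleN1r. Qed.

Lemma cstarB a b : cstar (a - b) = cstar a - cstar b.
Proof.
rewrite cstarD -scaleN1r cstarZ.
by rewrite (_ : conjc (-1) = -1 :> R[i]) ?scaleN1r// rmorphN rmorph1.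
Qed.

Lemma cmul0l b : cmul 0 b = 0 :> A.
Proof. by have := cmulZl 0 0 b; rewrite !scale0r. Qed.

Lemma cmul0r b : cmul b 0 = 0 :> A.
Proof. by have := cmulZr 0 b 0; rewrite !scale0r. Qed.

Lemma cstar0 : cstar 0 = 0 :> A.
Proof. by have := cstarZ 0 (0 : A); rewrite conjc0 !scale0r. Qed.

Lemma cauchy_cvgA (V : completeNormedModType R[i]) (x : nat -> V) :
  (forall e : R, 0 < e -> exists N, forall n m, (N <= n)%N -> (N <= m)%N ->
     rnorm (x n - x m) <= e) ->
  exists l : V, forall e : R, 0 < e ->
    exists N, forall n, (N <= n)%N -> rnorm (x n - l) <= e.
Proof.
move=> cx; have : cvgn x.
  apply/cauchy_cvgP/cauchy_exP => e e0.
  have eE : e = (Re e)%:C by rewrite RRe_real// gtr0_real.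
  have e0' : 0 < Re e by rewrite -ltcR -eE.
  have [|N xN] := cx (Re e / 2); first by rewrite divr_gt0.
  exists (x N); exists N => //= n /= Nn; rewrite -ball_normE /= eE normE ltcR.
  by apply: le_lt_trans (xN _ _ _ _) _ => //; rewrite ltr_pdivrMr// ltr_pMr// ltr1n.
move=> /cvg_ex[l xl]; exists l => e e0.
have e0' : 0 < e%:C by rewrite ltcR.
have /cvgrPdist_le /(_ _ e0') [N _ xN] := xl.
by exists N => n Nn; rewrite rdistC -rnormP; exact: xN.
Qed.

End cstar_norm.

(* An isometric *-isomorphism of A onto the algebra of continuous functions on
   X, with a |-> fval a. *)
Record function_rep {R : realType} (A : cstarType R) (X : topologicalType) := FunRep {
  fval :> A -> X -> R[i];
  fval_cont : forall a, ccont (fval a);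
  fvalD : forall a b t, fval (a + b) t = fval a t + fval b t;
  fvalZ : forall (c : R[i]) a t, fval (c *: a) t = c * fval a t;
  fvalM : forall a b t, fval (cmul a b) t = fval a t * fval b t;
  fval_star : forall a t, fval (cstar a) t = conjc (fval a t);
  fval_le : forall a t, rnorm (fval a t) <= rnorm a;
  fval_norm : forall a (M : R), 0 <= M -> (forall t, rnorm (fval a t) <= M) ->
    rnorm a <= M;
  fval_surj : forall f, ccont f -> exists a, forall t, fval a t = f t }.

Section formal_sums.
Context {R : realType} {T : choiceType}.
Implicit Types l : seq (R[i] * T).

Definition coef l (g : T) : R[i] := \sum_(y <- l | y.2 == g) y.1.

(** Lists may repeat a group element. Regrouping gives the form in which the universal norm is
    stated, and one term per element when terms are counted. *)
Lemma collect (V : lmodType R[i]) (v : T -> V) l (S : seq T) : uniq S ->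
  all (fun y => y.2 \in S) l ->
  \sum_(y <- l) y.1 *: v y.2 = \sum_(g <- S) coef l g *: v g.
Proof.
move=> uS lS; under [RHS]eq_bigr => g _ do rewrite /coef scaler_suml big_mkcond.
rewrite exchange_big /= !big_seq; apply: eq_bigr => y /(allP lS) yS.
rewrite (bigD1_seq y.2)//= eqxx big1 ?addr0// => g gy.
by rewrite eq_sym (negbTE gy).
Qed.

Lemma in_support l : all (fun y => y.2 \in undup (map snd l)) l.
Proof. by apply/allP => y yl; rewrite mem_undup; apply: map_f. Qed.

End formal_sums.

Section gelfand.
Context {R : realType} {G : topologicalZmodType}.
Hypotheses (cptG : compact [set: G]) (hausG : hausdorff_space G).
Context {A : cstarType R} {u : dual_group R G -> A}.
Hypothesis Au : full_group_cstar u.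
Local Notation Gm := (dual_group R G).
Implicit Types (a b : A) (l : seq (R[i] * Gm)).

Let uM g h : u (g * h)%g = cmul (u g) (u h). Proof. by case: Au. Qed.
Let uV g : u (g^-1)%g = cstar (u g). Proof. by case: Au. Qed.

Definition comb l : A := \sum_(y <- l) y.1 *: u y.2.

Lemma comb_dense a (e : R) : 0 < e -> exists l, rnorm (a - comb l) <= e.
Proof.
move=> e0; have [_ _ _ dA] := Au; have e0' : 0 < e%:C by rewrite ltcR.
have [|b [/= ab [s [x bE]]]] := dA (ball a e%:C) _ (ball_open a e%:C).
  by exists a; exact: ballxx.
exists [seq (x g, g) | g <- s]; rewrite /comb big_map /= -bE.
by move: ab; rewrite -ball_normE /= normE ltcR => /ltW.
Qed.

Lemma char_mulC (g h : Gm) : (g * h)%g = (h * g)%g.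
Proof. by apply: dual_group_ext => x /=; rewrite mulrC. Qed.

Lemma comb_cat l l' : comb (l ++ l') = comb l + comb l'.
Proof. by rewrite /comb big_cat. Qed.

Lemma comb_scale c l : comb [seq (c * x.1, x.2) | x <- l] = c *: comb l.
Proof.
by rewrite /comb big_map scaler_sumr; apply: eq_bigr => x _; rewrite scalerA.
Qed.

Definition mull l l' : seq (R[i] * Gm) :=
  [seq (x.1 * y.1, (x.2 * y.2)%g) | x <- l, y <- l'].

Lemma cmul_suml (I : Type) (s : seq I) (F : I -> A) a :
  cmul (\sum_(i <- s) F i) a = \sum_(i <- s) cmul (F i) a.
Proof.
elim: s => [|i s ih]; last by rewrite !big_cons cmulDl ih.
by rewrite !big_nil cmul0l.
Qed.

Lemma cmul_sumr (I : Type) (s : seq I) (F : I -> A) a :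
  cmul a (\sum_(i <- s) F i) = \sum_(i <- s) cmul a (F i).
Proof.
elim: s => [|i s ih]; last by rewrite !big_cons cmulDr ih.
by rewrite !big_nil cmul0r.
Qed.

Lemma comb_mull l l' : comb (mull l l') = cmul (comb l) (comb l').
Proof.
rewrite /comb /mull big_allpairs_dep cmul_suml; apply: eq_bigr => x _.
rewrite cmul_sumr; apply: eq_bigr => y _ /=.
by rewrite cmulZl cmulZr scalerA uM.
Qed.

Lemma trig_mull l l' t : trig (mull l l') t = trig l t * trig l' t.
Proof.
rewrite /trig /mull big_allpairs_dep mulr_suml; apply: eq_bigr => x _.
by rewrite mulr_sumr; apply: eq_bigr => y _ /=; rewrite mulrACA.
Qed.

Definition starl l : seq (R[i] * Gm) := [seq (conjc x.1, (x.2^-1)%g) | x <- l].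

Lemma comb_starl l : comb (starl l) = cstar (comb l).
Proof.
rewrite /comb /starl; elim: l => [|x l ih].
  by rewrite /= !big_nil cstar0.
by rewrite /= !big_cons cstarD -ih /= cstarZ uV.
Qed.

Lemma trig_starl l t : trig (starl l) t = conjc (trig l t).
Proof.
rewrite /trig /starl rmorph_sum big_map; apply: eq_bigr => x _ /=.
by rewrite conjcM -charN.
Qed.

Lemma trig_coef l S t : uniq S -> all (fun y => y.2 \in S) l ->
  trig l t = \sum_(g <- S) coef l g * g t.
Proof. exact: (@collect R Gm R[i]^o (fun g => g t)). Qed.

Lemma comb_coef l S : uniq S -> all (fun y => y.2 \in S) l ->
  comb l = \sum_(g <- S) coef l g *: u g.
Proof. exact: collect. Qed.

(* Evaluation at t is a one-dimensional representation of the dual group. *)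
Lemma trig_le_comb l t : rnorm (trig l t) <= rnorm (comb l).
Proof.
have [_ _ nA _] := Au; pose S := undup (map snd l).
have uS : uniq S by exact: undup_uniq.
rewrite (trig_coef t uS (in_support l)) (comb_coef uS (in_support l)).
rewrite [leRHS]/rnorm nA /= /universal_norm; apply: ub_le_sup.
  exists (\sum_(g <- S) rnorm (coef l g)) => _ [H [pi [[_ _ _ piU]] [xi xi1 ->]]].
  apply: le_trans (ler_rnorm_sum _ _ _) _; apply: ler_sum => g _.
  rewrite rnormZ ler_piMr ?rnorm_ge0//.
  have : `|pi g xi| ^+ 2 = `|xi| ^+ 2 by rewrite -!inner_norm piU.
  move/eqP; rewrite eqrXn2// => /eqP.
  rewrite [rnorm (pi g xi)]/rnorm => ->; move: xi1.
  by rewrite normE (_ : 1 = 1%:C)// lecR.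
exists R[i], (fun (g : Gm) (xi : R[i]) => g t * xi); split.
  split=> [g c x y|xi|g h xi|g x y].
  - by rewrite mulrDr; congr (_ + _); exact: mulrCA.
  - by rewrite mul1r.
  - by rewrite /= mulrA.
  - rewrite /inner /= conjcM mulrACA mulcJ /rnorm dual_group_norm /=.
    by rewrite expr1n mul1r.
exists 1; first by rewrite normr1.
by rewrite /rnorm; congr (Re `|_|); apply: eq_bigr => g _; rewrite mulr1.
Qed.

(** Combinations of characters commute; density extends this to one factor at a time. *)
Lemma cmulC a b : cmul a b = cmul b a.
Proof.
have lC l l' : cmul (comb l) (comb l') = cmul (comb l') (comb l).
  rewrite -!comb_mull /comb /mull !big_allpairs_dep exchange_big /=.
  by apply: eq_bigr => x _; apply: eq_bigr => y _; rewrite mulrC char_mulC.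
have small x y : forall e : R, 0 < e -> exists l, [/\ rnorm (x - comb l) <= e,
    rnorm (cmul x y - cmul (comb l) y) <= e & rnorm (cmul y x - cmul y (comb l)) <= e].
  move=> e e0; have y0 : 0 < rnorm y + 1 by rewrite ltr_wpDl// rnorm_ge0.
  have y1 : 1 <= rnorm y + 1 by rewrite lerDr rnorm_ge0.
  have [|l xl] := comb_dense x (e := e / (rnorm y + 1)); first by rewrite divr_gt0.
  have xy : rnorm (x - comb l) * rnorm y <= e.
    apply: (@le_trans _ _ (e / (rnorm y + 1) * (rnorm y + 1))).
      by apply: ler_pM => //; rewrite ?rnorm_ge0// lerDl.
    by rewrite divfK// gt_eqF.
  exists l; split.
  - apply: le_trans xl _; rewrite ler_pdivrMr// ler_peMr//; exact: ltW.
  - by rewrite -cmulBl; apply: le_trans (rcnormM _ _) _.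
  - by rewrite -cmulBr; apply: le_trans (rcnormM _ _) _; rewrite mulrC.
have C1 l y : cmul (comb l) y = cmul y (comb l).
  apply/subr0_eq/rnorm_small => e e0; have e2 : 0 < e / 2 by rewrite divr_gt0.
  have [l' [_ h1 h2]] := small y (comb l) _ e2.
  apply: le_trans (ler_rdistD (cmul (comb l) (comb l')) _ _) _.
  by rewrite [e]splitr lerD// lC rdistC.
apply/subr0_eq/rnorm_small => e e0; have e2 : 0 < e / 2 by rewrite divr_gt0.
have [l [_ h1 h2]] := small a b _ e2.
apply: le_trans (ler_rdistD (cmul (comb l) b) _ _) _.
by rewrite [e]splitr lerD// C1 rdistC.
Qed.

(** By commutativity [cstar (a a)] times [a a] is the square of the self-adjoint [cstar a * a], so
    repeated use of the C*-identity gives this for every [a]. *)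
Lemma rnorm_square a : rnorm (cmul a a) = rnorm a ^+ 2.
Proof.
apply/eqP; rewrite -(@eqrXn2 _ 2)// ?rnorm_ge0 ?exprn_ge0 ?rnorm_ge0//.
rewrite -(rcnorm_star (cmul a a)) -(rcnorm_star a) cstarM; apply/eqP.
have -> : cmul (cmul (cstar a) (cstar a)) (cmul a a) =
    cmul (cstar (cmul (cstar a) a)) (cmul (cstar a) a).
  rewrite cstarM cstarK !cmulA; congr (cmul _ a).
  by rewrite -!cmulA [cmul (cstar a) a]cmulC.
by rewrite rcnorm_star.
Qed.

(** A superset of the support of an [n]-fold product, with length polynomial in [n] of degree
    [size s]. *)
Fixpoint monomials (s : seq Gm) n : seq Gm := if s is g :: s'
  then [seq (g ^+ k * h)%g | k <- iota 0 n.+1, h <- monomials s' n] else [:: 1%g].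

Lemma monomials_cons g s n : monomials (g :: s) n =
  [seq (g ^+ k * h)%g | k <- iota 0 n.+1, h <- monomials s n].
Proof. by []. Qed.

Lemma size_monomials s n : size (monomials s n) = (n.+1 ^ size s)%N.
Proof.
elim: s => [//|g s ih].
by rewrite monomials_cons size_allpairs size_iota ih -expnS.
Qed.

Lemma monomials1 s n : 1%g \in monomials s n.
Proof.
elim: s => [|g s ih]; first by rewrite mem_seq1.
rewrite monomials_cons; apply/allpairsP; exists (0%N, 1%g); split => //.
by rewrite expg0 mulg1.
Qed.

Lemma monomialsM s m n g h : g \in monomials s m -> h \in monomials s n ->
  (g * h)%g \in monomials s (m + n).
Proof.
elim: s g h => [|x s ih] g h.
  by rewrite !mem_seq1 => /eqP-> /eqP->; rewrite mulg1.
rewrite !monomials_cons.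
move=> /allpairsP[[i g'] [im g'm ->]] /allpairsP[[j h'] [jn h'n ->]].
apply/allpairsP; exists ((i + j)%N, (g' * h')%g); split.
- by move: im jn; rewrite !mem_iota /=; lia.
- exact: ih.
- rewrite /= expgnDr -!mulgA; congr (_ * _)%g.
  by rewrite !mulgA [(g' * _)%g]char_mulC.
Qed.

Lemma monomials_gen s g : g \in s -> g \in monomials s 1.
Proof.
elim: s => // x s ih; rewrite in_cons monomials_cons => /orP[/eqP->|gs].
  apply/allpairsP; exists (1%N, 1%g); split => //; first exact: monomials1.
  by rewrite expg1 mulg1.
apply/allpairsP; exists (0%N, g); split => //; first exact: ih.
by rewrite expg0 mul1g.
Qed.

(** Translation by a point where the two characters differ multiplies the mean of [chi * conjc psi]
    by a factor other than 1, yet preserves it. *)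
Lemma ip_char (chi psi : Gm) : ip chi psi = (chi == psi)%:R.
Proof.
have [<-|cp] := eqVneq chi psi; first by rewrite ip_N2 ?N2_char//; exact: ccont_char.
have [t ct] : exists t, chi t != psi t.
  apply: contrapT => /forallNP h; move/eqP : cp; apply; apply: dual_group_ext => t.
  by move/negP : (h t); rewrite negbK => /eqP.
pose k s := chi s * conjc (psi s).
have ck : ccont k by apply: ccontM; [|apply: ccont_conj]; exact: ccont_char.
have kM s : k (s + t) = k t * k s by rewrite /k !dual_groupD conjcM; ring.
have : mean k = k t * mean k.
  by rewrite -(meanZ cptG _ ck) -{1}(mean_shift cptG t ck); congr mean; apply/funext.
rewrite -[ip _ _]/(mean k) -[LHS]mul1r => /eqP; rewrite -subr_eq0 -mulrBl mulf_eq0.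
move=> /orP[|/eqP//]; rewrite subr_eq0 eq_sym => /eqP kt.
have p1 : conjc (psi t) * psi t = 1.
  by rewrite mulrC mulcJ /rnorm dual_group_norm /= expr1n.
by move/eqP : ct; case; rewrite -[LHS]mulr1 -p1 mulrA [chi t * _]kt mul1r.
Qed.

Lemma ip_trig l (g : Gm) : ip (trig l) g = coef l g.
Proof.
elim: l => [|x l ih].
  rewrite /coef big_nil /ip -[RHS](@mean_cst R G 0); congr mean; apply/funext => s.
  by rewrite /trig big_nil mul0r.
have cx := ccont_char x.2; have cg := ccont_char g.
have -> : trig (x :: l) = (fun t => x.1 * x.2 t + trig l t).
  by apply/funext => t; rewrite /trig big_cons.
rewrite (ipDl cptG (ccontZ _ cx) (ccont_trig l) cg) (ipZl cptG _ cx cg) ih ip_char.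
rewrite /coef big_cons; case: eqP => _; first by rewrite mulr1.
by rewrite mulr0 add0r.
Qed.

(** Orthogonality recovers coefficients as means against characters, so the sup norm controls
    them. *)
Lemma coef_le l (g : Gm) (M : R) : (forall t, rnorm (trig l t) <= M) ->
  rnorm (coef l g) <= M.
Proof.
move=> lM; rewrite -ip_trig; apply: mean_le => // [|t].
  by apply: ccontM; [exact: ccont_trig|apply: ccont_conj; exact: ccont_char].
by rewrite rnormM rnorm_conj [X in _ * X]/rnorm dual_group_norm /= mulr1.
Qed.

Lemma unit_norm_le1 g : rnorm (u g) <= 1.
Proof.
have u1 : rnorm (u 1%g) <= 1.
  have h : rnorm (u 1%g) ^+ 2 = rnorm (u 1%g) by rewrite -rnorm_square -uM mulg1.
  by have := rnorm_ge0 (u 1%g); nra.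
have : rnorm (u g) ^+ 2 <= 1.
  by rewrite -rcnorm_star -uV -uM mulVg.
by have := rnorm_ge0 (u g); nra.
Qed.

Fixpoint squarel l k : seq (R[i] * Gm) :=
  if k is k'.+1 then mull (squarel l k') (squarel l k') else l.

(* ‖a‖^(2^k) = ‖a^(2^k)‖, and the powers of a have polynomially growing support
   and coefficients bounded by the sup norm. *)
Lemma comb_le_trig l (M : R) : 0 <= M -> (forall t, rnorm (trig l t) <= M) ->
  rnorm (comb l) <= M.
Proof.
move=> M0 lM; pose s := map snd l.
(* The polynomial factor is the number of monomials that can occur in the [2 ^ k]-th power. *)
apply: (@le_of_poly_bound R _ _ (size s)); rewrite ?rnorm_ge0// => k.
have -> : rnorm (comb l) ^+ (2 ^ k) = rnorm (comb (squarel l k)).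
  elim: k => [//|k ih]; rewrite expnS mulnC exprM ih /= comb_mull rnorm_square.
  by [].
have kM t : rnorm (trig (squarel l k) t) <= M ^+ (2 ^ k).
  elim: k => [|k ih] /=; first by rewrite expn0 expr1.
  rewrite trig_mull rnormM -expr2 expnS mulnC exprM; apply: lerXn2r => //.
    by rewrite nnegrE rnorm_ge0.
  by rewrite nnegrE exprn_ge0.
pose S := undup (monomials s (2 ^ k)).
have kS : all (fun y => y.2 \in S) (squarel l k).
  rewrite (eq_all (a2 := fun y => y.2 \in monomials s (2 ^ k))); last first.
    by move=> y; rewrite mem_undup.
  apply/allP; elim: k {kM S} => [|k ih] y /=.
    by move=> yl; apply/monomials_gen/map_f.
  move=> /allpairsP[[y1 y2] [/= h1 h2 ->]] /=.
  by rewrite expnS mul2n -addnn; apply: monomialsM; exact: ih.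
rewrite (comb_coef (undup_uniq _) kS); apply: le_trans (ler_rnorm_sum _ _ _) _.
apply: (@le_trans _ _ (\sum_(g <- S) M ^+ (2 ^ k))).
  apply: ler_sum => g _; rewrite rnormZ -[leRHS]mulr1.
  by apply: ler_pM; rewrite ?rnorm_ge0 ?unit_norm_le1//; exact: coef_le.
rewrite big_const_seq count_predT iter_addr_0 -[_ *+ size S]mulr_natl.
apply: ler_wpM2r; first by rewrite exprn_ge0.
rewrite -natrX ler_nat; apply: leq_trans (size_undup _) _.
by rewrite size_monomials.
Qed.

(** The reflection matches the sign in [fourier_stieltjes], so that integrating the transform of
    [u gamma] gives the Fourier-Stieltjes coefficient at [gamma]. *)
Let T l t := trig l (- t).

(** The graph of the Gelfand transform, as the closure of its graph on combinations. Each algebraic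
    rule is proved for this relation before a function is extracted from it. *)
Definition represents_fun a f := forall e : R, 0 < e -> exists l,
  rnorm (a - comb l) <= e /\ forall t, rnorm (f t - trig l (- t)) <= e.

Let Tdist l l' (e : R) : 0 <= e -> rnorm (comb l - comb l') <= e <->
  forall t, rnorm (T l t - T l' t) <= e.
Proof.
move=> e0; pose k := l ++ [seq (-1 * x.1, x.2) | x : R[i] * Gm <- l'].
have kE : comb k = comb l - comb l' by rewrite /k comb_cat comb_scale scaleN1r.
have tE t : trig k t = trig l t - trig l' t.
  by rewrite /k trig_cat trig_scale mulN1r.
rewrite -kE; split=> [h t|h].
  by rewrite /T -tE; apply: le_trans h; exact: trig_le_comb.
by apply: comb_le_trig => // t; have := h (- t); rewrite /T opprK tE.
Qed.

Lemma represents_fun_ex a : exists2 f, ccont f & represents_fun a f.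
Proof.
have /choice[L LP] : forall n : nat, exists l, rnorm (a - comb l) <= n.+1%:R^-1.
  by move=> n; apply: comb_dense; rewrite invr_gt0.
have LC (e : R) : 0 < e -> exists N, forall n m, (N <= n)%N -> (N <= m)%N ->
    forall t, rnorm (T (L n) t - T (L m) t) <= e.
  move=> e0; have [|N NP] := @small_inv R (e / 2); first by rewrite divr_gt0.
  exists N => n m Nn Nm; apply/Tdist; first exact: ltW.
  apply: le_trans (ler_rdistD a _ _) _; rewrite [e]splitr lerD//.
    by rewrite rdistC; apply: le_trans (LP n) (NP _ Nn).
  exact: le_trans (LP m) (NP _ Nm).
have [f cf fP] := uniform_complete (fun n => ccont_opp (ccont_trig (L n))) LC.
exists f => // e e0; have [N NP] := fP _ e0; have [M MP] := small_inv e0.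
exists (L (maxn N M)); split; first exact: le_trans (LP _) (MP _ (leq_maxr _ _)).
by move=> t; rewrite rdistC; exact: NP (leq_maxl _ _) t.
Qed.

Lemma represents_fun_surj f : ccont f -> exists a, represents_fun a f.
Proof.
move=> cf; have cf' := ccont_opp cf.
have /choice[L LP] : forall n : nat, exists l,
    forall t, rnorm (f (- t) - trig l t) <= n.+1%:R^-1.
  by move=> n; apply: trig_dense => //; rewrite invr_gt0.
have [e e0|a aP] := @cauchy_cvgA R A (fun n => comb (L n)).
  have [|N NP] := @small_inv R (e / 2); first by rewrite divr_gt0.
  exists N => n m Nn Nm; apply/Tdist => [|t]; first exact: ltW.
  apply: le_trans (ler_rdistD (f t) _ _) _; rewrite [e]splitr lerD//.
    have := LP n (- t); rewrite opprK rdistC => /le_trans; apply; exact: NP.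
  have := LP m (- t); rewrite opprK => /le_trans; apply; exact: NP.
exists a => e e0; have [N NP] := aP _ e0; have [M MP] := small_inv e0.
exists (L (maxn N M)); split; first by rewrite rdistC NP// leq_maxl.
move=> t; have := LP (maxn N M) (- t); rewrite opprK => /le_trans; apply.
exact: MP (leq_maxr _ _).
Qed.

Lemma represents_fun_le a f t : represents_fun a f -> rnorm (f t) <= rnorm a.
Proof.
move=> af; apply/ler_addgt0Pr => e e0; have e2 : 0 < e / 2 by rewrite divr_gt0.
have [l [al fl]] := af _ e2.
apply: le_trans (ler_rnormBD _ (trig l (- t))) _.
apply: le_trans (lerD (fl t) (trig_le_comb l (- t))) _.
have := ler_rnormBD (comb l) a; rewrite rdistC; move: al.
by set x := rnorm (a - _); set y := rnorm (comb l); set z := rnorm a; lra.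
Qed.

Lemma represents_fun_norm a f (M : R) : 0 <= M -> represents_fun a f ->
  (forall t, rnorm (f t) <= M) -> rnorm a <= M.
Proof.
move=> M0 af fM; apply/ler_addgt0Pr => e e0; have e2 : 0 < e / 2 by rewrite divr_gt0.
have [l [al fl]] := af _ e2.
have : rnorm (comb l) <= M + e / 2.
  apply: comb_le_trig => [|t]; first by rewrite addr_ge0// ltW.
  apply: le_trans (ler_rnormBD _ (f (- t))) _; rewrite addrC lerD//.
  by have := fl (- t); rewrite opprK rdistC.
have := ler_rnormBD a (comb l); move: al.
by set x := rnorm (a - _); set y := rnorm (comb l); set z := rnorm a; lra.
Qed.

Lemma represents_funD a b f g : represents_fun a f -> represents_fun b g ->
  represents_fun (a + b) (fun t => f t + g t).
Proof.
move=> af bg e e0; have e2 : 0 < e / 2 by rewrite divr_gt0.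
have [l [al fl]] := af _ e2; have [l' [bl gl]] := bg _ e2.
exists (l ++ l'); split=> [|t]; rewrite ?comb_cat ?trig_cat opprD addrACA [e]splitr;
  by apply: le_trans (ler_rnormD _ _) _; rewrite lerD.
Qed.

Lemma represents_funZ a f c : represents_fun a f ->
  represents_fun (c *: a) (fun t => c * f t).
Proof.
move=> af e e0; have c0 : 0 < rnorm c + 1 by rewrite ltr_wpDl// rnorm_ge0.
have [|l [al fl]] := af (e / (rnorm c + 1)); first by rewrite divr_gt0.
have h (x : R) : 0 <= x -> x <= e / (rnorm c + 1) -> rnorm c * x <= e.
  move=> x0 xe; apply: (@le_trans _ _ ((rnorm c + 1) * (e / (rnorm c + 1)))).
    by apply: ler_pM => //; rewrite ?rnorm_ge0// lerDl.
  by rewrite mulrCA divff ?mulr1// gt_eqF.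
exists [seq (c * x.1, x.2) | x <- l]; split=> [|t].
  by rewrite comb_scale -scalerBr rnormZ; apply: h => //; exact: rnorm_ge0.
by rewrite trig_scale -mulrBr rnormM; apply: h => //; exact: rnorm_ge0.
Qed.

Lemma represents_fun_star a f : represents_fun a f ->
  represents_fun (cstar a) (fun t => conjc (f t)).
Proof.
move=> af e /af[l [al fl]]; exists (starl l); split=> [|t].
  by rewrite comb_starl -cstarB rnorm_cstar.
by rewrite trig_starl -conjcB rnorm_conj.
Qed.

Lemma represents_fun_uniq a f g : represents_fun a f -> represents_fun a g ->
  forall t, f t = g t.
Proof.
move=> af ag t; have := represents_funD af (represents_funZ (-1) ag).
rewrite scaleN1r subrr => h0; have := represents_fun_le t h0.
rewrite rnorm0 mulN1r => h; apply/subr0_eq/rnorm0_eq0/eqP.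
by rewrite eq_le h rnorm_ge0.
Qed.

Lemma represents_funM a b f g : represents_fun a f -> represents_fun b g ->
  represents_fun (cmul a b) (fun t => f t * g t).
Proof.
move=> af bg e e0.
have fa t := represents_fun_le t af; have gb t := represents_fun_le t bg.
pose B := rnorm a + rnorm b + 1.
have na := rnorm_ge0 a; have nb := rnorm_ge0 b.
have B0 : 0 < B by rewrite /B; lra.
(* With [d <= 1], the error of a product is at most [d * rnorm b + (rnorm a + d) * d <= d * B]. *)
pose d := Num.min 1 (e / (2 * B)).
have d0 : 0 < d by rewrite lt_min ltr01 divr_gt0// mulr_gt0.
have d1 : d <= 1 by rewrite ge_min lexx.
have dB : d * B <= e / 2.
  have : d <= e / (2 * B) by rewrite ge_min lexx orbT.
  by rewrite ler_pdivlMr ?mulr_gt0//; lra.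
have [l [al fl]] := af _ d0; have [l' [bl gl]] := bg _ d0.
exists (mull l l'); split=> [|t].
  rewrite comb_mull.
  have -> : cmul a b - cmul (comb l) (comb l') =
      cmul (a - comb l) b + cmul (comb l) (b - comb l').
    by rewrite cmulBl cmulBr addrA subrK.
  apply: le_trans (ler_rnormD _ _) _.
  apply: le_trans (lerD (rcnormM _ _) (rcnormM _ _)) _.
  have := ler_rnormBD (comb l) a; rewrite rdistC; move: al bl.
  have := rnorm_ge0 (a - comb l); have := rnorm_ge0 (b - comb l').
  have := rnorm_ge0 (comb l).
  move: dB; rewrite /B; set x := rnorm (a - _); set y := rnorm (b - _).
  set z := rnorm (comb l); move=> *; nra.
rewrite trig_mull.
have -> : f t * g t - trig l (- t) * trig l' (- t) =
   (f t - trig l (- t)) * g t + trig l (- t) * (g t - trig l' (- t)) by ring.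
apply: le_trans (ler_rnormD _ _) _; rewrite !rnormM.
have := ler_rnormBD (trig l (- t)) (f t); rewrite rdistC.
have := fl t; have := gl t; have := fa t; have := gb t.
have := rnorm_ge0 (f t - trig l (- t)); have := rnorm_ge0 (g t - trig l' (- t)).
have := rnorm_ge0 (trig l (- t)); have := rnorm_ge0 (f t); have := rnorm_ge0 (g t).
move: dB; rewrite /B; set x := rnorm (f t - _); set y := rnorm (g t - _).
set z := rnorm (trig _ _); move=> *; nra.
Qed.

Lemma represents_fun_comb l : represents_fun (comb l) (fun t => trig l (- t)).
Proof.
move=> e e0; exists l; rewrite subrr rnorm0; split; first exact: ltW.
by move=> t; rewrite subrr rnorm0; exact: ltW.
Qed.

Definition gelfand a : G -> R[i] := projT1 (cid2 (represents_fun_ex a)).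

Lemma gelfand_cont a : ccont (gelfand a).
Proof. by rewrite /gelfand; case: cid2. Qed.

Lemma gelfandP a : represents_fun a (gelfand a).
Proof. by rewrite /gelfand; case: cid2. Qed.

Lemma gelfand_comb l t : gelfand (comb l) t = trig l (- t).
Proof. exact: represents_fun_uniq (gelfandP _) (represents_fun_comb l) t. Qed.

Fact gelfandD a b t : gelfand (a + b) t = gelfand a t + gelfand b t.
Proof.
exact: represents_fun_uniq (gelfandP _) (represents_funD (gelfandP a) (gelfandP b)) t.
Qed.

Fact gelfandZ (c : R[i]) a t : gelfand (c *: a) t = c * gelfand a t.
Proof. exact: represents_fun_uniq (gelfandP _) (represents_funZ c (gelfandP a)) t. Qed.

Fact gelfandM a b t : gelfand (cmul a b) t = gelfand a t * gelfand b t.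
Proof.
exact: represents_fun_uniq (gelfandP _) (represents_funM (gelfandP a) (gelfandP b)) t.
Qed.

Fact gelfand_star a t : gelfand (cstar a) t = conjc (gelfand a t).
Proof. exact: represents_fun_uniq (gelfandP _) (represents_fun_star (gelfandP a)) t. Qed.

Fact gelfand_surj f : ccont f -> exists a, forall t, gelfand a t = f t.
Proof.
move=> cf; have [a af] := represents_fun_surj cf.
by exists a => t; exact: represents_fun_uniq (gelfandP a) af t.
Qed.

Definition gelfand_rep : function_rep A G :=
  FunRep gelfand_cont gelfandD gelfandZ gelfandM gelfand_star
    (fun a t => represents_fun_le t (gelfandP a))
    (fun a M M0 => represents_fun_norm M0 (gelfandP a)) gelfand_surj.

End gelfand.

(** * Functionals on continuous functions *)

Section real_functions.
Context {R : realType} {X : topologicalType}.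
Implicit Types (f g : X -> R[i]) (k l : X -> R).

Definition rc k := ccont (fun t => (k t)%:C).

Lemma rc_cst (c : R) : rc (fun=> c). Proof. exact: ccont_cst. Qed.

Lemma rcD k l : rc k -> rc l -> rc (fun t => k t + l t).
Proof.
by move=> ck cl; have := ccontD ck cl; rewrite /rc; under eq_fun do rewrite -rmorphD.
Qed.

Lemma rcM k l : rc k -> rc l -> rc (fun t => k t * l t).
Proof.
by move=> ck cl; have := ccontM ck cl; rewrite /rc; under eq_fun do rewrite -rmorphM.
Qed.

Lemma rcN k : rc k -> rc (fun t => - k t).
Proof. by move=> ck; have := ccontN ck; rewrite /rc; under eq_fun do rewrite -rmorphN. Qed.

Lemma rcB k l : rc k -> rc l -> rc (fun t => k t - l t).
Proof. by move=> ck cl; apply: rcD => //; exact: rcN. Qed.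

Lemma rc_norm k : rc k -> rc (fun t => `|k t|).
Proof. by move=> /ccont_rnorm; rewrite /rc; under eq_fun do rewrite rnormC. Qed.

Lemma rc_max k l : rc k -> rc l -> rc (fun t => Num.max (k t) (l t)).
Proof.
move=> ck cl; rewrite (_ : (fun _ => _) = fun t => (k t + l t + `|k t - l t|) * 2^-1).
  by apply: rcM; [apply/rcD/rc_norm/rcB => //; exact: rcD|exact: rc_cst].
by apply/funext => t; rewrite maxr_absE.
Qed.

Lemma rc_min k l : rc k -> rc l -> rc (fun t => Num.min (k t) (l t)).
Proof.
move=> ck cl; rewrite (_ : (fun _ => _) = fun t => (k t + l t - `|k t - l t|) * 2^-1).
  by apply: rcM; [apply/rcB/rc_norm/rcB => //; exact: rcD|exact: rc_cst].
by apply/funext => t; rewrite minr_absE.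
Qed.

Lemma ccontV f : ccont f -> (forall t, f t != 0) -> ccont (fun t => (f t)^-1).
Proof. by move=> /ccontP cf f0; apply/ccontP => t; apply: cvgV => //; exact: cf. Qed.

End real_functions.

Section dual_complete.
Context {R : realType} {V : normedModType R[i]}.
Implicit Types phi psi : dual V.

Lemma dual_rle phi a : rnorm (phi a) <= rnorm phi * rnorm a.
Proof. by rewrite -lecR rmorphM /= -!normE; exact: dual_le. Qed.

Lemma rnorm_dual_le phi (M : R) : 0 <= M ->
  (forall a, rnorm (phi a) <= M * rnorm a) -> rnorm phi <= M.
Proof.
move=> M0 pM; rewrite -rnormP; apply: norm_dual_le; first by rewrite lecR.
by move=> a; rewrite !normE -rmorphM lecR.
Qed.

Lemma dual_subE phi psi a : (phi - psi) a = phi a - psi a.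
Proof. by rewrite -scaleN1r dual_addE dual_scaleE mulN1r. Qed.

Lemma dualD phi a b : phi (a + b) = phi a + phi b. Proof. exact: raddfD. Qed.

Lemma dualB phi a b : phi (a - b) = phi a - phi b. Proof. exact: raddfB. Qed.

Lemma dualZ phi (c : R[i]) a : phi (c *: a) = c * phi a.
Proof. exact: linearZ. Qed.

Definition rmkdual (f : V -> R[i]) (fl : scalar f)
    (fM : exists2 M : R, 0 <= M & forall x, rnorm (f x) <= M * rnorm x) : dual V.
Proof.
refine (@mkdual R V f fl _); case: fM => M M0 fM.
exists M%:C; first by rewrite lecR.
by move=> x; rewrite !normE -rmorphM lecR.
Defined.

Lemma dual_complete (x : nat -> dual V) :
  (forall e : R, 0 < e -> exists N, forall n m, (N <= n)%N -> (N <= m)%N ->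
     rnorm (x n - x m) <= e) ->
  exists l : dual V, forall e : R, 0 < e ->
    exists N, forall n, (N <= n)%N -> rnorm (x n - l) <= e.
Proof.
move=> xC.
have /choice[l lP] : forall a, exists l : R[i], forall e : R, 0 < e ->
    exists N, forall n, (N <= n)%N -> rnorm (x n a - l) <= e.
  move=> a; apply: cauchy_cvgC => e e0.
  have a0 : 0 < rnorm a + 1 by rewrite ltr_wpDl// rnorm_ge0.
  have [|N NP] := xC (e / (rnorm a + 1)); first by rewrite divr_gt0.
  exists N => n m Nn Nm; rewrite -dual_subE; apply: le_trans (dual_rle _ _) _.
  apply: (@le_trans _ _ (e / (rnorm a + 1) * (rnorm a + 1))); last by rewrite divfK// gt_eqF.
  by apply: ler_pM; rewrite ?rnorm_ge0 ?NP// lerDl.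
have near_l (e : R) : 0 < e -> exists N, forall n, (N <= n)%N ->
    forall a, rnorm (x n a - l a) <= e * rnorm a.
  move=> e0; have [N NP] := xC _ e0; exists N => n Nn a.
  apply/ler_addgt0Pr => d d0; have [M MP] := lP a _ d0.
  apply: le_trans (ler_rdistD (x (maxn N M) a) _ _) _; apply: lerD.
    rewrite -dual_subE; apply: le_trans (dual_rle _ _) _.
    by apply: ler_wpM2r; [exact: rnorm_ge0|apply: NP => //; exact: leq_maxl].
  exact: MP (leq_maxr _ _).
have lS : scalar l.
  move=> c a b; apply/subr0_eq/rnorm_small => e e0.
  pose d := e / (rnorm c + 2).
  have c0 : 0 < rnorm c + 2 by rewrite ltr_wpDl// rnorm_ge0.
  have d0 : 0 < d by rewrite divr_gt0.
  have [N1 h1] := lP (c *: a + b) _ d0.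
  have [N2 h2] := lP a _ d0; have [N3 h3] := lP b _ d0.
  pose n := maxn N1 (maxn N2 N3).
  have {}h1 := h1 n (leq_maxl _ _).
  have {}h2 := h2 n (leq_trans (leq_maxl _ _) (leq_maxr _ _)).
  have {}h3 := h3 n (leq_trans (leq_maxr _ _) (leq_maxr _ _)).
  have -> : l (c *: a + b) - (c * l a + l b) = c * (x n a - l a) +
      (x n b - l b) - (x n (c *: a + b) - l (c *: a + b)).
    by rewrite dual_scalar; ring.
  apply: le_trans (ler_rnormB _ _) _; apply: le_trans (lerD (ler_rnormD _ _) h1) _.
  rewrite rnormM; have := ler_wpM2l (rnorm_ge0 c) h2.
  have : e = d * (rnorm c + 2) by rewrite /d divfK// gt_eqF.
  move: h3; move: (rnorm c) (rnorm (x n a - l a)) (rnorm (x n b - l b)) => p q r.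
  move=> *; lra.
have lB : exists2 M : R, 0 <= M & forall a, rnorm (l a) <= M * rnorm a.
  have [N /(_ N (leqnn N)) NP] := near_l 1 ltr01.
  exists (rnorm (x N) + 1) => [|a]; first by rewrite addr_ge0// rnorm_ge0.
  apply: le_trans (ler_rnormBD _ (x N a)) _; rewrite rdistC.
  by rewrite mulrDl addrC; apply: lerD; [exact: dual_rle|exact: NP].
exists (rmkdual lS lB) => e e0; have [N NP] := near_l e e0; exists N => n Nn.
apply: rnorm_dual_le => [|a]; first exact: ltW.
by rewrite dual_subE; exact: NP.
Qed.

End dual_complete.

Section module_action.
Context {R : realType} {X : topologicalType} {A : cstarType R}.
Variable j : function_rep A X.
Implicit Types (f g : X -> R[i]) (k l c : X -> R) (phi psi v : dual A) (a b : A).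

Lemma fval_inj a b : (forall t, j a t = j b t) -> a = b.
Proof.
move=> ab; apply/subr0_eq/rnorm0_eq0/eqP; rewrite eq_le rnorm_ge0 andbT.
apply: (@fval_norm _ _ _ j) => // t.
by rewrite fvalD -scaleN1r fvalZ mulN1r ab subrr rnorm0.
Qed.

(* The element of A represented by f (0 when f is not continuous). *)
Definition el f : A := xget 0 [set a | forall t, j a t = f t].

Lemma elE f t : ccont f -> j (el f) t = f t.
Proof.
move=> cf; rewrite /el; case: xgetP => [a _ //|].
by have [a af] := fval_surj j cf => /(_ a).
Qed.

Lemma el_fval a : el (j a) = a.
Proof. by apply: fval_inj => t; rewrite elE//; exact: fval_cont. Qed.

Lemma elD f g : ccont f -> ccont g -> el (fun t => f t + g t) = el f + el g.
Proof.
by move=> cf cg; apply: fval_inj => t; rewrite fvalD !elE//; exact: ccontD.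
Qed.

Lemma elZ (c : R[i]) f : ccont f -> el (fun t => c * f t) = c *: el f.
Proof. by move=> cf; apply: fval_inj => t; rewrite fvalZ !elE//; exact: ccontZ. Qed.

Lemma elM f g : ccont f -> ccont g -> el (fun t => f t * g t) = cmul (el f) (el g).
Proof.
by move=> cf cg; apply: fval_inj => t; rewrite fvalM !elE//; exact: ccontM.
Qed.

Lemma el_star f : ccont f -> el (fun t => conjc (f t)) = cstar (el f).
Proof.
by move=> cf; apply: fval_inj => t; rewrite fval_star !elE//; exact: ccont_conj.
Qed.

Lemma fcmulC a b : cmul a b = cmul b a.
Proof. by apply: fval_inj => t; rewrite !fvalM mulrC. Qed.

Lemma rnorm_el f (M : R) : 0 <= M -> ccont f -> (forall t, rnorm (f t) <= M) ->
  rnorm (el f) <= M.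
Proof.
by move=> M0 cf fM; apply: (@fval_norm _ _ _ j) => // t; rewrite elE.
Qed.

(** In terms of measures, the measure with density [f] with respect to [psi]. *)
Definition dc psi f : dual A := dact psi (el f).

Lemma dcE psi f a : dc psi f a = psi (cmul (el f) a). Proof. by []. Qed.

Lemma dc_el psi f g : ccont f -> ccont g ->
  dc psi f (el g) = psi (el (fun t => f t * g t)).
Proof. by move=> cf cg; rewrite dcE elM. Qed.

Lemma dcDr psi f g : ccont f -> ccont g ->
  dc psi (fun t => f t + g t) = dc psi f + dc psi g.
Proof.
move=> cf cg; apply: dual_ext => a.
by rewrite dual_addE !dcE elD// cmulDl raddfD.
Qed.

Lemma dcZr psi (c : R[i]) f : ccont f -> dc psi (fun t => c * f t) = c *: dc psi f.
Proof.
move=> cf; apply: dual_ext => a.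
by rewrite dual_scaleE !dcE elZ// cmulZl linearZ.
Qed.

Lemma dcBr psi f g : ccont f -> ccont g ->
  dc psi (fun t => f t - g t) = dc psi f - dc psi g.
Proof.
move=> cf cg; rewrite -[in RHS]scaleN1r -dcZr// -dcDr//; last exact: ccontZ.
by congr dc; apply/funext => t; rewrite mulN1r.
Qed.

Lemma dcDl phi psi f : dc (phi + psi) f = dc phi f + dc psi f.
Proof. exact: dual_ext. Qed.

Lemma dcZl psi (c : R[i]) f : dc (c *: psi) f = c *: dc psi f.
Proof. exact: dual_ext. Qed.

Lemma dcBl phi psi f : dc (phi - psi) f = dc phi f - dc psi f.
Proof. by rewrite -scaleN1r dcDl dcZl scaleN1r. Qed.

Lemma dcA psi f g : ccont f -> ccont g -> dc (dc psi f) g = dc psi (fun t => f t * g t).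
Proof. by move=> cf cg; apply: dual_ext => a; rewrite !dcE elM// cmulA. Qed.

Lemma dcAC psi f g : dc (dc psi f) g = dc (dc psi g) f.
Proof.
by apply: dual_ext => a; rewrite !dcE !cmulA [cmul (el f) _]fcmulC.
Qed.

Lemma el1 a : cmul (el (fun=> 1)) a = a.
Proof.
by apply: fval_inj => t; rewrite fvalM elE ?mul1r//; exact: ccont_cst.
Qed.

Lemma dc1 psi : dc psi (fun=> 1) = psi.
Proof. by apply: dual_ext => a; rewrite dcE el1. Qed.

Lemma dc_le psi f (M : R) : 0 <= M -> ccont f -> (forall t, rnorm (f t) <= M) ->
  rnorm (dc psi f) <= rnorm psi * M.
Proof.
move=> M0 cf fM; apply: rnorm_dual_le => [|a]; first by rewrite mulr_ge0 ?rnorm_ge0.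
rewrite dcE -mulrA; apply: le_trans (dual_rle _ _) _.
apply: ler_wpM2l; first exact: rnorm_ge0.
apply: le_trans (rcnormM _ _) _; apply: ler_wpM2r; first exact: rnorm_ge0.
exact: rnorm_el.
Qed.

Lemma eval_le psi f (M : R) : 0 <= M -> ccont f -> (forall t, rnorm (f t) <= M) ->
  rnorm (psi (el f)) <= rnorm psi * M.
Proof.
move=> M0 cf fM; apply: le_trans (dual_rle _ _) _.
by apply: ler_wpM2l; [exact: rnorm_ge0|exact: rnorm_el].
Qed.

Lemma rnorm_dual_sup psi (M : R) : 0 <= M ->
  (forall f, ccont f -> (forall t, rnorm (f t) <= 1) -> rnorm (psi (el f)) <= M) ->
  rnorm psi <= M.
Proof.
move=> M0 h; apply: rnorm_dual_le => // a.
have [a0|a0] := eqVneq (rnorm a) 0.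
  by rewrite a0 mulr0 (rnorm0_eq0 a0) raddf0 rnorm0.
have a_gt0 : 0 < rnorm a by rewrite lt_def a0 rnorm_ge0.
rewrite -ler_pdivrMr// mulrC -[(rnorm a)^-1]rnormC_ge0 ?invr_ge0 ?rnorm_ge0//.
rewrite -rnormM.
have -> : ((rnorm a)^-1)%:C * psi a = psi (el (fun t => ((rnorm a)^-1)%:C * j a t)).
  by rewrite elZ ?el_fval ?linearZ//; exact: fval_cont.
apply: h => [|t]; first exact/ccontZ/fval_cont.
rewrite rnormM rnormC_ge0 ?invr_ge0 ?rnorm_ge0// ler_pdivrMl// mulr1.
exact: fval_le.
Qed.

Lemma norming psi (e : R) : 0 < e -> exists f, [/\ ccont f,
  forall t, rnorm (f t) <= 1 & rnorm psi - e <= Re (psi (el f))].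
Proof.
move=> e0; apply: contrapT => /forallNP h.
have le0 : 0 <= Num.max 0 (rnorm psi - e) by rewrite le_max lexx.
have : rnorm psi <= Num.max 0 (rnorm psi - e).
  apply: rnorm_dual_sup => // f cf f1; have [->|f0] := eqVneq (psi (el f)) 0.
    by rewrite rnorm0.
  have n0 : 0 < rnorm (psi (el f)).
    rewrite lt_def rnorm_ge0 andbT; apply: contra f0 => /eqP f0.
    exact/eqP/rnorm0_eq0.
  rewrite le_max; apply/orP; right; rewrite leNgt; apply/negP => lt.
  pose u := conjc (psi (el f)) / (rnorm (psi (el f)))%:C.
  have u1 : rnorm u = 1.
    by rewrite /u rnormM rnormV rnorm_conj rnormC_ge0 ?divff ?gt_eqF// ltW.
  have um : u * psi (el f) = (rnorm (psi (el f)))%:C.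
    rewrite /u mulrAC [conjc _ * _]mulrC mulcJ -fmorphV -rmorphM expr2 mulfK//.
    by rewrite gt_eqF.
  apply: (h (fun t => u * f t)); split; first exact: ccontZ.
    by move=> t; rewrite rnormM u1 mul1r.
  rewrite elZ// dualZ um /=; exact: ltW.
rewrite le_max => /orP[h0|]; last by lra.
have p0 : rnorm psi = 0 by apply/eqP; rewrite eq_le h0 rnorm_ge0.
apply: (h (fun=> 0)); split; first exact: ccont_cst.
  by move=> t; rewrite rnorm0.
have -> : el (fun=> 0) = 0.
  apply: fval_inj => t; rewrite elE; last exact: ccont_cst.
  by have := fvalZ j 0 0 t; rewrite scale0r mul0r => ->.
by rewrite raddf0 p0 /=; lra.
Qed.

(** For [k >= 0] this is the integral of [k] against the variation of [psi], obtained as a norm;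
    [tvD] shows that it is additive there. *)
Definition tv psi k : R := rnorm (dc psi (fun t => (k t)%:C)).

Lemma tv_ge0 psi k : 0 <= tv psi k. Proof. exact: rnorm_ge0. Qed.

Lemma tvDl phi psi k : tv (phi + psi) k <= tv phi k + tv psi k.
Proof. by rewrite /tv dcDl ler_rnormD. Qed.

(* [(w + w') c = w b + w' b' - d c] for [c = (w b + w' b') / (w + w' + d)] *)
Lemma tvD psi k l : rc k -> rc l -> (forall t, 0 <= k t) -> (forall t, 0 <= l t) ->
  tv psi (fun t => k t + l t) = tv psi k + tv psi l.
Proof.
move=> ck cl k0 l0; apply/eqP; rewrite eq_le; apply/andP; split.
  rewrite /tv (_ : (fun t => _%:C) = fun t => (k t)%:C + (l t)%:C).
    by rewrite dcDr// ler_rnormD.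
  by apply/funext => t; rewrite rmorphD.
apply/ler_addgt0Pr => e e0.
(* Adding [d] keeps the denominator of [c] away from 0 and costs at most [e / 2]; each of the two
   norming functions costs [e / 4]. *)
pose d := e / (2 * (rnorm psi + 1)).
have p1 : 0 < rnorm psi + 1 by rewrite ltr_wpDl// rnorm_ge0.
have d0 : 0 < d by rewrite divr_gt0// mulr_gt0.
have e4 : 0 < e / 4 by rewrite divr_gt0.
have [b [cb b1 bP]] := norming (dc psi (fun t => (k t)%:C)) e4.
have [b' [cb' b1' bP']] := norming (dc psi (fun t => (l t)%:C)) e4.
pose s t := k t + l t + d.
have cs : rc s by apply/rcD/rc_cst/rcD.
have s0 t : 0 < s t by rewrite ltr_wpDl// addr_ge0.
pose q t := (k t)%:C * b t + (l t)%:C * b' t.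
have cq : ccont q by apply: ccontD; apply: ccontM.
pose c t := q t / (s t)%:C.
have cc : ccont c.
  apply: ccontM => //; apply: ccontV => // t.
  by rewrite eq_complex /= negb_and gt_eqF.
have c1 t : rnorm (c t) <= 1.
  rewrite /c rnormM rnormV [rnorm (s t)%:C]rnormC_ge0; last exact: ltW.
  rewrite ler_pdivrMr// mul1r.
  apply: le_trans (ler_rnormD _ _) _; rewrite !rnormM !rnormC_ge0//.
  have := ler_wpM2l (k0 t) (b1 t); have := ler_wpM2l (l0 t) (b1' t).
  by rewrite /s !mulr1; move: d0; set p := _ * _; set r := _ * _; lra.
have key : psi (el (fun t => (k t + l t)%:C * c t)) =
    dc psi (fun t => (k t)%:C) (el b) + dc psi (fun t => (l t)%:C) (el b') -
    d%:C * psi (el c).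
  have -> : (fun t => (k t + l t)%:C * c t) =
      (fun t => (k t)%:C * b t + (l t)%:C * b' t + (- d%:C) * c t).
    apply/funext => t.
    have sE : (s t)%:C * c t = q t.
      rewrite /c mulrCA divff ?mulr1//.
      by rewrite eq_complex /= negb_and gt_eqF.
    by rewrite -/(q t) -sE /s !rmorphD /=; ring.
  rewrite (elD cq (ccontZ _ cc)) (elD (ccontM ck cb) (ccontM cl cb')) elZ//.
  by rewrite !dualD dualZ mulNr !dc_el.
have h1 : rnorm (psi (el (fun t => (k t + l t)%:C * c t))) <=
    tv psi (fun t => k t + l t).
  have ckl : ccont (fun t => (k t + l t)%:C) by exact: rcD.
  rewrite -dc_el//; apply: le_trans (eval_le _ ler01 cc c1) _.
  by rewrite mulr1.
have h2 : rnorm (d%:C * psi (el c)) <= e / 2.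
  rewrite rnormM rnormC_ge0; last exact: ltW.
  have := eval_le psi ler01 cc c1; rewrite mulr1 => h.
  apply: (@le_trans _ _ (d * (rnorm psi + 1))).
    by apply: ler_wpM2l; [exact: ltW|apply: le_trans h _; rewrite lerDl].
  by rewrite /d invfM mulrA divfK ?gt_eqF.
have := Re_le_rnorm (psi (el (fun t => (k t + l t)%:C * c t))).
rewrite {1}key ReB ReD; have := Re_le_rnorm (d%:C * psi (el c)).
move: bP bP' h1 h2; rewrite -!/(tv _ _).
move: (tv psi _) (tv psi _) (tv psi _) (rnorm _) (rnorm _) (Re _) (Re _) (Re _) => *.
lra.
Qed.

Lemma tv_mono psi k l : rc k -> rc l -> (forall t, 0 <= k t) ->
  (forall t, k t <= l t) -> tv psi k <= tv psi l.
Proof.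
move=> ck cl k0 kl; have ckl := rcB cl ck.
have -> : tv psi l = tv psi (fun t => k t + (l t - k t)).
  by congr tv; apply/funext => t; rewrite addrC subrK.
rewrite tvD//; first by rewrite lerDl tv_ge0.
by move=> t; rewrite subr_ge0.
Qed.

Lemma tvZ psi (c : R) k : 0 <= c -> rc k -> tv psi (fun t => c * k t) = c * tv psi k.
Proof.
move=> c0 ck; rewrite /tv.
rewrite (_ : (fun t => _%:C) = fun t => c%:C * (k t)%:C).
  by rewrite dcZr// rnormZ rnormC_ge0.
by apply/funext => t; rewrite rmorphM.
Qed.

Lemma tv1 psi : tv psi (fun=> 1) = rnorm psi.
Proof. by rewrite /tv dc1. Qed.

Lemma eval_tv psi k g : rc k -> ccont g -> (forall t, rnorm (g t) <= 1) ->
  rnorm (psi (el (fun t => (k t)%:C * g t))) <= tv psi k.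
Proof.
move=> ck cg g1; rewrite -dc_el//; apply: le_trans (eval_le _ ler01 cg g1) _.
by rewrite mulr1.
Qed.

End module_action.

(** * Absolute continuity and central supports *)

Section band.
Context {R : realType} {X : topologicalType} {A : cstarType R}.
Variable j : function_rep A X.
Variable phi0 : dual A.
Implicit Types (f g : X -> R[i]) (k l w c : X -> R) (phi psi v : dual A).

Local Notation dc := (dc j).
Local Notation tv := (tv j).
Local Notation el := (el j).
Local Notation re k := (fun t => (k t)%:C).

Definition mass k : R := Re (phi0 (el (re k))).

Hypothesis phi0_ge0 : forall k, rc k -> (forall t, 0 <= k t) -> 0 <= mass k.

Lemma massD k l : rc k -> rc l -> mass (fun t => k t + l t) = mass k + mass l.
Proof.
move=> ck cl; rewrite /mass (_ : re (fun t => k t + l t) = fun t => (k t)%:C + (l t)%:C).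
  by rewrite elD// dualD ReD.
by apply/funext => t; rewrite rmorphD.
Qed.

Lemma mass_mono k l : rc k -> rc l -> (forall t, k t <= l t) -> mass k <= mass l.
Proof.
move=> ck cl kl; have clk := rcB cl ck.
have -> : mass l = mass (fun t => k t + (l t - k t)).
  by congr mass; apply/funext => t; rewrite addrC subrK.
by rewrite massD// lerDl phi0_ge0// => t; rewrite subr_ge0.
Qed.

Definition unit_fun k := rc k /\ forall t, 0 <= k t <= 1.

Lemma unit_fun_ge0 k t : unit_fun k -> 0 <= k t.
Proof. by case=> _ /(_ t)/andP[]. Qed.

Lemma unit_fun_le1 k t : unit_fun k -> k t <= 1.
Proof. by case=> _ /(_ t)/andP[]. Qed.

Lemma unit_fun1 : unit_fun (fun=> 1).
Proof. by split; [exact: rc_cst|move=> t; rewrite ler01 lexx]. Qed.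

Lemma unit_funC k : unit_fun k -> unit_fun (fun t => 1 - k t).
Proof.
move=> [ck k01]; split; first exact/rcB/ck/rc_cst.
by move=> t; have := k01 t; lra.
Qed.

Lemma unit_funM k l : unit_fun k -> unit_fun l -> unit_fun (fun t => k t * l t).
Proof.
move=> uk ul; split; first by apply: rcM; [case: uk|case: ul].
move=> t; have := unit_fun_ge0 t uk; have := unit_fun_ge0 t ul.
have := unit_fun_le1 t uk; have := unit_fun_le1 t ul => *.
by apply/andP; split; nra.
Qed.

Lemma massCM k l : unit_fun k -> unit_fun l ->
  mass (fun t => 1 - k t * l t) <= mass (fun t => 1 - k t) + mass (fun t => 1 - l t).
Proof.
move=> uk ul; have [ck _] := unit_funC uk; have [cl _] := unit_funC ul.
rewrite -massD//; apply: mass_mono.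
- by have [] := unit_funC (unit_funM uk ul).
- exact: rcD.
move=> t; have := unit_fun_ge0 t uk; have := unit_fun_ge0 t ul.
have := unit_fun_le1 t uk; have := unit_fun_le1 t ul => *; nra.
Qed.

Lemma tv_unit_le psi k : unit_fun k -> tv psi k <= rnorm psi.
Proof.
move=> [ck k01]; rewrite -[leRHS](tv1 j).
apply: tv_mono => //; first exact: rc_cst.
  by move=> t; have /andP[] := k01 t.
by move=> t; have /andP[] := k01 t.
Qed.

Lemma tv_split psi k : unit_fun k ->
  rnorm psi = tv psi k + tv psi (fun t => 1 - k t).
Proof.
move=> uk; have [ck _] := uk; have [ck' _] := unit_funC uk.
rewrite -tvD//; last 2 first.
- by move=> t; exact: unit_fun_ge0.
- by move=> t; exact: unit_fun_ge0 (unit_funC uk).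
by rewrite -(tv1 j); congr tv; apply/funext => t; rewrite addrC subrK.
Qed.

Lemma reM k l : re (fun t => k t * l t) = fun t => (k t)%:C * (l t)%:C.
Proof. by apply/funext => t; rewrite rmorphM. Qed.

Lemma dc_reM psi k l : rc k -> rc l ->
  dc psi (re (fun t => k t * l t)) = dc (dc psi (re k)) (re l).
Proof. by move=> ck cl; rewrite dcA// reM. Qed.

Lemma dcC psi k : rc k -> dc psi (re (fun t => 1 - k t)) = psi - dc psi (re k).
Proof.
move=> ck; rewrite -[X in _ = X - _](dc1 j) -dcBr//; last exact: ccont_cst.
by congr dc; apply/funext => t; rewrite rmorphB.
Qed.

(* The functionals absolutely continuous with respect to phi0. *)
Definition ac v := forall eta : R, 0 < eta -> exists2 e : R, 0 < e &
  forall k, unit_fun k -> mass k <= e -> tv v k <= eta.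

Lemma acD u v : ac u -> ac v -> ac (u + v).
Proof.
move=> au av eta eta0; have eta2 : 0 < eta / 2 by rewrite divr_gt0.
have [e e0 eu] := au _ eta2; have [d d0 dv] := av _ eta2.
exists (Num.min e d); first by rewrite lt_min e0.
move=> k uk; rewrite le_min => /andP[ke kd].
by apply: le_trans (tvDl _ _ _ _) _; rewrite [eta]splitr lerD ?eu ?dv.
Qed.

(** Subtractivity is asked instead of linearity so that the conjugate-linear [dstar] is included,
    along with scalings, [dact] and [bidact F]. Such maps preserve [ac], hence commute with taking
    absolutely continuous parts. *)
Definition module_map (Q : dual A -> dual A) := [/\
  forall phi psi, Q (phi - psi) = Q phi - Q psi,
  exists2 M : R, 0 <= M & forall psi, rnorm (Q psi) <= M * rnorm psi &
  forall psi k, rc k -> Q (dc psi (re k)) = dc (Q psi) (re k)].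

Lemma module_map_small Q (e : R) : module_map Q -> 0 < e -> exists2 d : R, 0 < d &
  forall psi, rnorm psi <= d -> rnorm (Q psi) <= e.
Proof.
move=> [_ [M M0 QM] _] e0; have M1 : 0 < M + 1 by rewrite ltr_wpDl.
exists (e / (M + 1)); first by rewrite divr_gt0.
move=> psi h; apply: le_trans (QM _) _.
apply: (@le_trans _ _ ((M + 1) * (e / (M + 1)))); last first.
  by rewrite mulrCA divff ?mulr1// gt_eqF.
by apply: ler_pM; rewrite ?rnorm_ge0// lerDl.
Qed.

Lemma ac_map Q v : module_map Q -> ac v -> ac (Q v).
Proof.
move=> mQ av eta /(module_map_small mQ)[d d0 dQ]; have [e e0 ev] := av _ d0.
exists e => // k uk ke; have [_ _ Qk] := mQ; have [ck _] := uk.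
by rewrite /tv -Qk//; apply: dQ; exact: ev.
Qed.

(* v is the absolutely continuous part of psi. *)
Definition ac_part psi v := ac v /\ forall e : R, 0 < e -> exists w,
  [/\ unit_fun w, mass (fun t => 1 - w t) <= e & rnorm (dc psi (re w) - v) <= e].

(** Take the product of cut-offs [w] and [w'] for the two pairs: as [v] is absolutely continuous and
    [1 - w'] has small mass, multiplying by [w'] hardly changes [v], and symmetrically. *)
Lemma ac_part_joint psi v psi' v' (e : R) : ac_part psi v -> ac_part psi' v' ->
  0 < e -> exists w, [/\ unit_fun w, mass (fun t => 1 - w t) <= e,
    rnorm (dc psi (re w) - v) <= e & rnorm (dc psi' (re w) - v') <= e].
Proof.
move=> [av h] [av' h'] e0; have e2 : 0 < e / 2 by rewrite divr_gt0.
have [d d0 dv] := av _ e2; have [d' d0' dv'] := av' _ e2.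
have m0 : 0 < Num.min (e / 2) d' by rewrite lt_min e2.
have m0' : 0 < Num.min (e / 2) d by rewrite lt_min e2.
have [w [uw mw ww]] := h _ m0; have [w' [uw' mw' ww']] := h' _ m0'.
move: mw ww mw' ww'; rewrite !le_min => /andP[mw1 mw2] /andP[ww1 _].
move=> /andP[mw1' mw2'] /andP[ww1' _].
have [cw _] := uw; have [cw' _] := uw'.
have key xi y k l : unit_fun k -> unit_fun l -> rnorm (dc xi (re k) - y) <= e / 2 ->
    tv y (fun t => 1 - l t) <= e / 2 ->
    rnorm (dc (dc xi (re k)) (re l) - y) <= e.
  move=> uk ul h1 h2; have [cl _] := ul.
  apply: le_trans (ler_rdistD (dc y (re l)) _ _) _; rewrite [e]splitr; apply: lerD.
    rewrite -dcBl; apply: le_trans h1; rewrite -[leRHS]mulr1.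
    apply: dc_le => // t; rewrite rnormC_ge0; first exact: unit_fun_le1.
    exact: unit_fun_ge0.
  by rewrite rdistC -dcC.
exists (fun t => w t * w' t); split.
- exact: unit_funM.
- by apply: le_trans (massCM uw uw') _; rewrite [e]splitr lerD.
- rewrite dc_reM//; apply: key => //; apply: dv => //; exact: unit_funC.
- rewrite dc_reM// dcAC; apply: key => //; apply: dv' => //; exact: unit_funC.
Qed.

Lemma ac_part_uniq psi v v' : ac_part psi v -> ac_part psi v' -> v = v'.
Proof.
move=> h h'; apply/subr0_eq/rnorm_small => e e0.
have e2 : 0 < e / 2 by rewrite divr_gt0.
have [w [_ _ h1 h2]] := ac_part_joint h h' e2.
apply: le_trans (ler_rdistD (dc psi (re w)) _ _) _; rewrite [e]splitr lerD//.
by rewrite rdistC.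
Qed.

Lemma ac_partD psi v psi' v' : ac_part psi v -> ac_part psi' v' ->
  ac_part (psi + psi') (v + v').
Proof.
move=> h h'; split; first by apply: acD; [case: h|case: h'].
move=> e e0; have e2 : 0 < e / 2 by rewrite divr_gt0.
have [w [uw mw h1 h2]] := ac_part_joint h h' e2; exists w; split => //.
  by apply: le_trans mw _; rewrite ler_pdivrMr// ler_pMr// ler1n.
rewrite dcDl opprD addrACA [e]splitr.
by apply: le_trans (ler_rnormD _ _) _; exact: lerD.
Qed.

Lemma ac_part_map Q psi v : module_map Q -> ac_part psi v -> ac_part (Q psi) (Q v).
Proof.
move=> mQ [av h]; split; first exact: ac_map.
move=> e e0; have [d d0 dQ] := module_map_small mQ e0.
have m0 : 0 < Num.min e d by rewrite lt_min e0.
have [w [uw mw ww]] := h _ m0; move: mw ww; rewrite !le_min.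
move=> /andP[mw _] /andP[_ ww]; exists w; split => //.
by have [QB _ Qk] := mQ; have [cw _] := uw; rewrite -Qk// -QB; exact: dQ.
Qed.

Lemma ac_part_self v : ac v -> ac_part v v.
Proof.
move=> av; split => // e e0; exists (fun=> 1); split; first exact: unit_fun1.
  rewrite (_ : mass _ = 0); first exact: ltW.
  rewrite /mass (_ : el _ = 0) ?raddf0//.
  apply: (fval_inj (j := j)) => t; rewrite elE; last exact: rc_cst.
  by have := fvalZ j 0 0 t; rewrite scale0r mul0r => ->; rewrite subrr.
by rewrite [dc v _](dc1 j) subrr rnorm0 ltW.
Qed.

Lemma ac_part_le psi v : ac_part psi v -> rnorm v <= rnorm psi.
Proof.
move=> [_ h]; apply/ler_addgt0Pr => e /h[w [uw _ ww]].
apply: le_trans (ler_rnormBD _ (dc psi (re w))) _.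
by rewrite rdistC addrC lerD//; exact: tv_unit_le.
Qed.

(* Near-minimizers w of tv psi w under mass (1 - w) <= e, as e -> 0. *)
Lemma ac_part_ex psi : exists v, ac_part psi v.
Proof.
pose S e := [set tv psi w | w in [set w | unit_fun w /\ mass (fun t => 1 - w t) <= e]].
pose M e := inf (S e).
have S1 e : 0 < e -> S e (rnorm psi).
  move=> e0; exists (fun=> 1); last exact: tv1.
  split; first exact: unit_fun1.
  rewrite (_ : mass _ = 0) ?ltW//.
  rewrite /mass (_ : el _ = 0) ?raddf0//.
  apply: (fval_inj (j := j)) => t; rewrite elE; last exact: rc_cst.
  by have := fvalZ j 0 0 t; rewrite scale0r mul0r => ->; rewrite subrr.
have Sinf e : 0 < e -> has_inf (S e).
  move=> e0; split; first by exists (rnorm psi); exact: S1.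
  by exists 0 => _ [w _ <-]; exact: tv_ge0.
have Mle e w : 0 < e -> unit_fun w -> mass (fun t => 1 - w t) <= e -> M e <= tv psi w.
  by move=> e0 uw mw; apply: ge_inf; [case: (Sinf e e0)|exists w].
have M_anti e e' : 0 < e -> e <= e' -> M e' <= M e.
  move=> e0 ee'; apply: lb_le_inf; first by exists (rnorm psi); exact: S1.
  move=> _ [w [uw mw] <-]; apply: Mle => //; first exact: lt_le_trans ee'.
  exact: le_trans mw ee'.
(* [M e] increases as [e] decreases, so [m] is its limit at 0. *)
pose m := sup [set M e | e in [set e | 0 < e]].
have msup : has_sup [set M e | e in [set e : R | 0 < e]].
  split; first by exists (M 1), 1 => //=.
  exists (rnorm psi) => _ [e /= e0 <-]; apply: ge_inf; first by case: (Sinf e e0).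
  exact: S1.
have Mm e : 0 < e -> M e <= m.
  by move=> e0; apply: ub_le_sup; [case: msup|exists e].
have /choice[w wP] : forall n : nat, exists w, [/\ unit_fun w,
    mass (fun t => 1 - w t) <= n.+1%:R^-1 & tv psi w <= M n.+1%:R^-1 + n.+1%:R^-1].
  move=> n; have n0 : 0 < n.+1%:R^-1 :> R by rewrite invr_gt0.
  have [_ [w [uw mw] <-] /ltW h] := inf_adherent n0 (Sinf _ n0).
  by exists w.
have uw n : unit_fun (w n) by case: (wP n).
have cw n : rc (w n) by case: (uw n).
(* If [1 - l] has small mass, [w n * l] still competes for some [M d] close to [m], while
   [tv psi (w n)] hardly exceeds [m]; so only little is lost on [w n * (1 - l)]. This gives both the
   Cauchy property, with [l] another [w n'], and absolute continuity of the limit, with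
   [l = 1 - k]. *)
have lose (e : R) : 0 < e -> exists d : R, exists N, 0 < d /\ forall n l,
    (N <= n)%N -> unit_fun l -> mass (fun t => 1 - l t) <= d ->
    tv psi (fun t => w n t * (1 - l t)) <= e.
  move=> e0; have e2 : 0 < e / 2 by rewrite divr_gt0.
  have [_ [d /= d0 <-] dm] := sup_adherent e2 msup.
  have d2 : 0 < d / 2 by rewrite divr_gt0.
  have q0 : 0 < Num.min (d / 2) (e / 2) by rewrite lt_min d2.
  have [N NP] := small_inv q0; exists (d / 2), N; split => // n l Nn ul ml.
  have := NP n Nn; rewrite le_min => /andP[nd ne].
  have [_ wm wt] := wP n; have n0 : 0 < n.+1%:R^-1 :> R by rewrite invr_gt0.
  have ucl := unit_funC ul; have [cl _] := ul; have [ccl _] := ucl.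
  have : M d <= tv psi (fun t => w n t * l t).
    apply: Mle => //; first exact: unit_funM.
    apply: le_trans (massCM (uw n) ul) _; rewrite [d]splitr lerD//.
    exact: le_trans wm nd.
  have : tv psi (w n) = tv psi (fun t => w n t * l t) + tv psi (fun t => w n t * (1 - l t)).
    rewrite -tvD.
    - by congr tv; apply/funext => t; ring.
    - exact: rcM.
    - exact: rcM.
    - by move=> t; exact: unit_fun_ge0 (unit_funM (uw n) ul).
    - by move=> t; exact: unit_fun_ge0 (unit_funM (uw n) ucl).
  have := Mm _ n0; move: wt ne dm; rewrite -/m.
  set a1 := tv psi (w n); set a2 := tv psi _; set a3 := tv psi _.
  set Mn := M _; set i := _^-1; set Md := M d; clearbody a1 a2 a3 Mn i Md m.
  by move=> *; lra.
have [e e0|v vP] := @dual_complete R A (fun n => dc psi (re (w n))).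
  have e2 : 0 < e / 2 by rewrite divr_gt0.
  have [d [N [d0 dN]]] := lose _ e2; have [N' NP'] := small_inv d0.
  exists (maxn N N') => n n'; rewrite !geq_max => /andP[Nn Nn'] /andP[Nm Nm'].
  have h p q : (N <= p)%N -> (N' <= q)%N ->
      rnorm (dc psi (re (w p)) - dc (dc psi (re (w p))) (re (w q))) <= e / 2.
    move=> Np Nq; rewrite -dcC// -dc_reM//; last by have [] := unit_funC (uw q).
    by apply: dN => //; have [_ wm _] := wP q; exact: le_trans wm (NP' _ Nq).
  apply: le_trans (ler_rdistD (dc (dc psi (re (w n))) (re (w n'))) _ _) _.
  by rewrite [e]splitr lerD ?h// rdistC dcAC h.
exists v; split=> [eta eta0|e e0].
  have eta2 : 0 < eta / 2 by rewrite divr_gt0.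
  have [d [N [d0 dN]]] := lose _ eta2; have [N' NP'] := vP _ eta2.
  exists d => // k uk kd; pose n := maxn N N'.
  have ukc := unit_funC uk; have [ck _] := uk.
  have := dN n (fun t => 1 - k t) (leq_maxl _ _) ukc.
  have -> : (fun t => 1 - (1 - k t)) = k by apply/funext => t; ring.
  move=> /(_ kd); have -> : (fun t => w n t * (1 - (1 - k t))) = fun t => w n t * k t.
    by apply/funext => t; ring.
  have h := NP' n (leq_maxr _ _); rewrite {1}/tv dc_reM// => h'.
  have : tv v k <= rnorm (dc (dc psi (re (w n)) - v) (re k)) +
      rnorm (dc (dc psi (re (w n))) (re k)).
    rewrite dcBl rdistC addrC; apply: le_trans (ler_rnormD _ _).
    by rewrite addrC subrK.
  move=> /le_trans; apply; rewrite [eta]splitr lerD//.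
  exact: le_trans (tv_unit_le _ uk) h.
have [N NP] := vP _ e0; have [N' NP'] := small_inv e0; pose n := maxn N N'.
exists (w n); split => //; last exact: NP (leq_maxl _ _).
by have [_ wm _] := wP n; apply: le_trans wm (NP' _ (leq_maxr _ _)).
Qed.

Definition acp psi : dual A := projT1 (cid (ac_part_ex psi)).

Lemma acpP psi : ac_part psi (acp psi).
Proof. by rewrite /acp; case: cid. Qed.

Lemma acp_eq psi v : ac_part psi v -> acp psi = v.
Proof. exact: ac_part_uniq (acpP psi). Qed.

Lemma acp_ac psi : ac (acp psi). Proof. by case: (acpP psi). Qed.

Lemma acp_id v : ac v -> acp v = v.
Proof. by move=> av; apply/acp_eq/ac_part_self. Qed.

Lemma acpD phi psi : acp (phi + psi) = acp phi + acp psi.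
Proof. by apply/acp_eq/ac_partD; exact: acpP. Qed.

Lemma acp_map Q psi : module_map Q -> acp (Q psi) = Q (acp psi).
Proof. by move=> mQ; apply/acp_eq/ac_part_map => //; exact: acpP. Qed.

Lemma module_mapZ (c : R[i]) : module_map (fun psi => c *: psi).
Proof.
split=> [phi psi||psi k _]; first exact: scalerBr.
  by exists (rnorm c) => [|psi]; [exact: rnorm_ge0|rewrite rnormZ].
by rewrite dcZl.
Qed.

Lemma module_map_dact a : module_map (fun psi => dact psi a).
Proof.
split=> [phi psi||psi k ck]; first exact: dual_ext.
  exists (rnorm a) => [|psi]; first exact: rnorm_ge0.
  by rewrite mulrC -rnormP rmorphM /= -!normE; exact: dact_norm.
by apply: dual_ext => b; rewrite /= !cmulA [cmul (el _) a](fcmulC j).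
Qed.

Lemma module_map_bidact (F : dual (dual A)) : module_map (bidact F).
Proof.
split=> [phi psi||psi k ck].
- apply: dual_ext => a; rewrite dual_subE /= -dualB; congr (dual_fun F _).
  exact: dual_ext.
- exists (rnorm F) => [|psi]; first exact: rnorm_ge0.
  by rewrite -rnormP rmorphM /= -!normE; exact: bidact_norm.
- apply: dual_ext => b /=; congr (dual_fun F _); apply: dual_ext => d /=.
  by rewrite cmulA.
Qed.

Lemma module_map_dstar : module_map (@dstar R A).
Proof.
split=> [phi psi||psi k ck].
- apply: dual_ext => a; rewrite dual_subE -[LHS]/(conjc ((phi - psi) (cstar a))).
  by rewrite dual_subE conjcB.
- exists 1 => // psi; rewrite mul1r -rnormP -normE.
  by apply: norm_dual_le => // a; exact: dstar_le.
- apply: dual_ext => a /=; rewrite cstarM -el_star//.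
  rewrite (_ : (fun t => conjc _) = re k); first by rewrite (fcmulC j).
  by apply/funext => t; rewrite conjc_real.
Qed.

Fact zac_scalar : scalar (fun psi => acp psi (el (fun=> 1))).
Proof.
by move=> c phi psi; rewrite acpD (acp_map _ (module_mapZ c)) dual_addE dual_scaleE.
Qed.

Fact zac_bounded : exists2 M : R, 0 <= M &
  forall psi, rnorm (acp psi (el (fun=> 1))) <= M * rnorm psi.
Proof.
exists 1 => // psi; rewrite mul1r; apply: le_trans (ac_part_le (acpP psi)).
rewrite -[leRHS]mulr1; apply: eval_le => //; first exact: ccont_cst.
by move=> t; rewrite rnorm1.
Qed.

Definition zac : dual (dual A) := rmkdual zac_scalar zac_bounded.

Lemma zacE psi : zac psi = acp psi (el (fun=> 1)). Proof. by []. Qed.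

Lemma dact_el1 psi a : dact psi a (el (fun=> 1)) = psi a.
Proof. by rewrite /= (fcmulC j) el1. Qed.

Lemma bidact_zac psi : bidact zac psi = acp psi.
Proof.
apply: dual_ext => a; rewrite -[LHS]/(zac (dact psi a)) zacE.
by rewrite (acp_map _ (module_map_dact a)) dact_el1.
Qed.

Lemma arensE (E F : dual (dual A)) psi : arens E F psi = E (bidact F psi).
Proof. by []. Qed.

Lemma bidact_el1 (F : dual (dual A)) psi : bidact F psi (el (fun=> 1)) = F psi.
Proof.
rewrite /=; congr (dual_fun F _); apply: dual_ext => a.
by rewrite /= el1.
Qed.

(** [acp] is idempotent and commutes with the module maps [dstar] and [bidact F]; these give
    idempotence, self-adjointness and centrality respectively. *)
Lemma zac_central : central_projection zac.
Proof.
split=> [||F]; apply: dual_ext => psi.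
- by rewrite arensE bidact_zac !zacE acp_id//; exact: acp_ac.
- rewrite -[LHS]/(conjc (zac (dstar psi))) !zacE (acp_map _ module_map_dstar) /=.
  rewrite conjcK; congr (dual_fun (acp psi) _).
  rewrite -el_star; last exact: ccont_cst.
  by congr (el _); apply/funext => t; rewrite conjc1.
- rewrite !arensE bidact_zac zacE (acp_map _ (module_map_bidact F)).
  exact: bidact_el1.
Qed.

Fact ev_scalar a : scalar (fun psi : dual A => psi a). Proof. by []. Qed.

Fact ev_bounded a : exists2 M : R, 0 <= M &
  forall psi : dual A, rnorm (psi a) <= M * rnorm psi.
Proof.
exists (rnorm a) => [|psi]; first exact: rnorm_ge0.
by rewrite mulrC; exact: dual_rle.
Qed.

Definition ev a : dual (dual A) := rmkdual (@ev_scalar a) (@ev_bounded a).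

(** Testing on the evaluations [ev a] suffices: by centrality, the product of [z] and [ev a] takes
    at [psi] the value of [bidact z psi] at [a]. *)
Lemma vanishes_offE psi (z : dual (dual A)) : central_projection z ->
  vanishes_off psi z <-> bidact z psi = psi.
Proof.
move=> [_ _ zC]; split=> [h|h F].
  apply: dual_ext => a; have := h (ev a); rewrite dual_subE zC arensE.
  by move=> /subr0_eq h'; rewrite -[LHS]/(ev a (bidact z psi)) -h'.
by rewrite dual_subE zC arensE h subrr.
Qed.

Lemma vanishes_off_zac psi : vanishes_off psi zac <-> ac psi.
Proof.
rewrite (vanishes_offE _ zac_central) bidact_zac; split=> [<-|]; first exact: acp_ac.
exact: acp_id.
Qed.

End band.

(** * Separating two functionals by a continuous function *)

Section separation.
Context {R : realType} {X : topologicalType} {A : cstarType R}.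
Variable j : function_rep A X.
Implicit Types (f g u : X -> R[i]) (k l w c : X -> R) (phi psi v y : dual A).

Local Notation dc := (dc j).
Local Notation tv := (tv j).
Local Notation el := (el j).
Local Notation re k := (fun t => (k t)%:C).

(** An approximate polar decomposition: a function [u] that nearly norms [psi] must nearly norm
    every cut [k psi] at once, because [tv_split] leaves no room for a loss on [k] or on [1 - k]. *)
Lemma norming_unit psi (e : R) : 0 < e -> exists u, [/\ ccont u,
  forall t, rnorm (u t) <= 1 & forall k, unit_fun k ->
    rnorm (psi (el (fun t => (k t)%:C * u t)) - (tv psi k)%:C) <= e].
Proof.
move=> e0; have p1 : 0 < rnorm psi + 1 by rewrite ltr_wpDl// rnorm_ge0.
(* From [rnorm z <= T] and [Re z >= T - d] the squared distance of [z] to [T] is at most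
   [2 * T * d], hence at most [e ^+ 2]. *)
pose d := e ^+ 2 / (2 * (rnorm psi + 1)).
have d0 : 0 < d by rewrite divr_gt0 ?exprn_gt0// mulr_gt0.
have [u [cu u1 uP]] := norming j psi d0; exists u; split => // k uk.
have [ck _] := uk; have ucl := unit_funC uk; have [ck' _] := ucl.
set z := psi _; set T := tv psi k.
have zT : rnorm z <= T by exact: eval_tv.
have T0 : 0 <= T by exact: tv_ge0.
have Tp : T <= rnorm psi by exact: tv_unit_le.
have zd : T - d <= Re z.
  have h := eval_tv j psi ck' cu u1.
  have := Re_le_rnorm (psi (el (fun t => (1 - k t)%:C * u t))).
  move: uP; rewrite (tv_split j psi uk) -/T.
  have -> : el u = el (fun t => (k t)%:C * u t) + el (fun t => (1 - k t)%:C * u t).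
    rewrite -elD; [|by apply: ccontM..].
    congr el; apply/funext => t; rewrite -mulrDl -rmorphD.
    by rewrite addrC subrK mul1r.
  rewrite dualD ReD -/z; move: h.
  by set a := rnorm _; set b := Re (psi _); set r := tv _ _; lra.
rewrite -(@ler_pXn2r _ 2)// ?nnegrE ?rnorm_ge0//; last exact: ltW.
rewrite rnorm_sqr ReB ImB /= subr0.
have : rnorm z ^+ 2 <= T ^+ 2 by rewrite lerXn2r// nnegrE ?rnorm_ge0.
rewrite rnorm_sqr => h.
have : e ^+ 2 = d * (2 * (rnorm psi + 1)).
  by rewrite /d divfK// gt_eqF// mulr_gt0.
by move=> ->; move: h zd Tp d0 T0; set a := Re z; set b := Im z; set N := rnorm psi; nra.
Qed.

(** The factor 4 counts the positive and negative parts of the real and imaginary parts. *)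
Lemma dual_le_unit psi (e : R) : 0 <= e ->
  (forall k, unit_fun k -> rnorm (psi (el (re k))) <= e) -> rnorm psi <= 4 * e.
Proof.
move=> e0 h; apply: (rnorm_dual_sup (j := j)) => [|f cf f1].
  by rewrite mulr_ge0.
pose p (k : X -> R) t := Num.max (k t) 0.
have pu k : rc k -> (forall t, `|k t| <= 1) -> unit_fun (p k).
  move=> ck k1; split; first by apply: rc_max => //; exact: rc_cst.
  move=> t; rewrite /p le_max lexx orbT ge_max ler01 andbT.
  by have := k1 t; rewrite ler_norml => /andP[].
have pE (r : R) : r = Num.max r 0 - Num.max (- r) 0.
  rewrite /Num.max; case: ltrP => [r0|r0]; case: ltrP => ?; lra.
pose g1 t := Re (f t); pose g2 t := Im (f t).
have c1 : rc g1 by exact: ccont_Re.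
have c2 : rc g2 by exact: ccont_Im.
have b1 t : `|g1 t| <= 1 by apply: le_trans (normRe_le _) _.
have b2 t : `|g2 t| <= 1 by apply: le_trans (normIm_le _) _.
have u1 := pu _ c1 b1; have u2 := pu _ c2 b2.
have [|v1 _] := pu _ (rcN c1); first by move=> t; rewrite normrN.
have [|v2 _] := pu _ (rcN c2); first by move=> t; rewrite normrN.
have u1' : unit_fun (p (fun t => - g1 t)) by apply: pu; [exact: rcN|move=> t; rewrite normrN].
have u2' : unit_fun (p (fun t => - g2 t)) by apply: pu; [exact: rcN|move=> t; rewrite normrN].
have [d1 _] := u1; have [d2 _] := u2.
have -> : el f = (el (re (p g1)) + (-1) *: el (re (p (fun t => - g1 t)))) +
    'i *: (el (re (p g2)) + (-1) *: el (re (p (fun t => - g2 t)))).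
  have e1 := ccontZ (-1) v1; have e2 := ccontZ (-1) v2.
  rewrite -(elZ j (-1) v1) -(elZ j (-1) v2) -(elD j d1 e1) -(elD j d2 e2).
  have de2 := ccontD d2 e2.
  rewrite -(elZ j 'i de2) -(elD j (ccontD d1 e1) (ccontZ 'i de2)).
  congr el; apply/funext => t; rewrite [LHS]complexE !mulN1r -!rmorphB.
  by rewrite /p -!pE.
rewrite !dualD !dualZ !dualD !dualZ.
have i1 : rnorm ('i : R[i]) = 1.
  by rewrite /rnorm normc_def /= expr0n add0r expr1n sqrtr1.
apply: le_trans (ler_rnormD _ _) _; rewrite rnormM i1 mul1r.
apply: le_trans (lerD (ler_rnormD _ _) (ler_rnormD _ _)) _.
rewrite !mulN1r !rnormN.
have := h _ u1; have := h _ u2; have := h _ u1'; have := h _ u2'.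
by set a := rnorm _; set b := rnorm _; set r := rnorm _; set s := rnorm _; lra.
Qed.

(* First-order condition at a near-minimizer k of |phi|((1-k)^2) + |y|(k^2). *)
Lemma balance phi y (e : R) : 0 < e -> exists2 k, unit_fun k & forall c, unit_fun c ->
  `|tv phi (fun t => (1 - k t) * c t) - tv y (fun t => k t * c t)| <= e.
Proof.
move=> e0; pose K := rnorm phi + rnorm y.
have K0 : 0 <= K by rewrite addr_ge0 ?rnorm_ge0.
(* Moving [k] by [s c] either way contributes quadratic terms of at most [s ^+ 2 * K], and [k] is
   optimal up to [s ^+ 2]; dividing by the factor [2 * s] of the linear term leaves
   [s * (1 + K) / 2], below [e]. *)
pose s := e / (1 + K); have s0 : 0 < s by rewrite divr_gt0// ltr_wpDr.
have s2 : 0 < s ^+ 2 by rewrite exprn_gt0.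
pose Phi k := tv phi (fun t => (1 - k t) ^+ 2) + tv y (fun t => k t ^+ 2).
pose D := [set Phi k | k in [set k | rc k]].
have rcX k : rc k -> rc (fun t => k t ^+ 2) by move=> ck; exact: rcM.
have rc1B k : rc k -> rc (fun t => 1 - k t) by move=> ck; apply/rcB/ck/rc_cst.
have Dinf : has_inf D.
  split; first by exists (Phi (fun=> 0)), (fun=> 0) => //; exact: rc_cst.
  by exists 0 => _ [k _ <-]; rewrite addr_ge0// tv_ge0.
have [_ [k0 /= ck0 <-] /ltW hk0] := inf_adherent s2 Dinf.
(* Clipping to the unit interval increases neither [(1 - k0) ^+ 2] nor [k0 ^+ 2] at any point. *)
pose k t := Num.max 0 (Num.min 1 (k0 t)).
have uk : unit_fun k.
  split; first by apply: rc_max; [exact: rc_cst|apply: rc_min => //; exact: rc_cst].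
  by move=> t; rewrite /k le_max lexx ge_max ler01 ge_min lexx.
have [ck _] := uk.
have Phik : Phi k <= inf D + s ^+ 2.
  apply: le_trans hk0; apply: lerD; apply: tv_mono => //.
  - exact/rcX/rc1B.
  - exact/rcX/rc1B.
  - by move=> t; exact: sqr_ge0.
  - move=> t; rewrite /k /Num.max /Num.min; set r := k0 t.
    by case: (ltrP 1 r) => h1; case: ltrP => h2; nra.
  - exact/rcX.
  - exact/rcX.
  - by move=> t; exact: sqr_ge0.
  - move=> t; rewrite /k /Num.max /Num.min; set r := k0 t.
    by case: (ltrP 1 r) => h1; case: ltrP => h2; nra.
exists k => // c uc; have [cc _] := uc.
have uck := unit_funC uk; have [ckc _] := uck.
have k0t t := unit_fun_ge0 t uk; have k1t t := unit_fun_ge0 t uck.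
have c0t t := unit_fun_ge0 t uc; have c1t t := unit_fun_le1 t uc.
pose a := tv phi (fun t => (1 - k t) * c t); pose b := tv y (fun t => k t * c t).
have tvc psi : tv psi (fun t => c t ^+ 2) <= rnorm psi.
  apply: tv_unit_le; have -> : (fun t => c t ^+ 2) = (fun t => c t * c t) by [].
  exact: unit_funM.
have expand psi l : rc l -> (forall t, 0 <= l t) ->
    tv psi (fun t => (l t + s * c t) ^+ 2) = tv psi (fun t => l t ^+ 2) +
      2 * s * tv psi (fun t => l t * c t) + s ^+ 2 * tv psi (fun t => c t ^+ 2).
  move=> cl l0.
  have cX1 := rcX _ cl; have cX2 := rcM cl cc; have cX3 := rcX _ cc.
  have sn : 0 <= 2 * s by rewrite mulr_ge0// ltW.
  rewrite -tvZ// -tvZ//; last by rewrite ltW.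
  have cY2 := rcM (rc_cst (2 * s)) cX2; have cY3 := rcM (rc_cst (s ^+ 2)) cX3.
  have l2 t : 0 <= l t ^+ 2 by exact: sqr_ge0.
  have lc t : 0 <= 2 * s * (l t * c t) by rewrite mulr_ge0// mulr_ge0.
  have c2 t : 0 <= s ^+ 2 * c t ^+ 2 by rewrite mulr_ge0 ?sqr_ge0.
  rewrite -tvD// -tvD//; last 2 first.
  - exact: rcD.
  - by move=> t; rewrite addr_ge0.
  by congr tv; apply/funext => t; ring.
(* Additivity of [tv] holds for nonnegative functions, so the cross term is added on the left
   instead of being subtracted on the right. *)
have shrink psi l : rc l -> (forall t, 0 <= l t) ->
    tv psi (fun t => (l t - s * c t) ^+ 2) + 2 * s * tv psi (fun t => l t * c t) =
      tv psi (fun t => l t ^+ 2) + s ^+ 2 * tv psi (fun t => c t ^+ 2).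
  move=> cl l0.
  have cX1 := rcX _ cl; have cX2 := rcM cl cc; have cX3 := rcX _ cc.
  have sn : 0 <= 2 * s by rewrite mulr_ge0// ltW.
  rewrite -tvZ// -tvZ//; last by rewrite ltW.
  have cY2 := rcM (rc_cst (2 * s)) cX2; have cY3 := rcM (rc_cst (s ^+ 2)) cX3.
  have l2 t : 0 <= l t ^+ 2 by exact: sqr_ge0.
  have lc t : 0 <= 2 * s * (l t * c t) by rewrite mulr_ge0// mulr_ge0.
  have c2 t : 0 <= s ^+ 2 * c t ^+ 2 by rewrite mulr_ge0 ?sqr_ge0.
  have cZ := rcX _ (rcB cl (rcM (rc_cst s) cc)).
  have z2 t : 0 <= (l t - s * c t) ^+ 2 by exact: sqr_ge0.
  rewrite -tvD// -tvD//.
  by congr tv; apply/funext => t; ring.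
have Ple l : rc l -> inf D <= Phi l.
  by move=> cl; apply: ge_inf; [case: Dinf|exists l].
have P1 := Ple _ (rcD ck (rcM (rc_cst s) cc)).
have P2 := Ple _ (rcB ck (rcM (rc_cst s) cc)).
move: P1; rewrite /Phi (expand y k ck k0t).
have -> : (fun t => (1 - (k t + s * c t)) ^+ 2) = (fun t => (1 - k t - s * c t) ^+ 2).
  by apply/funext => t; ring.
move: P2; rewrite /Phi.
have -> : (fun t => (1 - (k t - s * c t)) ^+ 2) = (fun t => (1 - k t + s * c t) ^+ 2).
  by apply/funext => t; ring.
rewrite (expand phi _ ckc k1t) => P2 P1.
have S1 := shrink phi _ ckc k1t; have S2 := shrink y k ck k0t.
move: Phik P1 P2 S1 S2 (tvc phi) (tvc y); rewrite /Phi -/a -/b.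
have es : e = s * (1 + K) by rewrite /s divfK// gt_eqF// ltr_wpDr.
have Kdef : rnorm phi + rnorm y = K by [].
clearbody a b K.
set p1 := tv phi _; set y1 := tv y _; set p2 := tv phi (fun t => c t ^+ 2).
set y2 := tv y (fun t => c t ^+ 2); set p3 := tv phi _; set y3 := tv y _.
move=> h1 h2 h3 h4 h5 h6 h7.
rewrite ler_norml es; apply/andP; split; rewrite -(ler_pM2l s0); nra.
Qed.

Lemma bidact_dc (F : dual (dual A)) psi f : bidact F (dc psi f) = dc (bidact F psi) f.
Proof.
apply: dual_ext => b /=; congr (dual_fun F _); apply: dual_ext => d /=.
by rewrite cmulA.
Qed.

Lemma bidactB (F : dual (dual A)) phi psi :
  bidact F (phi - psi) = bidact F phi - bidact F psi.
Proof. by have [QB _ _] := module_map_bidact j F; exact: QB. Qed.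

(** With [k] from [balance] and phases [u], [u'] from [norming_unit], the functional
    [(1 - k) u phi - k u' y] is small. [F] maps it to [(1 - k) u phi], which is therefore small too;
    hence so is [|phi|(1 - k)], and by balance [|y|(k)]. *)
Lemma separate (F : dual (dual A)) phi y (e : R) : bidact F phi = phi ->
  bidact F y = 0 -> 0 < e -> exists k, [/\ unit_fun k,
    tv phi (fun t => 1 - k t) <= e & tv y k <= e].
Proof.
move=> Fphi Fy e0; pose K := rnorm F.
have K0 : 0 <= K by exact: rnorm_ge0.
(* The difference has norm at most [4 * (3 * d)]: two phase errors and one balance error, times the
   4 of [dual_le_unit]. After [F], one more phase error and one more balance error give
   [12 * K * d + 2 * d]. *)
pose d := e / (12 * K + 2).
have K1 : 0 < 12 * K + 2 by rewrite ltr_wpDl// mulr_ge0.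
have d0 : 0 < d by rewrite divr_gt0.
have ed : e = d * (12 * K + 2) by rewrite /d divfK// gt_eqF.
have [k uk kP] := balance phi y d0.
have [u [cu u1 uP]] := norming_unit phi d0.
have [u' [cu' u1' uP']] := norming_unit y d0.
have uck := unit_funC uk; have [ck _] := uk; have [ck' _] := uck.
pose f t := (1 - k t)%:C * u t; pose g t := (k t)%:C * u' t.
have cf : ccont f by exact: ccontM.
have cg : ccont g by exact: ccontM.
pose th := dc phi f - dc y g.
have thle : rnorm th <= 4 * (3 * d).
  apply: dual_le_unit => [|c uc]; first by rewrite mulr_ge0// ltW.
  have [cc _] := uc.
  rewrite dual_subE !dc_el//.
  have -> : (fun t => f t * (c t)%:C) = (fun t => ((1 - k t) * c t)%:C * u t).
    by apply/funext => t; rewrite /f rmorphM; ring.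
  have -> : (fun t => g t * (c t)%:C) = (fun t => (k t * c t)%:C * u' t).
    by apply/funext => t; rewrite /g rmorphM; ring.
  have h1 := uP _ (unit_funM uck uc); have h2 := uP' _ (unit_funM uk uc).
  have h3 := kP _ uc; move: h1 h2 h3.
  set z1 := phi _; set z2 := y _; set t1 := tv _ _; set t2 := tv _ _ => h1 h2 h3.
  have -> : z1 - z2 = (z1 - t1%:C) - (z2 - t2%:C) + (t1 - t2)%:C.
    by rewrite rmorphB; ring.
  apply: le_trans (ler_rnormD _ _) _; rewrite rnormC.
  apply: le_trans (lerD (ler_rnormB _ _) (lexx _)) _; lra.
have Fth : bidact F th = dc phi f.
  rewrite /th bidactB !bidact_dc Fphi Fy.
  suff -> : dc 0 g = 0 by rewrite subr0.
  exact: dual_ext.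
have h1 : rnorm (dc phi f) <= K * (12 * d).
  rewrite -Fth; have [_ _ _] := module_map_bidact j F.
  have : rnorm (bidact F th) <= rnorm F * rnorm th.
    by rewrite -rnormP rmorphM /= -!normE; exact: bidact_norm.
  move/le_trans; apply; apply: ler_wpM2l => //.
  by apply: le_trans thle _; rewrite mulrA -natrM.
have h2 : rnorm (phi (el f)) <= K * (12 * d).
  have := eval_le j (dc phi f) ler01 (@ccont_cst R X 1) (fun t => _).
  rewrite mulr1 dc_el//; last exact: ccont_cst.
  have -> : (fun t => f t * 1) = f by apply/funext => t; rewrite mulr1.
  move=> h; apply: le_trans (h _) h1 => t; by rewrite rnorm1.
have h3 := uP _ uck; have h4 := kP _ unit_fun1.
have e1 : tv phi (fun t => 1 - k t) <= 12 * K * d + d.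
  have := ler_rnormBD ((tv phi (fun t => 1 - k t))%:C : R[i]) (phi (el f)).
  rewrite rnormC_ge0 ?tv_ge0// rdistC; move: h3; rewrite -/f.
  by move: h2; set a := rnorm _; set b := rnorm (_ - _); set r := tv _ _; lra.
exists k; split => //; first by rewrite ed; move: e1 d0; nra.
move: h4.
have -> : (fun t => (1 - k t) * 1) = (fun t => 1 - k t).
  by apply/funext => t; rewrite mulr1.
have -> : (fun t => k t * 1) = k by apply/funext => t; rewrite mulr1.
rewrite ler_norml => /andP[h4 _]; rewrite ed; move: h4 e1 d0.
by set r := tv _ _; set r' := tv _ _; lra.
Qed.

End separation.

(** * Central supports, absolute continuity and orthogonality of functionals *)

Section central_support.
Context {R : realType} {X : topologicalType} {A : cstarType R}.
Variable j : function_rep A X.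
Implicit Types (phi psi v y : dual A) (F z : dual (dual A)).

Lemma bidact_arens E F psi : bidact (arens E F) psi = bidact E (bidact F psi).
Proof.
apply: dual_ext => a; rewrite -[LHS]/(E (bidact F (dact psi a))).
rewrite -[RHS]/(E (dact (bidact F psi) a)); congr (dual_fun E _).
apply: dual_ext => b /=; congr (dual_fun F _); apply: dual_ext => d /=.
by rewrite cmulA.
Qed.

(* phi and phi0 are mutually absolutely continuous. *)
Record equivalent (phi0 phi : dual A) := Equivalent {
  equiv_ge0 : forall k, rc k -> (forall t, 0 <= k t) -> 0 <= mass j phi0 k;
  equiv_ac : ac j phi0 phi;
  equiv_dom : exists2 C : R, 0 < C &
    forall k, unit_fun k -> mass j phi0 k <= C * tv j phi k }.

Section support.
Variables (phi0 phi : dual A).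
Hypothesis pq : equivalent phi0 phi.
Let pos := equiv_ge0 pq.
Local Notation z0 := (zac pos).

(** This gives minimality of [zac]. The defect [y = v - z v] is absolutely continuous and killed by
    [z], so some [k] makes [|y|(k)] and [|phi|(1 - k)] small; the latter bounds the mass of [1 - k],
    which makes [|y|(1 - k)] small as well. *)
Lemma support_fixes z v : bidact z phi = phi -> arens z z = z -> ac j phi0 v ->
  bidact z v = v.
Proof.
move=> zphi zz av; pose y := v - bidact z v.
have ay : ac j phi0 y.
  rewrite /y -scaleN1r; apply: acD => //; apply: ac_map; first exact: module_mapZ.
  exact: ac_map (module_map_bidact j z) av.
have zy : bidact z y = 0 by rewrite /y (bidactB j) -bidact_arens zz subrr.
suff : y = 0 by move/subr0_eq.
apply: rnorm_small => e e0; have e2 : 0 < e / 2 by rewrite divr_gt0.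
have [d d0 dy] := ay _ e2; have [C C0 CP] := equiv_dom pq.
have m0 : 0 < Num.min (e / 2) (d / C) by rewrite lt_min e2 divr_gt0.
have [k [uk]] := separate j zphi zy m0; rewrite !le_min => /andP[_ kd] /andP[ke _].
rewrite (tv_split j y uk) [e]splitr; apply: lerD => //.
have uck := unit_funC uk; apply: dy => //; apply: le_trans (CP _ uck) _.
by rewrite mulrC -ler_pdivlMr.
Qed.

Lemma central_support_zac : is_central_support phi z0.
Proof.
have [zz zs zC] := zac_central pos; split; first by split.
  exact/vanishes_off_zac/equiv_ac.
move=> z' cz' /(vanishes_offE _ cz') z'phi; have [z'z' _ z'C] := cz'.
apply: dual_ext => psi; rewrite -z'C arensE -(bidact_el1 j).
rewrite bidact_zac support_fixes//; exact: acp_ac.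
Qed.

(** Two central supports lie below each other, and centrality makes this order antisymmetric. *)
Lemma zsE : zs phi = z0.
Proof.
have cs := central_support_zac; rewrite /zs; case: xgetP => [z _|/(_ z0)//].
move=> [cz vz mz]; have [c0 v0 m0] := cs.
have h1 : arens z z0 = z := mz _ c0 v0.
have h2 : arens z0 z = z0 := m0 _ cz vz.
by case: cz => _ _ zC; rewrite -h1 zC h2.
Qed.

Lemma bidact_zs psi : ac_part j phi0 psi (bidact (zs phi) psi).
Proof. by rewrite zsE bidact_zac; exact: acpP. Qed.

Lemma zs_fixes psi : bidact (zs phi) psi = psi <-> ac j phi0 psi.
Proof.
rewrite zsE -(vanishes_off_zac pos); apply: iff_sym.
by apply: vanishes_offE; exact: zac_central.
Qed.

Lemma zs_commute F psi : bidact (zs phi) (bidact F psi) = bidact F (bidact (zs phi) psi).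
Proof.
by have [_ _ zC] := zac_central pos; rewrite zsE -!bidact_arens zC.
Qed.

Lemma zs_apply psi : zs phi psi = bidact (zs phi) psi (el j (fun=> 1)).
Proof. by rewrite bidact_el1. Qed.

Lemma zs_central : central_projection (zs phi) /\ vanishes_off phi (zs phi) /\
  forall z, central_projection z -> vanishes_off phi z -> proj_le (zs phi) z.
Proof. by rewrite zsE; case: central_support_zac. Qed.

End support.

Lemma functional_llE phi0 phi psi0 psi : equivalent phi0 phi -> equivalent psi0 psi ->
  functional_ll phi psi <-> ac j psi0 phi.
Proof.
move=> hp hq; rewrite /functional_ll /proj_le; split=> [h|ah].
  apply/(zs_fixes hq).
  have pp : bidact (zs phi) phi = phi by apply/(zs_fixes hp); exact: equiv_ac.
  by rewrite -{1}pp (zs_commute hq) -bidact_arens h.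
have [_ [_ m]] := zs_central hp; have [cq _] := zs_central hq.
by apply: m => //; apply/(vanishes_offE _ cq)/(zs_fixes hq).
Qed.

(** The two supports commute, so their product sends every functional to one fixed by both, that is,
    absolutely continuous with respect to both. *)
Lemma functional_perpE phi0 phi psi0 psi : equivalent phi0 phi -> equivalent psi0 psi ->
  functional_perp phi psi <-> forall v, ac j phi0 v -> ac j psi0 v -> v = 0.
Proof.
move=> hp hq; rewrite /functional_perp; split=> [h v /(zs_fixes hp) vp /(zs_fixes hq) vq|h].
  rewrite -vp -vq -bidact_arens h; exact: dual_ext.
apply: dual_ext => w; rewrite arensE (zs_apply phi).
rewrite [bidact _ _]h//.
  by apply/(zs_fixes hp); rewrite -bidact_arens; have [[-> _ _] _] := zs_central hp.
apply/(zs_fixes hq); rewrite (zs_commute hq) -(bidact_arens (zs psi)).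
by have [[-> _ _] _] := zs_central hq.
Qed.

(** In this form orthogonality supplies cut-offs of nearly full [psi0]-mass on which [phi] is small,
    the raw material for a separating set. *)
Lemma functional_perp_part phi0 phi psi0 psi : equivalent phi0 phi ->
  equivalent psi0 psi -> functional_perp phi psi -> ac_part j psi0 phi 0.
Proof.
move=> hp hq h; have := bidact_zs hq phi.
have pp : bidact (zs phi) phi = phi by apply/(zs_fixes hp); exact: equiv_ac.
suff -> : bidact (zs psi) phi = 0 by [].
rewrite -{1}pp (zs_commute hq) -bidact_arens h; exact: dual_ext.
Qed.

End central_support.

(** * Complex Borel measures *)

Section integration.
Context {R : realType} {G : topologicalZmodType}.
Hypothesis cptG : compact [set: G].
Implicit Types (k f : G -> R) (l : {finite_measure set (borel G) -> \bar R}).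

Lemma borel_open (U : set G) : open U -> measurable (U : set (borel G)).
Proof. by move=> oU; exact: sub_sigma_algebra. Qed.

Lemma borel_closed (U : set G) : closed U -> measurable (U : set (borel G)).
Proof.
move=> cU; rewrite -[U]setCK; apply: measurableC; apply: borel_open.
exact: closed_openC.
Qed.

Lemma rc_preimage_open k (U : set R) : rc k -> open U -> open (k @^-1` U).
Proof. by move=> /ccont_real ck oU; apply: open_comp => // x _; exact: ck. Qed.

Lemma rc_measurable k : rc k -> measurable_fun setT (k : borel G -> R).
Proof.
move=> ck; apply: (measurability _ (measurable_realfun.RGenOInfty.measurableE R)) => _ [_ [a ->]] <-.
by rewrite setTI; apply: borel_open; apply: rc_preimage_open => //; exact: interval_open.
Qed.

Lemma rc_integrable l k : rc k -> l.-integrable setT (EFin \o (k : borel G -> R)).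
Proof.
move=> ck; apply: measurable_bounded_integrable => //.
- by rewrite -ge0_fin_numE// fin_num_measure.
- exact: rc_measurable.
- have [M M0 kM] := ccont_bounded cptG ck.
  exists M; split; first exact: num_real.
  by move=> r Mr x _; rewrite /= -rnormC (le_trans (kM x))// ltW.
Qed.

Definition ri l k : R := Rintegral l setT (k : borel G -> R).

Lemma riD l k f : rc k -> rc f -> ri l (fun t => k t + f t) = ri l k + ri l f.
Proof. by move=> ck cf; apply: RintegralD => //; exact: rc_integrable. Qed.

Lemma riB l k f : rc k -> rc f -> ri l (fun t => k t - f t) = ri l k - ri l f.
Proof. by move=> ck cf; apply: RintegralB => //; exact: rc_integrable. Qed.

Lemma riZ l c k : rc k -> ri l (fun t => c * k t) = c * ri l k.
Proof. by move=> ck; apply: RintegralZl => //; exact: rc_integrable. Qed.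

Lemma ri_ge0 l k : (forall t, 0 <= k t) -> 0 <= ri l k.
Proof. by move=> k0; apply: Rintegral_ge0 => t _; exact: k0. Qed.

Lemma ri_mono l k f : rc k -> rc f -> (forall t, k t <= f t) -> ri l k <= ri l f.
Proof. by move=> ck cf kf; apply: le_Rintegral => //; exact: rc_integrable. Qed.

Lemma ri_norm l k : rc k -> `|ri l k| <= ri l (fun t => `|k t|).
Proof. by move=> ck; apply: le_normr_Rintegral => //; exact: rc_integrable. Qed.

Definition size_of l (B : set G) : R := fine (l B).

Lemma size_ofE l (B : set G) : measurable (B : set (borel G)) -> l B = (size_of l B)%:E.
Proof. by move=> mB; rewrite fineK// fin_num_measure. Qed.

Lemma size_of_ge0 l (B : set G) : 0 <= size_of l B.
Proof. by rewrite fine_ge0. Qed.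

Lemma size_of_mono l (B C : set G) : measurable (B : set (borel G)) ->
  measurable (C : set (borel G)) -> B `<=` C -> size_of l B <= size_of l C.
Proof. by move=> mB mC BC; rewrite -lee_fin -!size_ofE// le_measure ?inE. Qed.

Let indic_int l (B : set G) (a b : R) : measurable (B : set (borel G)) ->
  l.-integrable setT (EFin \o (fun t : borel G => a + b * \1_B t)) /\
  Rintegral l setT (fun t : borel G => a + b * \1_B t) = a * size_of l setT + b * size_of l B.
Proof.
move=> mB; have ic : l.-integrable setT (EFin \o cst a) by exact: finite_measure_integrable_cst.
have ii := integrable_indic l mB.
have iz : l.-integrable setT (EFin \o (fun t => b * \1_B t)).
  by under [_ \o _]eq_fun do rewrite /= EFinM; exact: integrableZl.
split; first by under [_ \o _]eq_fun do rewrite /= EFinD; exact: integrableD.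
rewrite RintegralD// Rintegral_cst// RintegralZl//; congr (_ + _ * _).
by rewrite /Rintegral integral_indic// setIT.
Qed.

(** Chebyshev's inequality. *)
Lemma ri_lower l k (B : set G) (s : R) : measurable (B : set (borel G)) -> rc k ->
  (forall t, 0 <= k t) -> (forall t, B t -> s <= k t) -> s * size_of l B <= ri l k.
Proof.
move=> mB ck k0 sk; have [ii] := indic_int l 0 s mB.
rewrite mul0r add0r => <-.
apply: le_Rintegral => //; first exact: rc_integrable.
move=> t _; rewrite indicE add0r; case: (boolP (t \in B)) => [|_].
  by rewrite inE mulr1; exact: sk.
by rewrite mulr0.
Qed.

Lemma ri_upper l k (B : set G) (s : R) : measurable (B : set (borel G)) -> unit_fun k ->
  0 <= s -> (forall t, ~ B t -> k t <= s) -> ri l k <= s * size_of l setT + size_of l B.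
Proof.
move=> mB uk s0 ks; have [ii] := indic_int l s 1 mB; rewrite mul1r => <-.
apply: le_Rintegral => //; first by apply: rc_integrable; case: uk.
move=> t _; rewrite indicE mul1r; case: (boolP (t \in B)) => [_|].
  by rewrite (le_trans (unit_fun_le1 t uk))// lerDr.
by rewrite notin_setE addr0; exact: ks.
Qed.

Lemma ri_cst l c : ri l (fun=> c) = c * size_of l setT.
Proof. exact: Rintegral_cst. Qed.

End integration.

(** * The variation measure of a complex measure *)

Section variation.
Context d {T : measurableType d} {R : realType}.
Implicit Types (mu : cmeasure T R) (nu : {charge set T -> \bar R}) (B E : set T).
Local Open Scope ereal_scope.

Definition jpos nu := jordan_pos (svalP (hahn_ex nu)).
Definition jneg nu := jordan_neg (svalP (hahn_ex nu)).

HB.instance Definition _ nu := FiniteMeasure.on (jpos nu).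
HB.instance Definition _ nu := FiniteMeasure.on (jneg nu).

Lemma jpos_le nu E (c : R) : measurable E ->
  (forall B, measurable B -> B `<=` E -> `|nu B| <= c%:E) -> jpos nu E <= c%:E.
Proof.
move=> mE h; rewrite /jpos jordan_posE cjordan_posE /crestr0 mem_set// /crestr.
have mP : measurable (sval (hahn_ex nu)).1 by have [[]] := svalP (hahn_ex nu).
by apply: le_trans (lee_abs _) _; apply: h; [exact: measurableI|exact: subIsetl].
Qed.

Lemma jneg_le nu E (c : R) : measurable E ->
  (forall B, measurable B -> B `<=` E -> `|nu B| <= c%:E) -> jneg nu E <= c%:E.
Proof.
move=> mE h; rewrite /jneg jordan_negE cjordan_negE /crestr0 mem_set// /crestr.
have mP : measurable (sval (hahn_ex nu)).2 by have [_ []] := svalP (hahn_ex nu).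
apply: le_trans (lee_abs _) _; rewrite abseN.
by apply: h; [exact: measurableI|exact: subIsetl].
Qed.

Lemma jneg_pos0 nu : jneg nu (sval (hahn_ex nu)).1 = 0.
Proof.
rewrite /jneg; have [[mP _] _ _ PN] := svalP (hahn_ex nu).
by rewrite jordan_negE cjordan_negE /crestr0 mem_set// /crestr PN charge0 oppe0.
Qed.

Lemma jpos_neg0 nu : jpos nu (~` (sval (hahn_ex nu)).1) = 0.
Proof.
rewrite /jpos; have [[mP _] _ _ _] := svalP (hahn_ex nu).
rewrite jordan_posE cjordan_posE /crestr0 mem_set; last exact: measurableC.
by rewrite /crestr setIC setICr charge0.
Qed.

Definition finite_add (l l' : {finite_measure set T -> \bar R}) := measure_add l l'.

HB.instance Definition _ l l' := Measure.on (finite_add l l').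

Let finite_add_fin l l' : fin_num_fun (finite_add l l').
Proof. by move=> B mB; rewrite /finite_add measure_addE fin_numD !fin_num_measure. Qed.

HB.instance Definition _ l l' :=
  @Measure_isFinite.Build _ _ _ (finite_add l l') (@finite_add_fin l l').

(** A finite measure lying between the total variation and four times it, hence with the same null
    sets; measure theory can be applied to it directly. *)
Definition variation mu := finite_add
  (finite_add (jpos (cre mu)) (jneg (cre mu))) (finite_add (jpos (cim mu)) (jneg (cim mu))).

HB.instance Definition _ mu := FiniteMeasure.on (variation mu).

Lemma variationE mu B : variation mu B =
  (jpos (cre mu) B + jneg (cre mu) B) + (jpos (cim mu) B + jneg (cim mu) B).
Proof. by rewrite /variation /finite_add measure_addE; congr (_ + _); exact: measure_addE. Qed.

Lemma rnorm_le_variation mu B : measurable B -> (rnorm (mu B))%:E <= variation mu B.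
Proof.
move=> mB; apply: (@le_trans _ _ (`|cre mu B| + `|cim mu B|)).
  by rewrite /cre /cim /= -EFinD lee_fin; exact: rnorm_le_ReIm.
rewrite variationE; apply: leeD.
  exact: (abse_charge_variation (svalP (hahn_ex (cre mu)))).
exact: (abse_charge_variation (svalP (hahn_ex (cim mu)))).
Qed.

Lemma variation_le mu E (c : R) : measurable E ->
  (forall B, measurable B -> B `<=` E -> (rnorm (mu B) <= c)%R) ->
  variation mu E <= (4 * c)%:E.
Proof.
move=> mE h; rewrite variationE.
have -> : (4 * c)%:E = (c%:E + c%:E) + (c%:E + c%:E) by rewrite -!EFinD; congr EFin; ring.
have hr B : measurable B -> B `<=` E -> `|cre mu B| <= c%:E.
  by move=> mB BE; rewrite lee_fin (le_trans (normRe_le _))// h.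
have hi B : measurable B -> B `<=` E -> `|cim mu B| <= c%:E.
  by move=> mB BE; rewrite lee_fin (le_trans (normIm_le _))// h.
by rewrite !leeD// ?jpos_le ?jneg_le.
Qed.

Let term_ge0 mu (F : (set T)^nat) n : 0 <= (Re `|mu (F n)|)%:E.
Proof. by rewrite lee_fin; exact: (rnorm_ge0 (mu (F n))). Qed.

(** Prepend [B] to any partition of [E]. This superadditivity is enough to compare the total
    variation with [variation]. *)
Lemma total_variationU mu E B : measurable B -> E `&` B = set0 ->
  total_variation mu E + (rnorm (mu B))%:E <= total_variation mu (E `|` B).
Proof.
move=> mB EB; rewrite -leeBrDr//; apply: ge_ereal_sup => _ [F [mF tF UF] <-].
rewrite leeBrDr//; apply: ereal_sup_ubound.
pose F' n := if n is n'.+1 then F n' else B.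
have FB n : F n `&` B = set0.
  by apply: subsetI_eq0 EB => //; rewrite -UF; exact: bigcup_sup.
exists F'; first split.
- by case.
- apply/trivIsetP => -[|i] [|k] // _ _ ik; rewrite /F'.
  + by rewrite setIC.
  + exact: FB.
  + by move/trivIsetP : tF; apply.
- rewrite -UF setUC; apply/seteqP; split=> [x [[|n] _ Fx]|x [Bx|[n _ Fx]]].
  + by left.
  + by right; exists n.
  + by exists 0%N.
  + by exists n.+1.
rewrite nneseries_recl => [|n _|//]; last exact: term_ge0.
rewrite addeC; congr (_ + _); rewrite -(@nneseries_addn _ _ 1) => [|n]; last exact: term_ge0.
by apply: eq_eseriesr => n _; rewrite addn1.
Qed.

Lemma total_variation_ge0 mu E : measurable E -> 0 <= total_variation mu E.
Proof.
move=> mE; apply: le_trans (ereal_sup_ubound _); last first.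
  exists (fun n => if n is 0%N then E else set0) => //; split.
  - by case.
  - by apply/trivIsetP => -[|i] [|k] // _ _ _; rewrite ?setI0 ?set0I.
  - by apply/seteqP; split=> [x [[|n] _]|x Ex] //; exists 0%N.
apply: nneseries_ge0 => n _ _.
exact: (@term_ge0 mu (fun n => if n is 0%N then E else set0)).
Qed.

Lemma total_variation_mono mu E B : measurable E -> measurable B -> E `<=` B ->
  total_variation mu E <= total_variation mu B.
Proof.
move=> mE mB EB; rewrite -[X in _ <= total_variation mu X](setDUK EB).
apply: le_trans (total_variationU _ _ _); last 2 first.
- exact: measurableD.
- by rewrite setDE setICA setICr setI0.
by rewrite leeDl// lee_fin rnorm_ge0.
Qed.

Lemma total_variationI mu E B U : measurable E -> measurable B -> measurable U ->
  E `<=` U -> B `<=` U -> E `&` B = set0 ->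
  total_variation mu E + (rnorm (mu B))%:E <= total_variation mu U.
Proof.
move=> mE mB mU EU BU EB; apply: le_trans (total_variationU _ mB EB) _.
by apply: total_variation_mono; [exact: measurableU| |rewrite subUset].
Qed.

Lemma total_variation_le mu E : measurable E -> total_variation mu E <= variation mu E.
Proof.
move=> mE; apply: ge_ereal_sup => _ [F [mF tF <-] <-].
rewrite measure_bigcup// eseries_mkcond [leRHS]eseries_mkcond.
apply: lee_nneseries => [n _ _|n _]; first exact: term_ge0.
by rewrite mem_setT; exact: rnorm_le_variation.
Qed.

Lemma total_variation_fin mu E : measurable E -> total_variation mu E \is a fin_num.
Proof.
move=> mE; rewrite ge0_fin_numE ?total_variation_ge0//.
rewrite (le_lt_trans (total_variation_le _ _))// -ge0_fin_numE//.
exact: fin_num_measure.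
Qed.

(** By superadditivity each measurable part [B] of the gap has [rnorm (mu B) <= e]; the four Jordan
    parts account for the factor 4. *)
Lemma variation_diff mu E U (e : R) : measurable E -> measurable U -> E `<=` U ->
  total_variation mu U <= total_variation mu E + e%:E -> variation mu (U `\` E) <= (4 * e)%:E.
Proof.
move=> mE mU EU h; apply: variation_le => [|B mB BUE]; first exact: measurableD.
have : total_variation mu E + (rnorm (mu B))%:E <= total_variation mu U.
  apply: total_variationI => //; first by move=> x /BUE[].
  by rewrite -subset0 => x [Ex /BUE[]].
move=> /le_trans/(_ h); rewrite -(fineK (total_variation_fin mu mE)) -!EFinD !lee_fin.
by rewrite lerD2l.
Qed.

Lemma total_variation_eq0 mu E : measurable E ->
  total_variation mu E = 0 <-> variation mu E = 0.
Proof.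
move=> mE; split=> h; apply/eqP; rewrite eq_le ?measure_ge0 ?total_variation_ge0// andbT.
  have := @variation_diff mu set0 E 0 measurable0 mE (@sub0set _ _).
  by rewrite setD0 mulr0; apply; rewrite h adde0 total_variation_ge0.
by rewrite -h total_variation_le.
Qed.

Lemma variation_eq0_sub mu E B : measurable E -> measurable B -> B `<=` E ->
  variation mu E = 0 -> variation mu B = 0.
Proof.
move=> mE mB BE h; apply/eqP; rewrite eq_le measure_ge0 andbT -h.
by rewrite le_measure ?inE.
Qed.

Lemma absolutely_continuousE (mu nu : cmeasure T R) : absolutely_continuous mu nu <->
  forall E, measurable E -> variation nu E = 0 -> variation mu E = 0.
Proof.
split=> [h E mE nuE|h N nuN B mB BN]; last first.
  by apply/total_variation_eq0 => //; apply: h => //; apply/total_variation_eq0/nuN.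
apply/total_variation_eq0 => //; apply: (h E _ E mE) => // B mB BE.
by apply/total_variation_eq0 => //; exact: variation_eq0_sub nuE.
Qed.

Lemma mutually_singularE (mu nu : cmeasure T R) : mutually_singular mu nu <->
  exists E, [/\ measurable E, variation mu E = 0 & variation nu (~` E) = 0].
Proof.
split=> -[E [mE a b]]; exists E; split=> //; have mC := measurableC mE.
- exact/total_variation_eq0.
- exact/total_variation_eq0.
- exact/total_variation_eq0.
- exact/total_variation_eq0.
Qed.

End variation.

Section regularity.
Context {R : realType} {G : topologicalZmodType}.
Hypotheses (cptG : compact [set: G]) (hausG : hausdorff_space G).
Implicit Types (mu : cmeasure (borel G) R).

Lemma regular_sandwich mu (E : set (borel G)) (e : R) : regular mu -> measurable E -> 0 < e ->
  exists K U : set G, [/\ closed K, open U, K `<=` E, E `<=` U &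
    (variation mu (U `\` K) <= e%:E)%E].
Proof.
(* There are two gaps, [U] minus [E] and [E] minus [K], each enlarged by the factor 4 of
   [variation_diff]. *)
move=> reg mE e0; have e8 : 0 < e / 8 by rewrite divr_gt0.
have [outer inner] := reg E mE; have finE := total_variation_fin mu mE.
have /(lb_ereal_inf_adherent e8)[_ [U [oU EU] <-]] : ereal_inf [set total_variation mu U | U in
    [set U | open (U : set G) /\ E `<=` U]] \is a fin_num by rewrite -outer.
rewrite -outer => /ltW hU.
have /(ub_ereal_sup_adherent e8)[_ [K [cK KE] <-]] : ereal_sup [set total_variation mu K | K in
    [set K | compact (K : set G) /\ K `<=` E]] \is a fin_num by rewrite -inner.
rewrite -inner => /ltW hK.
have clK : closed K := compact_closed hausG cK.
have mK := borel_closed clK; have mU := borel_open oU.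
exists K, U; split=> //.
have -> : U `\` K = (U `\` E) `|` (E `\` K).
  apply/seteqP; split=> [x [Ux Kx]|x [[Ux Ex]|[Ex Kx]]].
  - by have [Ex|Ex] := pselect (E x); [right|left].
  - by split=> // /KE.
  - by split=> //; exact: EU.
have h1 := variation_diff mE mU EU hU.
have h2 : (variation mu (E `\` K) <= (4 * (e / 8))%:E)%E.
  by apply: variation_diff => //; rewrite -leeBlDr.
have -> : e = 4 * (e / 8) + 4 * (e / 8) by field.
apply: le_trans (measureU2 _ _ _) _; [exact: measurableD|exact: measurableD|].
by rewrite EFinD leeD.
Qed.

(* Urysohn functions squeezed between a closed and an open approximation. *)
Lemma lusin mu1 mu2 (E : set (borel G)) (e : R) : regular mu1 -> regular mu2 ->
  measurable E -> 0 < e -> exists2 w : G -> R, unit_fun w &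
    forall l : {finite_measure set (borel G) -> \bar R},
      (forall B, measurable B -> (l B <= variation mu1 B)%E) \/
      (forall B, measurable B -> (l B <= variation mu2 B)%E) ->
    `|ri l w - size_of l E| <= e.
Proof.
move=> reg1 reg2 mE e0.
have [K1 [U1 [cK1 oU1 KE1 EU1 h1]]] := regular_sandwich reg1 mE e0.
have [K2 [U2 [cK2 oU2 KE2 EU2 h2]]] := regular_sandwich reg2 mE e0.
have cK : closed (K1 `|` K2) by exact: closedU.
have oU : open (U1 `&` U2) by exact: openI.
have KE : K1 `|` K2 `<=` E by rewrite subUset.
have EU : E `<=` U1 `&` U2 by rewrite subsetI.
have [|w [cw w01 w0 w1]] := ccont_urysohn (R := R) cptG hausG (open_closedC oU) cK.
  by rewrite -subset0 => x [/= nU /KE/EU].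
have uw : unit_fun w by [].
exists w => // l hl.
have mK := borel_closed cK; have mU := borel_open oU.
have lo : size_of l (K1 `|` K2) <= ri l w.
  have := @ri_lower _ _ cptG l w (K1 `|` K2) 1 mK cw; rewrite mul1r; apply=> t.
    exact: unit_fun_ge0.
  by move=> Kt; rewrite w1.
have hi : ri l w <= size_of l (U1 `&` U2).
  have := @ri_upper _ _ cptG l w (U1 `&` U2) 0 mU uw (lexx _); rewrite mul0r add0r; apply.
  by move=> t nt; rewrite w0.
have lo' : size_of l (K1 `|` K2) <= size_of l E by exact: size_of_mono.
have hi' : size_of l E <= size_of l (U1 `&` U2) by exact: size_of_mono.
have mD : measurable ((U1 `&` U2) `\` (K1 `|` K2) : set (borel G)) by exact: measurableD.
have dl : size_of l (U1 `&` U2) <= size_of l (K1 `|` K2) + e.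
  have KU : K1 `|` K2 `<=` U1 `&` U2 by apply: subset_trans KE EU.
  rewrite -lee_fin EFinD -!size_ofE// -[in X in (X <= _)%E](setDUK KU).
  apply: le_trans (measureU2 _ mK mD) _; rewrite leeD2l//.
  case: hl => hl; apply: le_trans (hl _ mD) _.
  - apply: le_trans h1; apply: le_measure; rewrite ?inE//.
      exact: measurableD (borel_open oU1) (borel_closed cK1).
    by move=> x [[Ux _] nK]; split=> // Kx; apply: nK; left.
  - apply: le_trans h2; apply: le_measure; rewrite ?inE//.
      exact: measurableD (borel_open oU2) (borel_closed cK2).
    by move=> x [[_ Ux] nK]; split=> // Kx; apply: nK; right.
by rewrite ler_norml; apply/andP; split; lra.
Qed.

Lemma ri_add (l l' : {finite_measure set (borel G) -> \bar R}) k : rc k ->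
  ri (finite_add l l') k = ri l k + ri l' k.
Proof.
move=> ck; have i1 := rc_integrable cptG l ck; have i2 := rc_integrable cptG l' ck.
have mk := measurable_int _ i1; rewrite /ri /Rintegral integral_measure_add//.
by rewrite fineD//; exact: integrable_fin_num.
Qed.

Lemma ri_variation mu k : rc k -> ri (variation mu) k =
  (ri (jpos (cre mu)) k + ri (jneg (cre mu)) k) +
  (ri (jpos (cim mu)) k + ri (jneg (cim mu)) k).
Proof.
move=> ck; transitivity (ri (finite_add (jpos (cre mu)) (jneg (cre mu))) k +
    ri (finite_add (jpos (cim mu)) (jneg (cim mu))) k); first exact: ri_add.
by rewrite !ri_add.
Qed.

End regularity.

(** * The functional of integration against a complex measure *)

Section measure_functional.
Context {R : realType} {G : topologicalZmodType} {A : cstarType R}.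
Hypotheses (cptG : compact [set: G]) (hausG : hausdorff_space G).
Variable j : function_rep A G.
Implicit Types (mu : cmeasure (borel G) R) (l : {finite_measure set (borel G) -> \bar R}).
Implicit Types (f g : G -> R[i]) (k w : G -> R).

Local Notation re k := (fun t => (k t)%:C).

Definition cint l f : R[i] := ri l (@complex.Re R \o f) +i* ri l (@complex.Im R \o f).

Lemma cintD l f g : ccont f -> ccont g -> cint l (fun t => f t + g t) = cint l f + cint l g.
Proof.
move=> cf cg; rewrite /cint -[RHS]/(_ +i* _) -!riD//;
  [|exact: ccont_Im|exact: ccont_Im|exact: ccont_Re|exact: ccont_Re].
by congr (_ +i* _); congr ri; apply/funext => t /=; case: (f t); case: (g t).
Qed.

Lemma cintZ l (c : R[i]) f : ccont f -> cint l (fun t => c * f t) = c * cint l f.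
Proof.
move=> cf; have cr := ccont_Re cf; have ci := ccont_Im cf; case: c => a b.
have rz (e : R) k : rc k -> rc (fun t => e * k t) by move=> ck; apply: rcM => //; exact: rc_cst.
rewrite /cint -[RHS]/(_ +i* _) -!riZ// -riB -?riD//; try exact: rz.
by congr (_ +i* _); congr ri; apply/funext => t /=; case: (f t).
Qed.

Lemma rnorm_cint l f k : ccont f -> rc k -> (forall t, rnorm (f t) <= k t) ->
  rnorm (cint l f) <= 2 * ri l k.
Proof.
move=> cf ck fk; rewrite mulr2n mulrDl mul1r; apply: le_trans (rnorm_le_ReIm _) _.
have cr : rc (@complex.Re R \o f) := ccont_Re cf; have ci : rc (@complex.Im R \o f) := ccont_Im cf.
rewrite /=; apply: lerD; (apply: le_trans (ri_norm cptG _ _) _; first by []);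
  apply: ri_mono => //; try exact: rc_norm; move=> t; apply: le_trans (fk t).
  exact: normRe_le.
exact: normIm_le.
Qed.

Definition integration_form l : dual A.
Proof.
refine (@rmkdual R A (fun a => cint l (j a)) _ _).
- move=> c a b; rewrite -cintZ -?cintD; try exact: fval_cont.
  + by congr cint; apply/funext => t; rewrite fvalD fvalZ.
  + by apply: ccontM; [exact: ccont_cst|exact: fval_cont].
- exists (2 * size_of l setT); first by rewrite mulr_ge0// size_of_ge0.
  move=> a; rewrite -mulrA [size_of _ _ * _]mulrC -(ri_cst l); apply: rnorm_cint.
  + exact: fval_cont.
  + exact: rc_cst.
  + by move=> t; exact: fval_le.
Defined.

Lemma integration_formE l a : integration_form l a = cint l (j a).
Proof. by []. Qed.

Lemma mass_integration_form l k : rc k -> mass j (integration_form l) k = ri l k.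
Proof.
move=> ck; rewrite /mass integration_formE /=.
by congr ri; apply/funext => t /=; rewrite elE.
Qed.

Definition measure_functional mu : dual A :=
  (integration_form (jpos (cre mu)) - integration_form (jneg (cre mu))) +
  (0 +i* 1) *: (integration_form (jpos (cim mu)) - integration_form (jneg (cim mu))).

Lemma measure_functionalE mu a : measure_functional mu a = cintegral mu (j a).
Proof.
rewrite /measure_functional dual_addE dual_scaleE !dual_subE !integration_formE /cint.
rewrite /cintegral /charge_integral.
by apply/eqP; rewrite eq_complex /= !mul0r !mul1r sub0r add0r /ri; apply/andP; split; apply/eqP.
Qed.

Lemma measure_functional_real mu k : rc k ->
  Re (measure_functional mu (el j (re k))) = ri (jpos (cre mu)) k - ri (jneg (cre mu)) k /\
  Im (measure_functional mu (el j (re k))) = ri (jpos (cim mu)) k - ri (jneg (cim mu)) k.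
Proof.
move=> ck; rewrite /measure_functional dual_addE dual_scaleE !dual_subE !integration_formE /cint.
have -> : @complex.Re R \o j (el j (re k)) = k by apply/funext => t /=; rewrite elE.
have -> : @complex.Im R \o j (el j (re k)) = fun=> 0 by apply/funext => t /=; rewrite elE.
have z l : ri l (fun=> 0 : R) = 0 by rewrite ri_cst mul0r.
by split=> /=; rewrite !z; ring.
Qed.

Lemma rnorm_measure_functional mu a k : rc k -> (forall t, rnorm (j a t) <= k t) ->
  rnorm (measure_functional mu a) <= 2 * ri (variation mu) k.
Proof.
move=> ck ak; rewrite (ri_variation cptG)// /measure_functional dual_addE dual_scaleE !dual_subE.
have h l : rnorm (integration_form l a) <= 2 * ri l k by apply: rnorm_cint => //; exact: fval_cont.
apply: le_trans (ler_rnormD _ _) _; rewrite rnormM.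
have -> : rnorm ((0 +i* 1) : R[i]) = 1 by rewrite /rnorm normc_def /= expr0n add0r expr1n sqrtr1.
rewrite mul1r mulrDr !mulrDr.
by apply: lerD; apply: le_trans (ler_rnormB _ _) _; apply: lerD.
Qed.

Let sign_arith (p n pc pb nb nw pw s e : R) : p - 2 * pc <= pb -> nb + n <= 2 * nw ->
  pc = s - pw -> `|pw - s| <= e / 4 -> `|nw| <= e / 4 -> p + n <= pb - nb + e.
Proof. by rewrite !ler_norml => ? ? ? /andP[? ?] /andP[? ?]; lra. Qed.

(** [b = 2 w - 1] is a continuous approximation of the Hahn sign of [nu], [w] approximating the
    indicator of the positive set for both Jordan parts. *)
Lemma charge_sign mu (nu : {charge set (borel G) -> \bar R}) (e : R) : regular mu ->
  (forall B, measurable B -> (jpos nu B <= variation mu B)%E) ->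
  (forall B, measurable B -> (jneg nu B <= variation mu B)%E) -> 0 < e ->
  exists b : G -> R, [/\ rc b, forall t, `|b t| <= 1 & forall k, unit_fun k ->
    ri (jpos nu) k + ri (jneg nu) k <=
    ri (jpos nu) (fun t => k t * b t) - ri (jneg nu) (fun t => k t * b t) + e].
Proof.
move=> reg hp hn e0; have e4 : 0 < e / 4 by rewrite divr_gt0.
have mP : measurable (sval (hahn_ex nu)).1 by have [[]] := svalP (hahn_ex nu).
have [w uw wl] := lusin cptG hausG reg reg mP e4.
have := wl (jpos nu) (or_introl hp); have := wl (jneg nu) (or_introl hn).
have -> : size_of (jneg nu) (sval (hahn_ex nu)).1 = 0 by exact: (congr1 fine (jneg_pos0 nu)).
rewrite subr0 => wn wp; have [cw w01] := uw.
have sP : size_of (jpos nu) setT = size_of (jpos nu) (sval (hahn_ex nu)).1.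
  rewrite /size_of -(setvU (sval (hahn_ex nu)).1) measureU//; last exact: setICl.
    by rewrite [X in (X + _)%E](jpos_neg0 nu) add0e.
  exact: measurableC.
have c2w : rc (fun t => 2 * w t) by apply: rcM => //; exact: rc_cst.
exists (fun t => 2 * w t - 1); split=> [|t|k uk].
- by apply: rcB => //; exact: rc_cst.
- by have := w01 t; rewrite ler_norml => /andP[? ?]; apply/andP; split; lra.
have [ck k01] := uk; have [cw1 _] := unit_funC uw.
have ckb : rc (fun t => k t * (2 * w t - 1)) by apply: rcM => //; apply: rcB => //; exact: rc_cst.
have c2 (h : G -> R) : rc h -> rc (fun t => 2 * h t) by move=> ch; apply: rcM => //; exact: rc_cst.
have lo : ri (jpos nu) k - 2 * ri (jpos nu) (fun t => 1 - w t) <=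
    ri (jpos nu) (fun t => k t * (2 * w t - 1)).
  rewrite -riZ// -riB//; last exact: c2.
  apply: ri_mono => //; first by apply: rcB => //; exact: c2.
  by move=> t; have := w01 t; have := k01 t => /andP[? ?] /andP[? ?]; nra.
have hi : ri (jneg nu) (fun t => k t * (2 * w t - 1)) + ri (jneg nu) k <= 2 * ri (jneg nu) w.
  rewrite -riZ// -riD//; apply: ri_mono => //; first exact: rcD.
  by move=> t; have := w01 t; have := k01 t => /andP[? ?] /andP[? ?]; nra.
have := riB cptG (jpos nu) (rc_cst (1 : R)) cw; rewrite ri_cst mul1r sP => p1.
exact: sign_arith lo hi p1 wp wn.
Qed.

(** Testing the functional on [k b], with [b] the approximate sign of the real or imaginary part,
    nearly recovers the integral of [k] against the variation of that part; [|b| <= 1] keeps the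
    test below [tv]. *)
Lemma jordan_le_tv mu k : regular mu -> unit_fun k ->
  ri (jpos (cre mu)) k + ri (jneg (cre mu)) k <= tv j (measure_functional mu) k /\
  ri (jpos (cim mu)) k + ri (jneg (cim mu)) k <= tv j (measure_functional mu) k.
Proof.
move=> reg uk; have [ck k01] := uk.
have vr B : (jpos (cre mu) B <= variation mu B)%E /\ (jneg (cre mu) B <= variation mu B)%E.
  by rewrite variationE; split; rewrite -addeA ?leeDl// ?adde_ge0// addeCA leeDl// ?adde_ge0.
have vi B : (jpos (cim mu) B <= variation mu B)%E /\ (jneg (cim mu) B <= variation mu B)%E.
  by rewrite variationE addeC; split; rewrite -addeA ?leeDl// ?adde_ge0// addeCA leeDl// ?adde_ge0.
have bound b : rc b -> (forall t, `|b t| <= 1) ->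
    rnorm (measure_functional mu (el j (re (fun t => k t * b t)))) <= tv j (measure_functional mu) k.
  move=> cb b1; have -> : re (fun t => k t * b t) = fun t => (k t)%:C * (b t)%:C.
    by apply/funext => t; rewrite rmorphM.
  by apply: eval_tv => // t; rewrite rnormC.
split; apply/ler_addgt0Pr => e e0.
- have [b [cb b1 kb]] := charge_sign reg (fun B _ => (vr B).1) (fun B _ => (vr B).2) e0.
  apply: le_trans (kb _ uk) _; rewrite lerD2r.
  have [<- _] := measure_functional_real mu (rcM ck cb).
  by apply: le_trans (bound b cb b1); apply: le_trans (normRe_le _); exact: ler_norm.
- have [b [cb b1 kb]] := charge_sign reg (fun B _ => (vi B).1) (fun B _ => (vi B).2) e0.
  apply: le_trans (kb _ uk) _; rewrite lerD2r.
  have [_ <-] := measure_functional_real mu (rcM ck cb).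
  by apply: le_trans (bound b cb b1); apply: le_trans (normIm_le _); exact: ler_norm.
Qed.

Lemma variation_le_tv mu k : regular mu -> unit_fun k ->
  ri (variation mu) k <= 2 * tv j (measure_functional mu) k.
Proof.
move=> reg uk; have [ck _] := uk; have [h1 h2] := jordan_le_tv reg uk.
by rewrite (ri_variation cptG)// mulr2n mulrDl mul1r lerD.
Qed.

Lemma tv_le_variation mu k : unit_fun k ->
  tv j (measure_functional mu) k <= 2 * ri (variation mu) k.
Proof.
move=> uk; have [ck k01] := uk.
have k0 : 0 <= 2 * ri (variation mu) k.
  by rewrite mulr_ge0// ri_ge0// => t; exact: unit_fun_ge0.
apply: rnorm_dual_le => // a; rewrite dcE -mulrA [ri _ _ * _]mulrC -(riZ cptG)//.
apply: rnorm_measure_functional => [|t]; first by apply: rcM => //; exact: rc_cst.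
rewrite fvalM elE// rnormM rnormC ger0_norm; last exact: unit_fun_ge0.
by rewrite mulrC ler_wpM2r// ?fval_le//; exact: unit_fun_ge0.
Qed.

Lemma measure_equivalent mu : regular mu ->
  equivalent j (integration_form (variation mu)) (measure_functional mu).
Proof.
move=> reg; split.
- by move=> k ck k0; rewrite mass_integration_form// ri_ge0.
- move=> eta eta0; exists (eta / 2); first by rewrite divr_gt0.
  move=> k uk; have [ck _] := uk; rewrite mass_integration_form// => h.
  by apply: le_trans (tv_le_variation _ uk) _; lra.
- exists 2 => // k uk; have [ck _] := uk; rewrite mass_integration_form//.
  exact: variation_le_tv.
Qed.

End measure_functional.

(** * From functionals back to measurable sets *)

Section dictionary.
Context {R : realType} {G : topologicalZmodType} {A : cstarType R}.
Hypotheses (cptG : compact [set: G]) (hausG : hausdorff_space G).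
Variable j : function_rep A G.
Variables (mu1 mu2 : cmeasure (borel G) R).
Hypotheses (reg1 : regular mu1) (reg2 : regular mu2).

Let V1 : {finite_measure set (borel G) -> \bar R} := variation mu1.
Let V2 : {finite_measure set (borel G) -> \bar R} := variation mu2.
Local Notation phi1 := (measure_functional cptG j mu1).
Local Notation phi2 := (measure_functional cptG j mu2).
Local Notation form l := (integration_form cptG j l).

Let equiv1 : equivalent j (form V1) phi1 := measure_equivalent cptG hausG j reg1.
Let equiv2 : equivalent j (form V2) phi2 := measure_equivalent cptG hausG j reg2.

Let approx (E : set (borel G)) (e : R) : measurable E -> 0 < e -> exists w : G -> R,
  [/\ unit_fun w, `|ri V1 w - size_of V1 E| <= e & `|ri V2 w - size_of V2 E| <= e].
Proof.
move=> mE e0; have [w uw wl] := lusin cptG hausG reg1 reg2 mE e0; exists w; split=> //.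
  by apply: wl; left.
by apply: wl; right.
Qed.

Let size_eq0 (V : {finite_measure set (borel G) -> \bar R}) (E : set (borel G)) :
  measurable E -> V E = 0%E <-> size_of V E = 0.
Proof. by move=> mE; rewrite (size_ofE V mE); split=> [[]|->]. Qed.

Let half_lt (x : R) : 0 < x -> x / 2 < x.
Proof. by move=> x0; lra. Qed.

Lemma rc_measurable_ge (k : G -> R) (s : R) : rc k ->
  measurable ([set t | s <= k t] : set (borel G)).
Proof.
move=> /ccont_real ck; apply: borel_closed.
have -> : [set t | s <= k t] = k @^-1` [set x | s <= x] by [].
by apply: preimage_closed => //; exact: closed_ge.
Qed.

Lemma variation_continuous : absolutely_continuous mu1 mu2 -> forall e : R, 0 < e ->
  exists2 d : R, 0 < d & forall E : set (borel G), measurable E ->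
    (V2 E < d%:E)%E -> (V1 E <= e%:E)%E.
Proof.
move=> /absolutely_continuousE ac e e0; have e2 : 0 < e / 2 by rewrite divr_gt0.
have dom1 E : measurable E -> V2 E = 0%E -> rnorm (mu1 E) <= 0.
  move=> mE V0; rewrite -lee_fin; apply: le_trans (rnorm_le_variation mu1 mE) _.
  by rewrite [X in (X <= _)%E](ac E mE V0).
have dr : cre mu1 `<< V2.
  apply/null_content_dominatesP => E mE V0; congr EFin; apply/eqP.
  by rewrite -normr_le0 (le_trans (normRe_le _))// dom1.
have di : cim mu1 `<< V2.
  apply/null_content_dominatesP => E mE V0; congr EFin; apply/eqP.
  by rewrite -normr_le0 (le_trans (normIm_le _))// dom1.
have [d1 [d10 h1]] := charge_variation_continuous (svalP (hahn_ex (cre mu1))) dr e2.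
have [d2 [d20 h2]] := charge_variation_continuous (svalP (hahn_ex (cim mu1))) di e2.
exists (Num.min d1 d2) => [|E mE Ed]; first by rewrite lt_min d10.
have Ed1 : (V2 E < d1%:E)%E by apply: lt_le_trans Ed _; rewrite lee_fin ge_min lexx.
have Ed2 : (V2 E < d2%:E)%E by apply: lt_le_trans Ed _; rewrite lee_fin ge_min lexx orbT.
rewrite [e]splitr EFinD [V1 _]variationE.
by apply: leeD; apply: ltW; [exact: h1|exact: h2].
Qed.

(** Forwards, split [k] at a level [s] and apply the epsilon-delta form of absolute continuity to
    the set where [k] is at least [s]. Backwards, replace a null set by a Urysohn function accurate
    for both measures. *)
Let ac_mass : absolutely_continuous mu1 mu2 <-> ac j (form V2) phi1.
Proof.
split=> [/variation_continuous h eta eta0|h].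
  have eta4 : 0 < eta / 4 by rewrite divr_gt0.
  have [d d0 hd] := h _ eta4; have T0 := size_of_ge0 V1 setT.
  (* Values of [k] below [s] contribute at most [eta / 4] and the set above it another [eta / 4];
     [tv_le_variation] doubles the sum. *)
  pose s := eta / 4 / (size_of V1 setT + 1).
  have s0 : 0 < s by rewrite divr_gt0// ltr_wpDl.
  have sT : s * size_of V1 setT <= eta / 4.
    rewrite /s -mulrA ger_pMr// ler_pdivrMl ?ltr_wpDl// mulr1.
    by rewrite lerDl.
  exists (s * d / 2) => [|k uk]; first by rewrite divr_gt0// mulr_gt0.
  have [ck k01] := uk; rewrite mass_integration_form// => km.
  have mB := rc_measurable_ge s ck.
  set B : set (borel G) := [set t | s <= k t] in mB.
  have lo := ri_lower cptG V2 mB ck (fun t => unit_fun_ge0 t uk) (fun t (st : B t) => st).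
  have V2B : (V2 B < d%:E)%E.
    rewrite (size_ofE V2 mB) lte_fin -(ltr_pM2l s0).
    apply: le_lt_trans lo _; apply: le_lt_trans km _.
    by apply: half_lt; rewrite mulr_gt0.
  have V1B := hd _ mB V2B; rewrite (size_ofE V1 mB) lee_fin in V1B.
  have hi : ri V1 k <= s * size_of V1 setT + size_of V1 B.
    apply: ri_upper => //; first exact: ltW.
    by move=> t /negP; rewrite -ltNge => /ltW.
  apply: le_trans (tv_le_variation cptG j mu1 uk) _.
  rewrite mulrC -ler_pdivlMr//; apply: le_trans hi _; apply: le_trans (lerD sT V1B) _.
  by have -> : eta / 4 + eta / 4 = eta / 2 by field.
apply/absolutely_continuousE => E mE /(size_eq0 V2 mE) V20; apply/(size_eq0 V1 mE)/eqP.
rewrite eq_le size_of_ge0 andbT; apply/ler_addgt0Pr => e e0; rewrite add0r.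
have e4 : 0 < e / 4 by rewrite divr_gt0.
have [d d0 hd] := h _ e4.
have m0 : 0 < Num.min d (e / 4) by rewrite lt_min d0.
have [w [uw]] := approx mE m0; have [cw _] := uw.
rewrite V20 subr0 !le_min => /andP[_ w1] /andP[w2 _].
have t1 : tv j phi1 w <= e / 4.
  by apply: hd => //; rewrite mass_integration_form// (le_trans (ler_norm _) w2).
have v1 := variation_le_tv cptG hausG j reg1 uw.
have -> : e = 2 * (e / 4) + 2 * (e / 4) by field.
apply: le_trans (_ : ri V1 w + e / 4 <= _).
  by rewrite -lerBlDl; apply: le_trans w1; rewrite distrC ler_norm.
apply: lerD; last by rewrite mulr2n mulrDl mul1r lerDl ltW.
by apply: le_trans v1 _; rewrite ler_pM2l.
Qed.

(** A Urysohn approximation [w] of [E] has small [V1]-mass while [1 - w] has small [V2]-mass, so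
    both halves of [v] in [tv_split] are small. *)
Let separated (E : set (borel G)) : measurable E -> V1 E = 0%E -> V2 (~` E) = 0%E ->
  forall v, ac j (form V1) v -> ac j (form V2) v -> v = 0.
Proof.
move=> mE /(size_eq0 V1 mE) V10 V20 v ac1 ac2; apply: rnorm_small => e e0.
have e2 : 0 < e / 2 by rewrite divr_gt0.
have [d1 d10 h1] := ac1 _ e2; have [d2 d20 h2] := ac2 _ e2.
have m0 : 0 < Num.min d1 d2 by rewrite lt_min d10.
have [w [uw]] := approx mE m0; have [cw w01] := uw; have uw' := unit_funC uw.
have [cw' _] := uw'.
rewrite V10 subr0 !le_min => /andP[w1 _] /andP[_ w2].
have sT : size_of V2 setT = size_of V2 E.
  rewrite /size_of -(setvU E) measureU//; last exact: setICl.
    by rewrite [X in (X + _)%E]V20 add0e.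
  exact: measurableC.
rewrite (tv_split j v uw) [e]splitr; apply: lerD.
  by apply: h1 => //; rewrite mass_integration_form// (le_trans (ler_norm _) w1).
apply: h2 => //; rewrite mass_integration_form//.
rewrite (riB cptG V2 (rc_cst (1 : R)) cw) ri_cst mul1r sT.
by apply: le_trans w2; rewrite distrC ler_norm.
Qed.

(** Borel-Cantelli: [E] is the upper limit of the sets [F n] where a cut-off is at least one half.
    Their [V1]-sizes are summable, and the [V2]-sizes of their complements tend to 0. *)
Let separation : ac_part j (form V2) phi1 0 -> exists E : set (borel G),
  [/\ measurable E, V1 E = 0%E & V2 (~` E) = 0%E].
Proof.
(* The factor [8^-1] absorbs the constant 4 of [F1], which keeps the sizes of the [F n] below the
   summable bound of [epsilon_trick0]. *)
move=> [_ h]; pose e n : R := 8^-1 / (2 ^ n.+1)%:R.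
have e0 n : 0 < e n by rewrite !divr_gt0// ltr0n expn_gt0.
have {h}/choice[w hw] n : exists w, [/\ unit_fun w, ri V2 (fun t => 1 - w t) <= e n &
    tv j phi1 w <= e n].
  have [w [uw]] := h _ (e0 n); have [cw' _] := unit_funC uw.
  by rewrite mass_integration_form// subr0 => ? ?; exists w.
pose F n : set (borel G) := [set t | 2^-1 <= w n t].
have mF n : measurable (F n) by apply: rc_measurable_ge; have [[]] := hw n.
have F1 n : size_of V1 (F n) <= 4 * e n.
  have [uw _ t1] := hw n; have [cw _] := uw.
  have v1 := variation_le_tv cptG hausG j reg1 uw.
  have lo := ri_lower cptG V1 (mF n) cw (fun t => unit_fun_ge0 t uw) (fun t (st : F n t) => st).
  have -> : 4 * e n = 2 * (2 * e n) by ring.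
  rewrite -ler_pdivrMl//; apply: le_trans lo _; apply: le_trans v1 _.
  by rewrite ler_pM2l.
have F2 n : size_of V2 (~` F n) <= 2 * e n.
  have [uw w1 _] := hw n; have uw' := unit_funC uw; have [cw' _] := uw'.
  rewrite -ler_pdivrMl//; apply: le_trans w1; apply: ri_lower => //.
  - exact: measurableC.
  - by move=> t; exact: (unit_fun_ge0 t uw').
  - by move=> t /negP; rewrite -ltNge => /ltW wt; lra.
have en (c : R) : 0 < c -> exists n, forall k, (n <= k)%N -> e k <= c.
  move=> c0; have [n hn] := small_inv c0; exists n => k nk; apply: le_trans (hn k nk).
  apply: (@le_trans _ _ (2 ^ k.+1)%:R^-1); first by rewrite ler_piMl ?invf_le1 ?ler1n.
  by rewrite lef_pV2 ?posrE ?ltr0n ?expn_gt0// ler_nat ltnW// ltn_expl.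
exists (lim_sup_set F); split.
- by apply: bigcap_measurable => // n _; exact: bigcup_measurable.
- apply: lim_sup_set_cvg0 => //; apply: (@le_lt_trans _ _ 1%:E); last exact: ltry.
  apply: le_trans (epsilon_trick0 xpredT (ler01 : 0 <= 1 :> R)).
  apply: lee_nneseries => [n _ _|n _]; first exact: measure_ge0.
  rewrite [X in (X <= _)%E](size_ofE V1 (mF n)) lee_fin.
  apply: le_trans (F1 n) _; rewrite /e mulrA ler_pM2r ?invr_gt0 ?ltr0n ?expn_gt0//.
  by lra.
- rewrite /lim_sup_set setC_bigcap; apply/negligibleP.
    by apply: bigcupT_measurable => n; apply: measurableC; exact: bigcup_measurable.
  apply: negligible_bigcup => n; apply/negligibleP.
    by apply: measurableC; exact: bigcup_measurable.
  have mC : measurable (~` \bigcup_(k >= n) F k) by apply: measurableC; exact: bigcup_measurable.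
  apply/(size_eq0 V2 mC)/eqP; rewrite eq_le size_of_ge0 andbT.
  apply/ler_addgt0Pr => c c0; rewrite add0r; have c2 : 0 < c / 2 by rewrite divr_gt0.
  have [m hm] := en _ c2; pose k := maxn n m.
  apply: le_trans (_ : 2 * e k <= _); last first.
    by rewrite -ler_pdivlMl// mulrC hm// leq_maxr.
  apply: le_trans (F2 k); apply: size_of_mono => //; first exact: measurableC.
  by apply: subsetC; apply: bigcup_sup; rewrite /= leq_maxl.
Qed.

Lemma measure_dictionary :
  (absolutely_continuous mu1 mu2 <-> functional_ll phi1 phi2) /\
  (mutually_singular mu1 mu2 <-> functional_perp phi1 phi2).
Proof.
split.
  split=> [/ac_mass h|/(functional_llE equiv1 equiv2) h]; last exact/ac_mass.
  exact/(functional_llE equiv1 equiv2).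
rewrite mutually_singularE; split=> [[E [mE V10 V20]]|].
  by apply/(functional_perpE equiv1 equiv2); exact: separated V20.
by move=> /(functional_perp_part equiv1 equiv2)/separation.
Qed.

End dictionary.

Lemma measure_functional_represents {R : realType} {G : topologicalZmodType} {A : cstarType R}
    (cptG : compact [set: G]) (hausG : hausdorff_space G)
    (u : dual_group R G -> A) (Au : full_group_cstar u) (mu : cmeasure (borel G) R) :
  represents u (fourier_stieltjes mu)
    (measure_functional cptG (gelfand_rep cptG hausG Au) mu).
Proof.
move=> s x; rewrite raddf_sum; apply: eq_bigr => g _.
transitivity (x g * measure_functional cptG (gelfand_rep cptG hausG Au) mu (u g)).
  exact: dualZ.
rewrite mulrC; congr (_ * _); rewrite measure_functionalE; congr cintegral; apply/funext => t /=.
have -> : u g = @comb _ _ _ u [:: (1, g)] by rewrite /comb big_seq1 scale1r.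
by rewrite gelfand_comb /trig big_seq1 mul1r.
Qed.

Theorem proposition4p11 (R : realType) (G : topologicalZmodType)
    (cptG : compact [set: G]%classic) (hausG : hausdorff_space G)
    (A : cstarType R) (u : dual_group R G -> A) (Au : full_group_cstar u)
    (mu1 mu2 : cmeasure (borel G) R) (reg1 : regular mu1) (reg2 : regular mu2) :
  exists phi1 phi2 : dual A,
    [/\ represents u (fourier_stieltjes mu1) phi1,
        represents u (fourier_stieltjes mu2) phi2,
        absolutely_continuous mu1 mu2 <-> functional_ll phi1 phi2 &
        mutually_singular mu1 mu2 <-> functional_perp phi1 phi2].
Proof.
pose j := gelfand_rep cptG hausG Au.
exists (measure_functional cptG j mu1), (measure_functional cptG j mu2).
have [ll perp] := measure_dictionary cptG hausG j reg1 reg2.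
by split=> //; exact: measure_functional_represents.
Qed.
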